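(* Let $\mathbb K$ be a field, let $p(z)$ be a non-constant Hilbert polynomial, and let $\mathbf{Hilb}^{p(z)}_{\mathbb P^n}$ be the Hilbert scheme parameterizing closed subschemes of $\mathbb P^n_{\mathbb K}$ with Hilbert polynomial $p(z)$. The arithmetically Gorenstein locus in $\mathbf{Hilb}^{p(z)}_{\mathbb P^n}$ is an open subset.
   Context: A closed projective scheme in $\mathbb P^n$ defined by a homogeneous ideal $I\subset\mathbb K[x_0,\dots,x_n]$ is arithmetically Gorenstein if the saturated ideal $I^{sat}$ is Gorenstein, i.e. $\mathbb K[x_0,\dots,x_n]/I^{sat}$ is a Gorenstein ring. The arithmetically Gorenstein locus is the subset of points of the Hilbert scheme corresponding to arithmetically Gorenstein schemes, where a point with residue field $\kappa$ corresponds to a closed subscheme of $\mathbb P^n_\kappa$ with Hilbert polynomial $p(z)$. *)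

(* Defs.v *)
From HB Require Import structures.
From mathcomp Require Import all_boot all_order all_algebra.
From mathcomp Require Import mpoly.
From mathcomp Require Import boolp classical_sets filter topology_structure.

Set Implicit Arguments.
Unset Strict Implicit.
Unset Printing Implicit Defensive.

Import GRing.Theory.
Local Open Scope classical_set_scope.
Local Open Scope ring_scope.

(** * Commutative algebra *)

Definition is_ideal (A : comNzRingType) (I : set A) : Prop :=
  [/\ I 0, forall a b, I a -> I b -> I (a + b) & forall a b, I b -> I (a * b)].

Definition prime_ideal (A : comNzRingType) (P : set A) : Prop :=
  [/\ is_ideal P, ~ P 1 & forall a b, P (a * b) -> P a \/ P b].

Definition ideal_gen (A : comNzRingType) (G : set A) : set A :=
  smallest (@is_ideal A) G.

Definition noetherian (A : comNzRingType) : Prop :=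
  forall I : set A, is_ideal I -> exists s : seq A, I = ideal_gen [set` s].

Definition is_quotient (A : comNzRingType) (I : set A)
    (Q : comNzRingType) (pi : {rmorphism A -> Q}) : Prop :=
  (forall q, exists a, pi a = q) /\ (forall a, pi a = 0 <-> I a).

(* L is the localization A_P. *)
Definition is_localization (A : comNzRingType) (P : set A)
    (L : comNzRingType) (phi : {rmorphism A -> L}) : Prop :=
  [/\ forall s, ~ P s -> exists u, phi s * u = 1,
      forall l, exists a s, ~ P s /\ phi s * l = phi a
    & forall a, phi a = 0 <-> exists s, ~ P s /\ s * a = 0].

Definition injective_module (R : comNzRingType) (E : lmodType R) : Prop :=
  forall (M N : lmodType R) (i : {linear M -> N}) (f : {linear M -> E}),
    injective i -> exists g : {linear N -> E}, forall m, g (i m) = f m.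

(* [injdim_le d M]: M has an injective resolution
   0 -> M -> E_0 -> ... -> E_d -> 0, built one short exact sequence
   0 -> M -> E -> C -> 0 at a time. *)
Inductive injdim_le (R : comNzRingType) : nat -> lmodType R -> Prop :=
| Injdim0 (M : lmodType R) : injective_module M -> injdim_le 0 M
| InjdimS (d : nat) (M E C : lmodType R)
    (f : {linear M -> E}) (g : {linear E -> C}) :
    injective_module E -> injective f -> (forall c, exists e, g e = c) ->
    (forall e, g e = 0 <-> exists m, f m = e) ->
    injdim_le d C -> injdim_le d.+1 M.

(* Bass: Noetherian, and every localization at a prime has finite injective
   dimension over itself. *)
Definition gorenstein_ring (R : comNzRingType) : Prop :=
  noetherian R /\
  forall (P : set R) (L : comNzRingType) (phi : {rmorphism R -> L}),
    prime_ideal P -> is_localization P phi ->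
    exists d, injdim_le d (L^o : lmodType L).

(* Flatness over A of the quotient of M by its submodule N, by the equational
   criterion: every linear relation in M / N follows from relations in A. *)
Definition flat_quotient (A : comNzRingType) (M : lmodType A) (N : set M) :=
  forall (k : nat) (a : 'I_k -> A) (m : 'I_k -> M),
    N (\sum_i a i *: m i) ->
    exists (l : nat) (c : 'I_k -> 'I_l -> A) (m' : 'I_l -> M),
      (forall i, N (m i - \sum_j c i j *: m' j)) /\
      (forall j, \sum_i a i * c i j = 0).

(** * Homogeneous ideals of A[x_0, ..., x_n] *)

Definition homog_ideal (n : nat) (A : comNzRingType)
    (I : set {mpoly A[n.+1]}) : Prop :=
  is_ideal I /\ forall f d, I f -> I (pihomog mdeg d f).

Definition sat (n : nat) (A : comNzRingType) (I : set {mpoly A[n.+1]}) :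
    set {mpoly A[n.+1]} :=
  [set f | exists N, forall m : 'X_{1..n.+1}, mdeg m = N -> I ('X_[m] * f)].

Definition ext_ideal (n : nat) (A B : comNzRingType) (phi : A -> B)
    (I : set {mpoly A[n.+1]}) : set {mpoly B[n.+1]} :=
  ideal_gen (map_mpoly phi @` I).

(* A[x] / (I, x_i - 1) is the coordinate ring of the affine chart x_i <> 0 of
   Proj (A[x] / I). *)
Definition chart_ideal (n : nat) (A : comNzRingType)
    (I : set {mpoly A[n.+1]}) (i : 'I_n.+1) : set {mpoly A[n.+1]} :=
  ideal_gen (I `|` [set 'X_i - 1]).

Definition flat_proj (n : nat) (A : comNzRingType) (I : set {mpoly A[n.+1]}) :
    Prop :=
  forall i : 'I_n.+1, flat_quotient (chart_ideal I i).

(* dim_k (k[x] / I)_t = r *)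
Definition hilbert_fun_is (n : nat) (k : fieldType) (I : set {mpoly k[n.+1]})
    (t r : nat) : Prop :=
  exists b : 'I_r -> {mpoly k[n.+1]},
    (forall j, b j \is t.-homog) /\
    forall f, f \is t.-homog ->
      exists! c : 'I_r -> k, I (f - \sum_j c j *: b j).

Definition has_hilbert_poly (n : nat) (k : fieldType)
    (I : set {mpoly k[n.+1]}) (p : {poly rat}) : Prop :=
  exists t0, forall t, (t0 <= t)%N ->
    exists r, hilbert_fun_is I t r /\ p.[t%:R] = r%:R.

(* p is the Hilbert polynomial of some closed subscheme of P^n over k. *)
Definition is_hilbert_polynomial (k : fieldType) (n : nat) (p : {poly rat}) :
    Prop :=
  exists I : set {mpoly k[n.+1]}, homog_ideal I /\ has_hilbert_poly I p.

(* k[x] / I^sat is Gorenstein. *)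
Definition arith_gorenstein (n : nat) (k : fieldType)
    (I : set {mpoly k[n.+1]}) : Prop :=
  exists (Q : comNzRingType) (pi : {rmorphism {mpoly k[n.+1]} -> Q}),
    is_quotient (sat I) pi /\ gorenstein_ring Q.

(** * Schemes over a field *)

(* Sections of a sheaf are taken over nonempty opens only.  In a locally ringed
   space these section rings are nonzero, and the zero ring over the empty open
   carries no information; omitting it lets section rings be [comNzRingType]s,
   as polynomial rings require. *)
Record nopen (X : topologicalType) := Nopen {
  pts :> set X;
  nopen_open : open pts;
  nopen_nonempty : pts !=set0
}.

Record ringed_space (K : fieldType) := RingedSpace {
  space :> topologicalType;
  sec : nopen space -> comAlgType K;
  res : forall U V : nopen space, V `<=` U -> {lrmorphism sec U -> sec V};
  res_id : forall (U : nopen space) (h : U `<=` U) s, res h s = s;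
  res_comp : forall (U V W : nopen space)
    (hVU : V `<=` U) (hWV : W `<=` V) (hWU : W `<=` U) s,
    res hWV (res hVU s) = res hWU s;
  res_glue : forall (U : nopen space) (C : set (nopen space))
    (s : forall V, sec V),
    (forall V, C V -> V `<=` U) ->
    (forall x, pts U x -> exists2 V, C V & pts V x) ->
    (forall (V V' W : nopen space) (h : W `<=` V) (h' : W `<=` V'),
      C V -> C V' -> res h (s V) = res h' (s V')) ->
    exists! t : sec U, forall (V : nopen space) (h : V `<=` U),
      C V -> res h t = s V
}.
Arguments res {K} r {U V}.

Section Schemes.
Variable K : fieldType.
Implicit Types X Y T : ringed_space K.

(* The germ of s at x is a unit of the stalk. *)
Definition germ_unit X (x : X) (U : nopen X) (s : sec U) : Prop :=
  exists (V : nopen X) (h : V `<=` U),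
    pts V x /\ exists t, res X h s * t = 1.

(* The nonunits of each stalk are closed under addition; stalks are nonzero
   because all section rings are. *)
Definition locally_ringed X : Prop :=
  forall (x : X) (U : nopen X) (s t : sec U), pts U x ->
    germ_unit x (s + t) -> germ_unit x s \/ germ_unit x t.

(* The prime of O(U) at which x lies under the canonical map U -> Spec O(U). *)
Definition point_ideal X (U : nopen X) (x : X) : set (sec U) :=
  [set s | ~ germ_unit x s].
Arguments point_ideal {X} U x.

Definition basic_open X (U : nopen X) (f : sec U) : set X :=
  [set x | pts U x /\ germ_unit x f].

(* U -> Spec O(U) is an isomorphism: a bijection on points, a homeomorphism,
   and O(D(f)) = O(U)_f. *)
Definition affine X (U : nopen X) : Prop :=
  [/\ forall P : set (sec U), prime_ideal P ->
        exists! x, pts U x /\ P = point_ideal U x,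
      forall (W : nopen X) x, W `<=` U -> pts W x ->
        exists f : sec U, basic_open f x /\ basic_open f `<=` W
    & forall (f : sec U) (V : nopen X) (h : V `<=` U),
        (V : set X) = basic_open f ->
        (forall a, res X h a = 0 -> exists k, f ^+ k * a = 0) /\
        (forall s, exists k a, res X h f ^+ k * s = res X h a)].

Definition loc_noeth_scheme X : Prop :=
  locally_ringed X /\
  forall x : X, exists U : nopen X, [/\ pts U x, affine U & noetherian (sec U)].

(* [comor U V h] is the composite O_Y(U) -> O_X(f^-1 U) -> O_X(V). *)
Record morphism X Y := Morphism {
  mfun :> X -> Y;
  mfun_cont : continuous mfun;
  comor : forall (U : nopen Y) (V : nopen X), V `<=` mfun @^-1` U ->
    {lrmorphism sec U -> sec V};
  comor_res : forall (U U' : nopen Y) (V V' : nopen X)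
    (h : V `<=` mfun @^-1` U) (h' : V' `<=` mfun @^-1` U')
    (hU : U' `<=` U) (hV : V' `<=` V) s,
    res X hV (comor h s) = comor h' (res Y hU s);
  comor_local : forall (U : nopen Y) (V : nopen X)
    (h : V `<=` mfun @^-1` U) x s, pts V x ->
    germ_unit x (comor h s) -> germ_unit (mfun x) s
}.

Definition mor_eq X Y (f g : morphism X Y) : Prop :=
  f =1 g /\
  forall (U : nopen Y) (V : nopen X) (hf : V `<=` f @^-1` U)
    (hg : V `<=` g @^-1` U) s, comor hf s = comor hg s.

(* [ev] presents kappa as the residue field of the stalk at x: it is onto, and
   a germ is killed iff it is not a unit. *)
Record residue_field X (x : X) (kappa : fieldType) := ResidueField {
  ev : forall U : nopen X, pts U x -> {rmorphism sec U -> kappa};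
  ev_res : forall (U V : nopen X) (Ux : pts U x) (Vx : pts V x)
    (h : V `<=` U) s,
    ev Vx (res X h s) = ev Ux s;
  ev_surj : forall c, exists (U : nopen X) (Ux : pts U x) s, ev Ux s = c;
  ev_eq0 : forall (U : nopen X) (Ux : pts U x) s,
    ev Ux s = 0 <-> ~ germ_unit x s
}.

(** * The Hilbert scheme *)

Variable n : nat.

(* A closed subscheme of P^n_T: over each affine open U, the saturated
   homogeneous ideal of its restriction to P^n_U.  The values at opens that are
   not affine are irrelevant. *)
Record closed_subscheme T := ClosedSubscheme {
  ideal_at : forall U : nopen T, set {mpoly (sec U)[n.+1]};
  ideal_at_homog : forall U, affine U -> homog_ideal (@ideal_at U);
  ideal_at_sat : forall U, affine U -> sat (@ideal_at U) = @ideal_at U;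
  ideal_at_res : forall (U V : nopen T) (h : V `<=` U), affine U -> affine V ->
    @ideal_at V = sat (ext_ideal (res T h) (@ideal_at U))
}.
Arguments ideal_at {T} c U.

Definition is_pullback T Y (f : morphism T Y)
    (Z : closed_subscheme Y) (W : closed_subscheme T) : Prop :=
  forall (U : nopen Y) (V : nopen T) (h : V `<=` f @^-1` U),
    affine U -> affine V ->
    ideal_at W V = sat (ext_ideal (comor h) (ideal_at Z U)).

(* The ideal in kappa[x_0, ..., x_n] of the fibre at x, for kappa the residue
   field of x in U. *)
Definition fibre_ideal T (Z : closed_subscheme T) (x : T) (kappa : fieldType)
    (r : residue_field x kappa) (U : nopen T) (Ux : pts U x) :
    set {mpoly kappa[n.+1]} :=
  ext_ideal (ev r Ux) (ideal_at Z U).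

Definition flat_family (p : {poly rat}) T (Z : closed_subscheme T) : Prop :=
  forall U : nopen T, affine U ->
    flat_proj (ideal_at Z U) /\
    forall (x : T) (kappa : fieldType) (r : residue_field x kappa)
      (Ux : pts U x),
      has_hilbert_poly (fibre_ideal Z r Ux) p.

(* H with the universal family Z represents the functor taking a locally
   Noetherian K-scheme T to the set of closed subschemes of P^n_T that are flat
   over T with Hilbert polynomial p. *)
Definition is_hilbert_scheme (p : {poly rat}) (H : ringed_space K)
    (Z : closed_subscheme H) : Prop :=
  [/\ loc_noeth_scheme H, flat_family p Z
    & forall (T : ringed_space K) (W : closed_subscheme T),
        loc_noeth_scheme T -> flat_family p W ->
        (exists f : morphism T H, is_pullback f Z W) /\
        (forall f g : morphism T H,
           is_pullback f Z W -> is_pullback g Z W -> mor_eq f g)].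

Definition arith_gorenstein_locus (H : ringed_space K)
    (Z : closed_subscheme H) : set H :=
  [set x | exists (kappa : fieldType) (r : residue_field x kappa)
      (U : nopen H) (Ux : pts U x),
      affine U /\ arith_gorenstein (fibre_ideal Z r Ux)].

End Schemes.

(* Main.v *)
(** Let J be the saturated ideal of a Gorenstein fibre.  The local ring of k[x]/J
    at the vertex has finite injective dimension.  By Rees' change of rings, this
    remains so modulo a maximal regular sequence of forms y_1, ..., y_r, where it
    makes the Artinian quotient self-injective.  So k[x]/J has a finite basis of
    monomials e_l over k[Y_1, ..., Y_r], and for some l_0 the matrix of the
    l_0-coordinates of the products e_i e_j is invertible at Y = 0; its
    determinant is weighted homogeneous, hence constant.  Conversely, an algebra
    with such a basis over k[Y] is a Frobenius extension of k[Y], hence Gorenstein.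

    Over an affine open with coordinate ring A, lift the y_i to A.  By Nakayama's
    lemma in each degree, the e_l generate over some A_f in a finite window of
    degrees, hence over every point of D(f) in all large degrees, where they are
    independent because the Hilbert polynomial has not changed.  As p is not
    constant, r >= 2, and divisibility by powers of y_1 and y_2 extends this to the
    small degrees of the saturation.  Finally D(f) is shrunk so that the pairing
    of the e_l remains nondegenerate. *)

From HB Require Import structures.
Require Import Defs.
From mathcomp Require Import all_boot all_order all_algebra.
From mathcomp Require Import perm mpoly.
From mathcomp Require Import boolp classical_sets filter topology_structure.
From mathcomp Require Import ring zify.

Set Implicit Arguments.
Unset Strict Implicit.
Unset Printing Implicit Defensive.

Import GRing.Theory.
Local Open Scope classical_set_scope.
Local Open Scope ring_scope.

(** * Quotients *)

(** The Gorenstein property speaks of injective resolutions, so it has to be traded for solvability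
    of linear systems: Ext is expressed by matrices of syzygies, and Baer's criterion, together with
    enough injectives over an algebra over a field, turns its vanishing for ideals back into
    resolutions. No theory of depth, dimension or canonical modules enters: the regular sequence is
    found by Noetherian induction, and its end is recognized by a socle element.

    The basis serves to replace the property by finitely many relations and one nonvanishing
    determinant, since such data spread from a point to a neighbourhood. Its elements are monomials
    so that they make sense over every coefficient ring. The obstacle is that over the coordinate
    ring nothing is known in small degrees, where the fibres still have to be saturated. Hence
    products of basis elements are multiplied by a high power of one lifted form before they are
    expanded, and the pairing is read off from the coefficients of that power. *)

Section SetoidQuotient.
Variables (T : Type) (E : T -> T -> Prop).
Hypotheses (Er : forall t, E t t) (Es : forall t u, E t u -> E u t)
  (Et : forall t u v, E t u -> E u v -> E t v).

(** The witness is chosen from the predicate [E t], which depends only on the class of [t]; this is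
    what makes [canon_eq] true. *)
Definition canon (t : T) : T := projT1 (cid (ex_intro (E t) t (Er t))).

Lemma canonP t : E t (canon t).
Proof. exact: (projT2 (cid (ex_intro (E t) t (Er t)))). Qed.

Lemma canon_eq t u : E t u -> canon t = canon u.
Proof.
move=> tu; have eEtu : E t = E u.
  apply/funext => v; apply/propext; split; first exact/Et/Es.
  exact: Et.
rewrite /canon; move: (ex_intro (E t) t (Er t)) (ex_intro (E u) u (Er u)).
by rewrite eEtu => p q; congr (projT1 (cid _)); exact: Prop_irrelevance.
Qed.

Definition squot := {t : T | canon t = t}.
HB.instance Definition _ := gen_eqMixin squot.
HB.instance Definition _ := gen_choiceMixin squot.

Definition scls (t : T) : squot :=
  exist _ (canon t) (esym (canon_eq (canonP t))).

Lemma sclsP t u : scls t = scls u <-> E t u.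
Proof.
split=> [[] eq_tu|tu]; last exact/eq_exist/canon_eq.
by apply: Et (canonP t) _; rewrite eq_tu; apply/Es/canonP.
Qed.

Lemma scls_val (x : squot) : scls (sval x) = x.
Proof. by case: x => t et; apply: eq_exist. Qed.

Variables (add : T -> T -> T) (zero : T) (opp : T -> T).
Hypotheses (addE : forall a b c d, E a b -> E c d -> E (add a c) (add b d))
  (oppE : forall a b, E a b -> E (opp a) (opp b))
  (addA : forall a b c, E (add a (add b c)) (add (add a b) c))
  (addC : forall a b, E (add a b) (add b a))
  (add0 : forall a, E (add zero a) a)
  (addN : forall a, E (add (opp a) a) zero).

Definition sq2 (f : T -> T -> T) (x y : squot) := scls (f (sval x) (sval y)).

Lemma sq2E f : (forall a b c d, E a b -> E c d -> E (f a c) (f b d)) ->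
  forall a b, sq2 f (scls a) (scls b) = scls (f a b).
Proof. by move=> fE a b; apply/sclsP/fE; apply/Es/canonP. Qed.

Let opq (x : squot) := scls (opp (sval x)).
Let opqE a : opq (scls a) = scls (opp a).
Proof. by apply/sclsP/oppE/Es/canonP. Qed.

Let addqA : associative (sq2 add).
Proof.
move=> x y z; rewrite -[x]scls_val -[y]scls_val -[z]scls_val.
by rewrite !sq2E //; apply/sclsP.
Qed.
Let addqC : commutative (sq2 add).
Proof.
by move=> x y; rewrite -[x]scls_val -[y]scls_val !sq2E //; apply/sclsP.
Qed.
Let addq0 : left_id (scls zero) (sq2 add).
Proof. by move=> x; rewrite -[x]scls_val !sq2E //; apply/sclsP. Qed.
Let addqN : left_inverse (scls zero) opq (sq2 add).
Proof. by move=> x; rewrite -[x]scls_val opqE !sq2E //; apply/sclsP. Qed.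

Let zm := GRing.isZmodule.Build squot addqA addqC addq0 addqN.
Let zmodT : zmodType := HB.pack squot zm.

(** Quotients, submodules, restrictions of scalars and coinduced modules are all obtained from it by
    checking the axioms up to [E]. *)
Lemma setoid_lmodule (R : pzRingType) (scale : R -> T -> T) :
  (forall x a b, E a b -> E (scale x a) (scale x b)) ->
  (forall x y a, E (scale x (scale y a)) (scale (x * y) a)) ->
  (forall a, E (scale 1 a) a) ->
  (forall x a b, E (scale x (add a b)) (add (scale x a) (scale x b))) ->
  (forall a x y, E (scale (x + y) a) (add (scale x a) (scale y a))) ->
  exists (W : lmodType R) (c : T -> W), [/\ forall w, exists t, c t = w,
    forall t u, c t = c u <-> E t u, forall t u, c (add t u) = c t + c u
    & forall x t, c (scale x t) = x *: c t].
Proof.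
move=> scE scA sc1 scDr scDl.
pose sc x (q : zmodT) : zmodT := scls (scale x (sval q)).
have scq x t : sc x (scls t) = scls (scale x t).
  by apply/sclsP/scE/Es/canonP.
have scqA x y q : sc x (sc y q) = sc (x * y) q.
  by rewrite -[q]scls_val !scq; apply/sclsP.
have scq1 : left_id 1 sc.
  by move=> q; rewrite -[q]scls_val !scq; apply/sclsP.
have scqDr : right_distributive sc +%R.
  move=> x q q'; rewrite -[q]scls_val -[q']scls_val.
  by rewrite [_ + _]sq2E // !scq [in RHS]/GRing.add /= sq2E //; apply/sclsP.
have scqDl q : {morph sc^~ q : x y / x + y}.
  move=> x y; rewrite -[q]scls_val !scq [in RHS]/GRing.add /= sq2E //.
  exact/sclsP.
pose lm := GRing.Zmodule_isLmodule.Build R zmodT scqA scq1 scqDr scqDl.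
pose W : lmodType R := HB.pack squot zm lm.
exists W, scls; split.
- by move=> w; exists (sval w); exact: scls_val.
- exact: sclsP.
- by move=> t u; rewrite -[scls (add t u)]sq2E.
- by move=> x t; exact/esym/scq.
Qed.

Lemma setoid_comring (mul : T -> T -> T) (one : T) :
  (forall a b c d, E a b -> E c d -> E (mul a c) (mul b d)) ->
  (forall a b c, E (mul a (mul b c)) (mul (mul a b) c)) ->
  (forall a b, E (mul a b) (mul b a)) ->
  (forall a, E (mul one a) a) ->
  (forall a b c, E (mul (add a b) c) (add (mul a c) (mul b c))) ->
  ~ E one zero ->
  exists (W : comNzRingType) (c : T -> W), [/\ forall w, exists t, c t = w,
    forall t u, c t = c u <-> E t u, forall t u, c (add t u) = c t + c u,
    forall t u, c (mul t u) = c t * c u & c one = 1].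
Proof.
move=> mulE mulA mulC mul1 mulD one0.
have mqA : associative (sq2 mul).
  move=> x y z; rewrite -[x]scls_val -[y]scls_val -[z]scls_val.
  by rewrite !sq2E //; apply/sclsP.
have mqC : commutative (sq2 mul).
  by move=> x y; rewrite -[x]scls_val -[y]scls_val !sq2E //; apply/sclsP.
have mq1 : left_id (scls one) (sq2 mul).
  by move=> x; rewrite -[x]scls_val !sq2E //; apply/sclsP.
have mqD : left_distributive (sq2 mul : zmodT -> zmodT -> zmodT) +%R.
  move=> x y z; rewrite -[x]scls_val -[y]scls_val -[z]scls_val.
  by rewrite /GRing.add /= !sq2E //; apply/sclsP.
have one_neq0 : (scls one : zmodT) != 0 by apply/eqP => /sclsP.
pose rg := GRing.Zmodule_isComNzRing.Build zmodT mqA mqC mq1 mqD one_neq0.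
pose W : comNzRingType := HB.pack squot zm rg.
exists W, scls; split=> //.
- by move=> w; exists (sval w); exact: scls_val.
- exact: sclsP.
- by move=> t u; rewrite -[scls (add t u)]sq2E.
- by move=> t u; rewrite -[scls (mul t u)]sq2E.
Qed.

End SetoidQuotient.

Lemma linear_of_fun (R : pzRingType) (U V : lmodType R) (f : U -> V) :
  (forall u v, f (u + v) = f u + f v) -> (forall a u, f (a *: u) = a *: f u) ->
  exists g : {linear U -> V}, forall u, g u = f u.
Proof.
move=> fD fZ.
have fL : linear f by move=> a u v; rewrite fD fZ.
pose g : {linear U -> V} := HB.pack f (GRing.isLinear.Build R U V _ f fL).
by exists g.
Qed.

Lemma rmorphism_of_fun (A B : pzRingType) (f : A -> B) :
  (forall u v, f (u + v) = f u + f v) -> (forall u v, f (u * v) = f u * f v) ->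
  f 1 = 1 -> exists g : {rmorphism A -> B}, forall u, g u = f u.
Proof.
move=> fD fM f1.
have f0 : f 0 = 0 by apply: (addrI (f 0)); rewrite -fD !addr0.
have fN u : f (- u) = - f u.
  by apply: (addrI (f u)); rewrite -fD !subrr.
have fB : zmod_morphism f by move=> u v; rewrite fD fN.
have fM1 : monoid_morphism f by split.
pose g : {rmorphism A -> B} := HB.pack f
  (GRing.isZmodMorphism.Build A B f fB) (GRing.isMonoidMorphism.Build A B f fM1).
by exists g.
Qed.

(** * Submodules, ideals and their quotients *)

Definition submodule (R : pzRingType) (V : lmodType R) (D : set V) : Prop :=
  [/\ D 0, forall u v, D u -> D v -> D (u + v) & forall a u, D u -> D (a *: u)].

Lemma submoduleN (R : pzRingType) (V : lmodType R) (D : set V) u :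
  submodule D -> D u -> D (- u).
Proof. by move=> [_ _ DZ] Du; rewrite -scaleN1r; apply: DZ. Qed.

Lemma submoduleB (R : pzRingType) (V : lmodType R) (D : set V) u v :
  submodule D -> D u -> D v -> D (u - v).
Proof. by move=> sD Du Dv; case: (sD) => _ DD _; apply: DD => //; apply: submoduleN. Qed.

Lemma submodule_sum (R : pzRingType) (V : lmodType R) (D : set V) (I : Type)
    (r : seq I) (P : pred I) (F : I -> V) :
  submodule D -> (forall i, P i -> D (F i)) -> D (\sum_(i <- r | P i) F i).
Proof.
case=> D0 DD _ DF; elim/big_rec: _ => // i x Pi Dx.
by apply: DD => //; exact: DF.
Qed.

Section Ideals.
Variables (A : comNzRingType) (I : set A).
Hypothesis idI : is_ideal I.

Lemma ideal0 : I 0. Proof. by case: idI. Qed.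
Lemma idealD a b : I a -> I b -> I (a + b). Proof. by case: idI => _ h _; apply: h. Qed.
Lemma idealMl a b : I b -> I (a * b). Proof. by case: idI => _ _ h; apply: h. Qed.
Lemma idealMr a b : I a -> I (a * b).
Proof. by rewrite mulrC; apply: idealMl. Qed.
Lemma idealN a : I a -> I (- a).
Proof. by rewrite -mulN1r; apply: idealMl. Qed.
Lemma idealB a b : I a -> I b -> I (a - b).
Proof. by move=> Ia Ib; apply: idealD => //; apply: idealN. Qed.
Lemma ideal_sum (T : Type) (r : seq T) (P : pred T) (F : T -> A) :
  (forall i, P i -> I (F i)) -> I (\sum_(i <- r | P i) F i).
Proof.
move=> IF; elim/big_rec: _ => [|i x Pi Ix]; first exact: ideal0.
by apply: idealD => //; apply: IF.
Qed.
Lemma idealDl a b : I b -> I (a + b) <-> I a.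
Proof.
move=> Ib; split=> [Iab|Ia]; last exact: idealD.
by rewrite -(addrK b a); apply: idealB.
Qed.
Lemma idealDr a b : I a -> I (a + b) <-> I b.
Proof. by rewrite addrC; apply: idealDl. Qed.
Lemma ideal_sub_trans a b c : I (a - b) -> I (b - c) -> I (a - c).
Proof. by move=> ab bc; rewrite -[a](subrK b) -addrA; apply: idealD. Qed.
Lemma ideal_congr a b : I (a - b) -> I a <-> I b.
Proof. by move=> Iab; rewrite -[a in I a](subrK b); apply: idealDr. Qed.
Lemma ideal_subC a b : I (a - b) -> I (b - a).
Proof. by move=> h; rewrite -opprB; apply: idealN. Qed.
End Ideals.

Lemma ideal_genP (A : comNzRingType) (G : set A) : is_ideal (ideal_gen G).
Proof.
split=> [J [[]]//|a b Ja Jb J iJ|a b Jb J iJ].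
- by apply: idealD; [case: iJ | exact: Ja | exact: Jb].
- by apply: idealMl; [case: iJ | exact: Jb].
Qed.

Lemma sub_ideal_gen (A : comNzRingType) (G : set A) : G `<=` ideal_gen G.
Proof. by move=> g Gg J [_]; apply. Qed.

Lemma ideal_gen_sub (A : comNzRingType) (G J : set A) :
  is_ideal J -> G `<=` J -> ideal_gen G `<=` J.
Proof. by move=> iJ GJ g; apply. Qed.

Lemma ideal_gen_seqP (A : comNzRingType) (s : seq A) x :
  ideal_gen [set` s] x <-> exists c : nat -> A, x = \sum_(i < size s) c i * s`_i.
Proof.
split; last first.
  case=> c ->; apply: (ideal_sum (ideal_genP _)) => i _.
  apply: (idealMl (ideal_genP _)); apply: sub_ideal_gen => /=.
  exact: mem_nth.
move=> h; apply: (h [set x | exists c : nat -> A,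
  x = \sum_(i < size s) c i * s`_i]); split.
  split.
  - by exists (fun=> 0); rewrite big1 // => i _; rewrite mul0r.
  - move=> _ _ [c ->] [d ->]; exists (fun i => c i + d i).
    by rewrite -big_split; apply: eq_bigr => i _; rewrite mulrDl.
  - move=> a _ [c ->]; exists (fun i => a * c i).
    by rewrite mulr_sumr; apply: eq_bigr => i _; rewrite mulrA.
move=> g /= gs; have lt_g : (index g s < size s)%N by rewrite index_mem.
exists (fun i => (i == index g s)%:R).
rewrite (bigD1 (Ordinal lt_g)) //= eqxx mul1r nth_index // big1 ?addr0 //.
by move=> i; rewrite -val_eqE /= => /negbTE ->; rewrite mul0r.
Qed.

Lemma exists_quotient (A : comNzRingType) (I : set A) : is_ideal I -> ~ I 1 ->
  exists (Q : comNzRingType) (pi : {rmorphism A -> Q}), is_quotient I pi.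
Proof.
move=> idI I1; pose E a b := I (a - b).
have E0 a b : a = b -> E a b by move=> ->; rewrite /E subrr; apply: ideal0.
have := @setoid_comring A E _ _ _ +%R 0 -%R _ _ _ _ _ _ *%R 1.
case=> //.
- by move=> a; apply: E0.
- by move=> a b; apply: ideal_subC.
- by move=> a b c; apply: ideal_sub_trans.
- move=> a b c d Eab Ecd; rewrite /E.
  have -> : a + c - (b + d) = (a - b) + (c - d) by ring.
  exact: idealD.
- move=> a b Eab; rewrite /E; have -> : - a - - b = - (a - b) by ring.
  exact: idealN.
- by move=> a b c; apply/E0/addrA.
- by move=> a b; apply/E0/addrC.
- by move=> a; apply/E0/add0r.
- by move=> a; apply/E0/addNr.
- move=> a b c d Eab Ecd; rewrite /E.
  have -> : a * c - b * d = c * (a - b) + b * (c - d) by ring.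
  by apply: idealD => //; apply: idealMl.
- by move=> a b c; apply/E0/mulrA.
- by move=> a b; apply/E0/mulrC.
- by move=> a; apply/E0/mul1r.
- by move=> a b c; apply/E0/mulrDl.
- by rewrite /E subr0.
move=> W [c [csurj cE cD cM c1]].
have [pi piE] := rmorphism_of_fun cD cM c1.
exists W, pi; split=> [q|a]; first by have [a <-] := csurj q; exists a.
by rewrite -(rmorph0 pi) !piE cE /E subr0.
Qed.

Lemma exists_quotient_lmodule (R : pzRingType) (V : lmodType R) (D : set V) :
  submodule D -> exists (W : lmodType R) (g : {linear V -> W}),
    (forall w, exists v, g v = w) /\ (forall v, g v = 0 <-> D v).
Proof.
move=> sD; case: (sD) => D0 DD DZ; pose E a b := D (a - b).
have E0 a b : a = b -> E a b by move=> ->; rewrite /E subrr.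
have := @setoid_lmodule V E _ _ _ +%R 0 -%R _ _ _ _ _ _ R *:%R.
case=> //.
- by move=> a; apply: E0.
- by move=> a b Eab; rewrite /E -opprB; apply: submoduleN.
- by move=> a b c Eab Ebc; rewrite /E -[a](subrK b) -addrA; apply: DD.
- by move=> a b c d Eab Ecd; rewrite /E opprD addrACA; apply: DD.
- by move=> a b Eab; rewrite /E -opprD; apply: submoduleN.
- by move=> a b c; apply/E0/addrA.
- by move=> a b; apply/E0/addrC.
- by move=> a; apply/E0/add0r.
- by move=> a; apply/E0/addNr.
- by move=> x a b Eab; rewrite /E -scalerBr; apply: DZ.
- by move=> x y a; apply/E0/scalerA.
- by move=> a; apply/E0/scale1r.
- by move=> x a b; apply/E0/scalerDr.
- by move=> a x y; apply/E0/scalerDl.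
move=> W [c [csurj cE cD cZ]].
have [g gE] := linear_of_fun cD cZ.
exists W, g; split=> [q|a]; first by have [a <-] := csurj q; exists a.
by rewrite -(linear0 g) !gE cE /E subr0.
Qed.

(** The subtype is taken up to equality of values, so that proofs of membership never have to be
    compared. *)
Lemma exists_submodule (R : pzRingType) (V : lmodType R) (D : set V) :
  submodule D -> exists (W : lmodType R) (i : {linear W -> V}),
    injective i /\ (forall v, D v <-> exists w, i w = v).
Proof.
move=> sD; case: (sD) => D0 DD DZ; pose T := {v : V | D v}.
pose E (a b : T) := sval a = sval b.
pose add (a b : T) : T := exist _ _ (DD _ _ (svalP a) (svalP b)).
pose opp (a : T) : T := exist _ _ (submoduleN sD (svalP a)).
pose scale x (a : T) : T := exist _ _ (DZ x _ (svalP a)).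
have := @setoid_lmodule T E _ _ _ add (exist _ 0 D0) opp _ _ _ _ _ _ R scale.
rewrite /E /=; case=> //.
- by move=> ? ? ? -> ->.
- by move=> ? ? ? ? -> ->.
- by move=> ? ? ->.
- by move=> *; rewrite addrA.
- by move=> *; rewrite addrC.
- by move=> *; rewrite add0r.
- by move=> *; rewrite addNr.
- by move=> ? ? ? ->.
- by move=> *; rewrite scalerA.
- by move=> *; rewrite scale1r.
- by move=> *; rewrite scalerDr.
- by move=> *; rewrite scalerDl.
move=> W [c [csurj cE cD cZ]].
pose j w := sval (sval (cid (csurj w))).
have jc t : j (c t) = sval t.
  by rewrite /j; case: cid => u /= /cE ->.
have [i iE] : exists i : {linear W -> V}, forall u, i u = j u.
  apply: linear_of_fun => [u v|a u]; have [u' <-] := csurj u.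
    by have [v' <-] := csurj v; rewrite -cD !jc.
  by rewrite -cZ !jc.
exists W, i; split=> [u v|v].
  have [u' <-] := csurj u; have [v' <-] := csurj v.
  by rewrite !iE !jc => ?; apply/cE.
split=> [Dv|[w <-]]; first by exists (c (exist _ v Dv)); rewrite iE jc.
by rewrite iE; have [t <-] := csurj w; rewrite jc; apply: svalP.
Qed.

Lemma exists_restriction_of_scalars_of_scalars (A B : pzRingType) (rho : {rmorphism A -> B})
    (M : lmodType B) :
  exists (W : lmodType A) (c : M -> W) (d : W -> M), [/\ cancel c d, cancel d c,
    forall u v, c (u + v) = c u + c v & forall a u, c (rho a *: u) = a *: c u].
Proof.
have := @setoid_lmodule M eq _ _ _ +%R 0 -%R _ _ _ _ _ _ A
  (fun a u => rho a *: u).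
case=> //.
- by move=> ? ? ? -> ->.
- by move=> ? ? ? ? -> ->.
- by move=> ? ? ->.
- by move=> *; rewrite addrA.
- by move=> *; rewrite addrC.
- by move=> *; rewrite add0r.
- by move=> *; rewrite addNr.
- by move=> ? ? ? ->.
- by move=> *; rewrite scalerA rmorphM.
- by move=> *; rewrite rmorph1 scale1r.
- by move=> *; rewrite scalerDr.
- by move=> *; rewrite rmorphD scalerDl.
move=> W [c [csurj cE cD cZ]].
have cdK w := projT2 (cid (csurj w)).
by exists W, c, (fun w => projT1 (cid (csurj w))); split=> // u; apply/cE.
Qed.

(** * Localization at a prime *)

Section Localization.
Variables (A : comNzRingType) (P : set A).
Hypothesis primeP : prime_ideal P.

Lemma prime_ideal_ideal : is_ideal P. Proof. by case: primeP. Qed.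

Lemma prime_idealM a b : ~ P a -> ~ P b -> ~ P (a * b).
Proof. by case: primeP => _ _ PM Pa Pb /PM[]. Qed.

Lemma prime_ideal_n1 : ~ P 1. Proof. by case: primeP. Qed.

Lemma exists_localization :
  exists (L : comNzRingType) (phi : {rmorphism A -> L}), is_localization P phi.
Proof.
pose T := (A * {s : A | ~ P s})%type.
pose den (x : T) := sval x.2.
(* The factor [u] makes the relation transitive when [A] has zero divisors. *)
pose E (x y : T) := exists2 u, ~ P u & u * (x.1 * den y - y.1 * den x) = 0.
have E1 x y : x.1 * den y = y.1 * den x -> E x y.
  by move=> e; exists 1; [exact: prime_ideal_n1 | rewrite e subrr mulr0].
have nP (x : T) : ~ P (den x) := svalP x.2.
pose mulS (s t : {s : A | ~ P s}) : {s : A | ~ P s} :=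
  exist (fun s => ~ P s) _ (prime_idealM (svalP s) (svalP t)).
pose one : {s : A | ~ P s} := exist (fun s => ~ P s) _ prime_ideal_n1.
pose add (x y : T) : T := (x.1 * den y + y.1 * den x, mulS x.2 y.2).
pose mul (x y : T) : T := (x.1 * y.1, mulS x.2 y.2).
pose opp (x : T) : T := (- x.1, x.2).
have := @setoid_comring T E _ _ _ add (0, one) opp _ _ _ _ _ _ mul (1, one).
case.
- by move=> x; apply: E1.
- by move=> x y [u nPu e]; exists u => //; rewrite -opprB mulrN e oppr0.
- move=> x y z [u nPu eu] [v nPv ev]; exists (u * v * den y).
    by apply: prime_idealM => //; apply: prime_idealM.
  rewrite [LHS](_ : _ = v * den z * (u * (x.1 * den y - y.1 * den x)) +
    u * den x * (v * (y.1 * den z - z.1 * den y))); last by ring.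
  by rewrite eu ev !mulr0 addr0.
- move=> x y z t [u nPu eu] [v nPv ev]; exists (u * v).
    exact: prime_idealM.
  rewrite [LHS](_ : _ = v * den z * den t * (u * (x.1 * den y - y.1 * den x)) +
    u * den x * den y * (v * (z.1 * den t - t.1 * den z))); last by rewrite /add /den /=; ring.
  by rewrite eu ev !mulr0 addr0.
- move=> x y [u nPu eu]; exists u => //;
  rewrite [LHS](_ : _ = - (u * (x.1 * den y - y.1 * den x)));
    last by rewrite /opp /den /=; ring.
  by rewrite eu oppr0.
- by move=> x y z; apply: E1; rewrite /add /den /=; ring.
- by move=> x y; apply: E1; rewrite /add /den /=; ring.
- by move=> x; apply: E1; rewrite /add /den /=; ring.
- by move=> x; apply: E1; rewrite /add /den /=; ring.
- move=> x y z t [u nPu eu] [v nPv ev]; exists (u * v).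
    exact: prime_idealM.
  rewrite [LHS](_ : _ = v * z.1 * den t * (u * (x.1 * den y - y.1 * den x)) +
    u * den x * y.1 * (v * (z.1 * den t - t.1 * den z))); last by rewrite /mul /den /=; ring.
  by rewrite eu ev !mulr0 addr0.
- by move=> x y z; apply: E1; rewrite /mul /den /=; ring.
- by move=> x y; apply: E1; rewrite /mul /den /=; ring.
- by move=> x; apply: E1; rewrite /mul /den /=; ring.
- by move=> x y z; apply: E1; rewrite /mul /add /den /=; ring.
- move=> [u nPu]; rewrite /den /= !mulr1 subr0 mulr1 => u0.
  by apply: nPu; rewrite u0; exact: (ideal0 prime_ideal_ideal).
move=> W [c [csurj cE cD cM c1]].
have [phi phiE] : exists phi : {rmorphism A -> W}, forall a, phi a = c (a, one).
  apply: rmorphism_of_fun => //.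
  - move=> u v; rewrite -cD; apply/cE/E1.
    by rewrite /add /den /=; ring.
  - by move=> u v; rewrite -cM; apply/cE/E1; rewrite /mul /den /=; ring.
exists W, phi; split.
- move=> s nPs; exists (c (1, exist (fun s => ~ P s) s nPs)); rewrite phiE -cM -c1.
  by apply/cE/E1; rewrite /den /=; ring.
- move=> l; have [x <-] := csurj l; exists x.1, (den x); split=> //.
  by rewrite !phiE -cM; apply/cE/E1; rewrite /den /=; ring.
- move=> a; rewrite -(rmorph0 phi) !phiE cE /E /den /=; split.
    by move=> [u nPu]; rewrite !mulr1 subr0 => e; exists u.
  by move=> [u [nPu e]]; exists u => //; rewrite !mulr1 subr0.
Qed.

End Localization.

Lemma comring_field (F : comNzRingType) :
  (forall x : F, x != 0 -> exists y, x * y = 1) ->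
  exists (k : fieldType) (f : {rmorphism F -> k}) (g : k -> F), cancel f g /\ cancel g f.
Proof.
move=> Finv.
pose inv (x : F) : F := if pselect (x != 0) is left nz
  then projT1 (cid (Finv x nz)) else 0.
have mulV x : x != 0 -> inv x * x = 1.
  rewrite /inv; case: pselect => // nz _.
  by rewrite mulrC (projT2 (cid (Finv x nz))).
have inv0 : inv 0 = 0 by rewrite /inv; case: pselect => // nz; case/eqP: (nz).
pose k : fieldType := HB.pack (GRing.ComNzRing.sort F)
  (GRing.ComNzRing_isField.Build F mulV inv0).
pose f : F -> k := id.
have [f' f'E] : exists f' : {rmorphism F -> k}, forall x, f' x = f x.
  exact: rmorphism_of_fun.
by exists k, f', id; split=> x; rewrite f'E.
Qed.

(** * Injective modules *)

Section Baer.
Variables (R : comNzRingType) (E : lmodType R).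

(** The map is a function on all of [R] that is linear only on [a], so the ideal needs no module
    structure of its own. *)
Definition baer : Prop := forall (a : set R) (f : R -> E), is_ideal a ->
  (forall x y, a x -> a y -> f (x + y) = f x + f y) ->
  (forall c x, a x -> f (c * x) = c *: f x) ->
  exists e, forall x, a x -> f x = x *: e.

Variables (M N : lmodType R) (i : {linear M -> N}) (f : {linear M -> E}).

(** Graphs of partial extensions of [f] along [i]; being single-valued at 0 suffices for a
    submodule. *)
Let good (G : set (N * E)) := [/\ @submodule R (N * E)%type G,
  forall e, G (0, e) -> e = 0 & forall m, G (i m, f m)].

Let good_fun G n e e' : good G -> G (n, e) -> G (n, e') -> e = e'.
Proof.
move=> [sG G0 _] Ge Ge'; apply/subr0_eq/G0.
by have : G (n - n, e - e') := submoduleB sG Ge Ge'; rewrite subrr.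
Qed.

Let good_bigcup (F : set (set (N * E))) :
  F `<=` [set X | X = set0 \/ good X] -> total_on F subset ->
  (\bigcup_(X in F) X) = set0 \/ good (\bigcup_(X in F) X).
Proof.
move=> Fgood Ftot.
case: (pselect (exists2 X, F X & X <> set0)) => [[X FX Xn0]|nF]; last first.
  left; apply/seteqP; split=> // x [X FX Xx]; apply: nF; exists X => // X0.
  by rewrite X0 in Xx.
have gX : good X by case: (Fgood _ FX).
right; split.
- split.
  + by exists X => //; case: gX => -[].
  + move=> u v [Y FY Yu] [Z FZ Zv].
    have [YZ|ZY] := Ftot _ _ FY FZ.
      exists Z => //; case: (Fgood _ FZ) => [Z0|[[_ ZD _] _ _]].
        by rewrite Z0 in Zv.
      by apply: ZD => //; apply: YZ.
    exists Y => //; case: (Fgood _ FY) => [Y0|[[_ YD _] _ _]].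
      by rewrite Y0 in Yu.
    by apply: YD => //; apply: ZY.
  + move=> a u [Y FY Yu]; exists Y => //.
    case: (Fgood _ FY) => [Y0|[[_ _ YZ] _ _]]; first by rewrite Y0 in Yu.
    exact: YZ.
- move=> e [Y FY Ye]; case: (Fgood _ FY) => [Y0|[_ Y0 _]].
    by rewrite Y0 in Ye.
  exact: Y0.
- by move=> m; exists X => //; case: gX.
Qed.

Lemma baer_extend : baer -> injective i -> exists g : {linear N -> E}, forall m, g (i m) = f m.
Proof.
move=> hE inj_i.
have [G [Ggood Gmax]] := Zorn_bigcup good_bigcup.
have {Ggood} gG : good G.
  case: Ggood => // G0; pose G1 := [set x : N * E | exists m, x = (i m, f m)].
  have gG1 : good G1.
    split; last by move=> m; exists m.
      split.
      - by exists 0; rewrite !linear0.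
      - by move=> _ _ [m ->] [m' ->]; exists (m + m'); rewrite !linearD.
      - by move=> a _ [m ->]; exists (a *: m); rewrite !linearZ.
    move=> e [m [im0 ->]]; have -> : m = 0 by apply: inj_i; rewrite linear0.
    by rewrite linear0.
  case: (Gmax G1); last by right.
  rewrite G0; split; first by move=> x [].
  by move=> /(_ (i 0, f 0)) h; apply: h; exists 0.
have [[G0 GD' GZ'] Gf Gif] := gG.
have GD u v e e' : G (u, e) -> G (v, e') -> G (u + v, e + e').
  by move=> Gu Gv; have := GD' _ _ Gu Gv.
have GZ a u e : G (u, e) -> G (a *: u, a *: e) by move=> Gu; have := GZ' a _ Gu.
have GN u e : G (u, e) -> G (- u, - e).
  by move=> /(GZ (-1)); rewrite !scaleN1r.
have Gtot n : exists e, G (n, e).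
  apply: contrapT => nG.
  (* The multiples of [n] that lie in the domain give a linear map on the ideal [a]; the element
     representing it is the value to be assigned to [n]. *)
  pose a := [set x : R | exists e, G (x *: n, e)].
  pose h x := if pselect (a x) is left ax then projT1 (cid ax) else 0.
  have hP x : a x -> G (x *: n, h x).
    by move=> ax; rewrite /h; case: pselect => // ax'; apply: (projT2 (cid ax')).
  have ida : is_ideal a.
    split.
    - by exists 0; rewrite scale0r.
    - move=> x y [e Ge] [e' Ge']; exists (e + e').
      by rewrite scalerDl; apply: (GD _ _ _ _ Ge Ge').
    - move=> b x [e Ge]; exists (b *: e).
      by rewrite -scalerA; apply: (GZ b _ _ Ge).
  have [||e0 he0] := hE a h ida.
  - move=> x y ax ay; apply: (@good_fun G ((x + y) *: n)) => //.
      by apply/hP/(idealD ida).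
    by rewrite scalerDl; apply: (GD _ _ _ _ (hP _ ax) (hP _ ay)).
  - move=> c x ax; apply: (@good_fun G ((c * x) *: n)) => //.
      by apply/hP/(idealMl ida).
    by rewrite -scalerA; apply: (GZ c _ _ (hP _ ax)).
  pose G' := [set y : N * E | exists v e x,
    G (v, e) /\ y = (v + x *: n, e + x *: e0)].
  have GG' : G `<=` G'.
    by move=> [v e] Gve; exists v, e, 0; rewrite !scale0r !addr0.
  apply: (Gmax G').
    split=> // G'G; apply: nG; exists e0; apply: G'G.
    by exists 0, 0, 1; rewrite !scale1r !add0r.
  right; split.
  - split; first exact: GG'.
    + move=> _ _ [v [e [x [Gve ->]]]] [v' [e' [x' [Gve' ->]]]].
      exists (v + v'), (e + e'), (x + x'); split; first exact: (GD _ _ _ _ Gve Gve').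
      by congr pair; rewrite scalerDl addrACA.
    + move=> b _ [v [e [x [Gve ->]]]].
      exists (b *: v), (b *: e), (b * x); split; first exact: (GZ b _ _ Gve).
      by congr pair; rewrite -scalerA -scalerDr.
  - move=> _ [v [e [x [Gve [xv ->]]]]].
    have vE : v = - (x *: n) by apply/eqP; rewrite -addr_eq0 -xv.
    have ax : a x.
      exists (- e); have := GN _ _ Gve.
      by rewrite vE opprK.
    have : G (v + x *: n, e + h x) := GD _ _ _ _ Gve (hP _ ax).
    rewrite vE addNr => /Gf.
    by rewrite he0.
  - by move=> m; apply/GG'/Gif.
have [g gP] := choice Gtot.
have [g' g'E] : exists g' : {linear N -> E}, forall n, g' n = g n.
  apply: linear_of_fun => [u v|a u].
    by apply: good_fun gG (gP _) (GD _ _ _ _ (gP u) (gP v)).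
  by apply: good_fun gG (gP _) (GZ a _ _ (gP u)).
by exists g' => m; rewrite g'E; apply: good_fun gG (gP _) (Gif m).
Qed.
End Baer.

Lemma baer_injective (R : comNzRingType) (E : lmodType R) :
  baer E -> injective_module E.
Proof. by move=> hE M N i f; apply: baer_extend. Qed.

Lemma vector_space_injective (k : fieldType) (E : lmodType k) :
  injective_module E.
Proof.
apply: baer_injective => a f ida fD fM.
case: (pselect (exists2 x, a x & x != 0)) => [[x ax x0]|na].
  have a1 : a 1 by rewrite -(mulVf x0); apply: idealMl.
  by exists (f 1) => y _; rewrite -fM // mulr1.
exists 0 => x ax; rewrite scaler0.
have [->|x0] := eqVneq x 0; last by case: na; exists x.
by rewrite -(mulr0 0) fM ?scale0r //; apply: ideal0.
Qed.

(* [M] embeds in the coinduced module of [k]-linear functions [L -> M], which is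
   injective because [k]-vector spaces are. *)
Lemma enough_injectives (k : fieldType) (L : comNzRingType)
    (io : {rmorphism k -> L}) (M : lmodType L) :
  exists (E : lmodType L) (f : {linear M -> E}),
    injective_module E /\ injective f.
Proof.
pose klin (f : L -> M) := (forall x y, f (x + y) = f x + f y) /\
  forall c x, f (io c * x) = io c *: f x.
pose T := {f : L -> M | klin f}; pose Eq (a b : T) := sval a =1 sval b.
have klinD (a b : T) : klin (fun x => sval a x + sval b x).
  case: a b => [a [aD aZ]] [b [bD bZ]]; split=> /= [x y|c x].
    by rewrite aD bD addrACA.
  by rewrite aZ bZ scalerDr.
have klin0 : klin (fun=> 0) by split=> [x y|c x]; rewrite ?addr0 ?scaler0.
have klinN (a : T) : klin (fun x => - sval a x).
  case: a => [a [aD aZ]]; split=> /= [x y|c x]; first by rewrite aD opprD.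
  by rewrite aZ scalerN.
have klinZ l (a : T) : klin (fun x => sval a (x * l)).
  case: a => [a [aD aZ]]; split=> /= [x y|c x]; first by rewrite mulrDl aD.
  by rewrite -mulrA aZ.
pose mk f (h : klin f) : T := exist klin f h.
pose add a b := mk _ (klinD a b); pose opp a := mk _ (klinN a).
pose scale l a := mk _ (klinZ l a).
have := @setoid_lmodule T Eq _ _ _ add (mk _ klin0) opp _ _ _ _ _ _ L scale.
rewrite /Eq /=; case=> //.
- by move=> a b ab x; rewrite ab.
- by move=> a b c ab bc x; rewrite ab.
- by move=> a b c d ab cd x /=; rewrite ab cd.
- by move=> a b ab x /=; rewrite ab.
- by move=> a b c x /=; rewrite addrA.
- by move=> a b x /=; rewrite addrC.
- by move=> a x /=; rewrite add0r.
- by move=> a x /=; rewrite addNr.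
- by move=> l a b ab x /=; rewrite ab.
- by move=> l l' a x /=; rewrite mulrA.
- by move=> a x /=; rewrite mulr1.
- by move=> a l l' x /=; rewrite mulrDr; case: a => a [/= aD _]; rewrite aD.
move=> E [c [csurj cE cD cZ]].
pose val w := sval (projT1 (cid (csurj w))).
have valc t : val (c t) =1 sval t.
  by rewrite /val; case: cid => u /= /cE.
have valD u v x : val (u + v) x = val u x + val v x.
  by have [u' <-] := csurj u; have [v' <-] := csurj v; rewrite -cD !valc.
have valZ l u x : val (l *: u) x = val u (x * l).
  by have [u' <-] := csurj u; rewrite -cZ !valc.
have vallin u : klin (val u).
  by rewrite /val; case: (projT1 _).
have val_inj u v : val u =1 val v -> u = v.
  have [u' <-] := csurj u; have [v' <-] := csurj v => uv.
  by apply/cE => x; rewrite -!valc.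
have klinM (m : M) : klin (fun x => x *: m).
  by split=> [x y|d x]; rewrite ?scalerDl ?scalerA.
have [f fE] : exists f : {linear M -> E}, forall m, f m = c (mk _ (klinM m)).
  apply: linear_of_fun => [u v|a u]; apply: val_inj => x; rewrite ?valD ?valZ !valc /=.
    by rewrite scalerDr.
  by rewrite scalerA.
exists E, f; split; last first.
  by move=> u v uv; have := valc (mk _ (klinM u)) 1;
    rewrite -fE uv fE valc /= !scale1r.
move=> N' N i g inj_i.
have [rN' [cN' [dN' [cdN' dcN' cDN' cZN']]]] := exists_restriction_of_scalars_of_scalars io N'.
have [rN [cN [dN [cdN dcN cDN cZN]]]] := exists_restriction_of_scalars_of_scalars io N.
have [rM [cM [dM [cdM dcM cDM cZM]]]] := exists_restriction_of_scalars_of_scalars io M.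
have dDN u v : dN (u + v) = dN u + dN v.
  by apply: (can_inj cdN); rewrite cDN !dcN.
have dDN' u v : dN' (u + v) = dN' u + dN' v.
  by apply: (can_inj cdN'); rewrite cDN' !dcN'.
have dZN' a u : dN' (a *: u) = io a *: dN' u.
  by apply: (can_inj cdN'); rewrite cZN' !dcN'.
have dDM u v : dM (u + v) = dM u + dM v.
  by apply: (can_inj cdM); rewrite cDM !dcM.
have dZM a u : dM (a *: u) = io a *: dM u.
  by apply: (can_inj cdM); rewrite cZM !dcM.
have [i' i'E] : exists i' : {linear rN' -> rN}, forall u, i' u = cN (i (dN' u)).
  apply: linear_of_fun => [u v|a u]; first by rewrite dDN' linearD cDN.
  by rewrite dZN' linearZ cZN.
(* By adjunction a linear map into the coinduced module is determined by its composite with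
   evaluation at 1, which is only [k]-linear; that composite is extended, and [Gf] recovers the
   [L]-linear map. *)
have [g' g'E] : exists g' : {linear rN' -> rM}, forall u, g' u = cM (val (g (dN' u)) 1).
  apply: linear_of_fun => [u v|a u]; first by rewrite dDN' linearD valD cDM.
  rewrite dZN' linearZ /= valZ mul1r -[io a in LHS]mulr1.
  by have [_ ->] := vallin (g (dN' u)); rewrite cZM.
have [|G GE] := vector_space_injective (i := i') g'.
  move=> u v; rewrite !i'E => /(can_inj cdN)/inj_i.
  exact: (can_inj dcN').
pose Gf (n : N) (x : L) : M := dM (G (cN (x *: n))).
have Gklin n : klin (Gf n).
  split=> [x y|d x]; rewrite /Gf; first by rewrite scalerDl cDN linearD dDM.
  by rewrite -scalerA cZN linearZ dZM.
have [h hE] : exists h : {linear N -> E}, forall n, h n = c (mk _ (Gklin n)).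
  apply: linear_of_fun => [u v|a u]; apply: val_inj => x; rewrite ?valD ?valZ !valc /=.
    by rewrite /Gf scalerDr cDN linearD dDM.
  by rewrite /Gf scalerA.
exists h => m; rewrite hE; apply: val_inj => x; rewrite valc /= /Gf -linearZ /=.
have := GE (cN' (x *: m)); rewrite i'E cdN' => ->.
by rewrite g'E cdN' cdM linearZ /= valZ mul1r.
Qed.

(** * Ext of finitely presented modules, by matrices *)

Section MatrixExt.
Variable L : comNzRingType.
Implicit Types M E C : lmodType L.

Definition act p n (G : 'M[L]_(p, n)) M (u : 'I_n -> M) : 'I_p -> M :=
  fun i => \sum_j G i j *: u j.

Lemma act_mul p n q (A : 'M_(p, n)) (B : 'M_(n, q)) M (u : 'I_q -> M) :
  act (A *m B) u =1 act A (act B u).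
Proof.
move=> i; rewrite /act.
under eq_bigr do rewrite mxE scaler_suml.
rewrite exchange_big; apply: eq_bigr => j _; rewrite scaler_sumr.
by apply: eq_bigr => l _; rewrite scalerA.
Qed.

Lemma act_ext p n (G : 'M_(p, n)) M (u w : 'I_n -> M) :
  u =1 w -> act G u =1 act G w.
Proof. by move=> uw i; apply: eq_bigr => j _; rewrite uw. Qed.

Lemma act0 p n (G : 'M_(p, n)) M : act G (fun=> 0 : M) =1 fun=> 0.
Proof. by move=> i; rewrite /act big1 // => j _; rewrite scaler0. Qed.

Lemma act0l p n M (u : 'I_n -> M) : act (0 : 'M_(p, n)) u =1 fun=> 0.
Proof. by move=> i; rewrite /act big1 // => j _; rewrite mxE scale0r. Qed.

Lemma actB p n (G : 'M_(p, n)) M (u w : 'I_n -> M) :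
  act G (fun j => u j - w j) =1 fun i => act G u i - act G w i.
Proof.
by move=> i; rewrite /act -sumrB; apply: eq_bigr => j _; rewrite scalerBr.
Qed.

Lemma actZ p n (G : 'M_(p, n)) M (u : 'I_n -> M) x :
  act G (fun j => x *: u j) =1 fun i => x *: act G u i.
Proof.
move=> i; rewrite /act scaler_sumr; apply: eq_bigr => j _.
by rewrite !scalerA mulrC.
Qed.

Lemma act_linear p n (G : 'M_(p, n)) M C (f : {linear M -> C}) (u : 'I_n -> M) :
  act G (f \o u) =1 f \o act G u.
Proof.
by move=> i; rewrite /act /= linear_sum; apply: eq_bigr => j _; rewrite linearZ.
Qed.

Lemma act_row p n (G : 'M_(p, n)) M (u : 'I_n -> M) i :
  act (row i G) u ord0 = act G u i.
Proof. by rewrite /act; apply: eq_bigr => j _; rewrite mxE. Qed.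

Lemma act_delta p M (u : 'I_p -> M) i : act (delta_mx ord0 i : 'rV_p) u ord0 = u i.
Proof.
rewrite /act (bigD1 i) //= mxE !eqxx scale1r big1 ?addr0 // => j ji.
by rewrite mxE (negbTE ji) andbF scale0r.
Qed.

(** Such an [h] is the same as a homomorphism from the row space of [G] to [M]; it extends to all
    row vectors exactly when it has the form [act G u]. *)
Definition cocycle p n (G : 'M[L]_(p, n)) M (h : 'I_p -> M) : Prop :=
  forall v : 'rV_p, v *m G = 0 -> act v h ord0 = 0.

(* Ext^1(coker G, M) = 0 *)
Definition ext_vanish p n (G : 'M[L]_(p, n)) M : Prop :=
  forall h : 'I_p -> M, cocycle G h -> exists u, h =1 act G u.

Definition is_syz q p n (K : 'M[L]_(q, p)) (G : 'M[L]_(p, n)) : Prop :=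
  forall v : 'rV_p, v *m G = 0 <-> exists w, v = w *m K.

Lemma is_syz_mul q p n (K : 'M_(q, p)) (G : 'M_(p, n)) : is_syz K G -> K *m G = 0.
Proof.
move=> syzK; apply/row_matrixP => i; rewrite row_mul row0.
by apply/syzK; exists (delta_mx ord0 i); rewrite -rowE.
Qed.

Lemma cocycle_of_syz q p n (K : 'M_(q, p)) (G : 'M_(p, n)) M (h : 'I_p -> M) :
  is_syz K G -> act K h =1 (fun=> 0) -> cocycle G h.
Proof.
by move=> syzK Kh v /syzK[w ->]; rewrite act_mul (act_ext _ Kh) act0.
Qed.

Lemma act_syz_cocycle q p n (K : 'M_(q, p)) (G : 'M_(p, n)) M (h : 'I_p -> M) :
  is_syz K G -> cocycle G h -> act K h =1 fun=> 0.
Proof.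
move=> syzK Gh i; rewrite -act_row; apply: Gh.
by rewrite -row_mul is_syz_mul // row0.
Qed.

(** The cocycle is a map from the row space to [E]; injectivity extends it to all row vectors, and
    [u] consists of the values on the unit vectors. *)
Lemma injective_ext_vanish E p n (G : 'M_(p, n)) :
  injective_module E -> ext_vanish G E.
Proof.
move=> injE h Gh.
pose D := [set x : 'rV[L]_n | exists v, x = v *m G].
have sD : submodule D.
  split; first by exists 0; rewrite mul0mx.
    by move=> _ _ [v ->] [w ->]; exists (v + w); rewrite mulmxDl.
  by move=> a _ [v ->]; exists (a *: v); rewrite scalemxAl.
have [W [i [inj_i iD]]] := exists_submodule sD.
have /choice[c cP] w : exists v, i w = v *m G by apply/iD; exists w.
have cE w v : i w = v *m G -> act (c w) h ord0 = act v h ord0.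
  move=> iw; apply/eqP; rewrite -subr_eq0; apply/eqP.
  have := Gh (c w - v); rewrite mulmxBl -cP iw subrr => /(_ erefl) <-.
  rewrite /act -sumrB; apply: eq_bigr => j _.
  by rewrite mxE mxE scalerBl.
have [f fE] : exists f : {linear W -> E}, forall w, f w = act (c w) h ord0.
  apply: linear_of_fun => [u v|a u].
    rewrite (cE _ (c u + c v)) ?linearD /= ?mulmxDl ?cP //.
    rewrite /act -big_split; apply: eq_bigr => j _.
    by rewrite mxE scalerDl.
  rewrite (cE _ (a *: c u)) ?linearZ /= -?scalemxAl ?cP //.
  rewrite /act scaler_sumr; apply: eq_bigr => j _.
  by rewrite mxE scalerA.
have [g gE] := injE _ _ i f inj_i.
exists (fun j => g (delta_mx ord0 j)) => l.
have [w iw] : exists w, i w = row l G.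
  by apply/iD; exists (delta_mx ord0 l); rewrite -rowE.
have := gE w; rewrite fE (cE _ (delta_mx ord0 l)) -?rowE // act_delta => <-.
rewrite iw [row l G]row_sum_delta linear_sum; apply: eq_bigr => j _.
by rewrite linearZ mxE.
Qed.

Definition ses M E C (f : {linear M -> E}) (g : {linear E -> C}) : Prop :=
  [/\ injective f, forall c, exists e, g e = c
    & forall e, g e = 0 <-> exists m, f m = e].

Section Shift.
Variables (M E C : lmodType L) (f : {linear M -> E}) (g : {linear E -> C}).
Hypotheses (injE : injective_module E) (sesfg : ses f g).
Variables (q p n : nat) (K : 'M[L]_(q, p)) (G : 'M[L]_(p, n)).
Hypothesis syzK : is_syz K G.

Lemma ses_comp m : g (f m) = 0.
Proof. by case: sesfg => _ _ gf; apply/gf; exists m. Qed.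

(** Dimension shifting: coker K is the first syzygy module of coker G, so Ext^1(coker G, C) =
    Ext^2(coker G, M) = Ext^1(coker K, M). The opposite implication is [ext_vanish_syzygy]. *)
Lemma ext_vanish_cosyzygy : ext_vanish K M -> ext_vanish G C.
Proof.
case: sesfg => inj_f surj_g gf vK h Gh.
have [h' h'E] := choice (fun i => surj_g (h i)).
have gKh i : g (act K h' i) = 0.
  rewrite -[LHS]/((g \o _) i) -act_linear -(act_syz_cocycle syzK Gh i).
  by apply: act_ext => j /=.
have [k kE] := choice (fun i => (gf _).1 (gKh i)).
have [|u uE] := vK k.
  move=> v vK0; apply: inj_f; rewrite linear0.
  rewrite -[LHS]/((f \o _) ord0) -act_linear (act_ext _ (_ : _ =1 act K h')) //.
  by rewrite -act_mul vK0 act0l.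
have [|w wE] := injective_ext_vanish (G := G) injE (h := fun i => h' i - f (u i)).
  apply: (cocycle_of_syz syzK) => i; rewrite actB -kE uE.
  by rewrite -[f (act K u i)]/((f \o _) i) -act_linear subrr.
exists (g \o w) => i; rewrite act_linear /= -wE linearB /= ses_comp subr0.
by rewrite h'E.
Qed.

Lemma ext_vanish_syzygy : ext_vanish G C -> ext_vanish K M.
Proof.
case: sesfg => inj_f surj_g gf vG h Kh.
have [|u' u'E] := injective_ext_vanish (G := K) injE (h := f \o h).
  by move=> v vK; rewrite act_linear /= (Kh v vK) linear0.
have [|c cE] := vG (g \o u').
  apply: (cocycle_of_syz syzK) => i; rewrite act_linear /= -u'E /=.
  exact: ses_comp.
have [c' c'E] := choice (fun j => surj_g (c j)).
have gu i : g (u' i - act G c' i) = 0.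
  rewrite linearB /= [g (u' i)]cE -[g (act G c' i)]/((g \o _) i) -act_linear.
  by apply/eqP; rewrite subr_eq0; apply/eqP/act_ext => j /=.
have [u uE] := choice (fun i => (gf _).1 (gu i)).
exists u => i; apply: inj_f; rewrite -[f (h i)]/((f \o h) i) u'E.
rewrite -[RHS]/((f \o _) i) -act_linear
  (act_ext K (uE : f \o u =1 (fun i => u' i - act G c' i))).
by rewrite actB -act_mul is_syz_mul // act0l subr0.
Qed.
End Shift.

(* Ext^(d+1)(coker G, M) = 0, computed from all, resp. some, choices of
   successive syzygies of G. *)
Fixpoint ext_all d p n (G : 'M[L]_(p, n)) M : Prop :=
  if d is d'.+1 then forall q (K : 'M_(q, p)), is_syz K G -> ext_all d' K M
  else ext_vanish G M.

Fixpoint ext_some d p n (G : 'M[L]_(p, n)) M : Prop :=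
  if d is d'.+1 then exists q (K : 'M_(q, p)), is_syz K G /\ ext_some d' K M
  else ext_vanish G M.

Lemma injdim_ext_all d M : injdim_le d M -> forall p n (G : 'M_(p, n)), ext_all d G M.
Proof.
elim=> {d M} [M injM p n G|d M E C f g injE inj_f surj_g gf _ IH p n G q K syzK].
  exact: injective_ext_vanish.
have sesfg : ses f g by split.
move: (IH _ _ G) => {IH}; elim: d q p n K G syzK => [|d IHd] q p n K G syzK /=.
  exact: (ext_vanish_syzygy injE sesfg).
by move=> hG r K' syzK'; apply: IHd syzK' (hG _ _ syzK).
Qed.

Lemma ext_some_cosyzygy M E C (f : {linear M -> E}) (g : {linear E -> C}) d p n
    (G : 'M_(p, n)) :
  injective_module E -> ses f g -> ext_some d.+1 G M -> ext_some d G C.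
Proof.
move=> injE sesfg [q [K [syzK]]].
elim: d q p n K G syzK => [|d IHd] q p n K G syzK /=.
  exact: (ext_vanish_cosyzygy injE sesfg syzK).
by move=> [r [K' [syzK' hK']]]; exists q, K; split=> //; apply: IHd syzK' hK'.
Qed.

Definition col_ideal p (G : 'cV[L]_p) : set L :=
  [set x | exists v : 'rV_p, x = (v *m G) ord0 ord0].

Lemma col_idealP p (G : 'cV[L]_p) : is_ideal (col_ideal G).
Proof.
split; first by exists 0; rewrite mul0mx mxE.
  by move=> _ _ [v ->] [w ->]; exists (v + w); rewrite mulmxDl [RHS]mxE.
by move=> a _ [v ->]; exists (a *: v); rewrite -scalemxAl [RHS]mxE.
Qed.

(** With a single column, coker G is L/a for the ideal [a] of its entries, and the vanishing of
    Ext^1(L/a, M) is Baer's condition at [a]. *)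
Lemma ext_vanish_extend M p (G : 'cV[L]_p)
    (f : L -> M) :
  ext_vanish G M ->
  (forall x y, col_ideal G x -> col_ideal G y -> f (x + y) = f x + f y) ->
  (forall c x, col_ideal G x -> f (c * x) = c *: f x) ->
  exists e, forall x, col_ideal G x -> f x = x *: e.
Proof.
move=> vG fD fZ; pose a := col_ideal G.
have ida : is_ideal a := col_idealP G.
have aG i : a (G i ord0) by exists (delta_mx ord0 i); rewrite -rowE mxE.
have f0 : f 0 = 0 by rewrite -(mulr0 0) fZ ?scale0r //; apply: ideal0.
have fv (v : 'rV_p) : f ((v *m G) ord0 ord0) = act v (fun i => f (G i ord0)) ord0.
  rewrite mxE /act.
  suff [_ ->] : a (\sum_j v ord0 j * G j ord0) /\
      f (\sum_j v ord0 j * G j ord0) = \sum_j f (v ord0 j * G j ord0).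
    by apply: eq_bigr => i _; rewrite fZ //; apply: aG.
  elim/big_rec2: _ => [|i y x _ [ax fx]]; first by split=> //; apply: ideal0.
  have aGi : a (v ord0 i * G i ord0) by apply: idealMl.
  by split; [apply: idealD | rewrite fD // fx].
have [|u uE] := vG (fun i => f (G i ord0)).
  by move=> v vG0; rewrite -fv vG0 mxE.
exists (u ord0) => x [v ->]; rewrite fv (act_ext _ uE).
by rewrite -act_mul /act big_ord_recl big_ord0 addr0.
Qed.

(** Embed [M] in an injective module and pass to the cokernel, which lowers the index of Ext by one;
    at index 0 Baer's criterion needs only the cyclic modules L/a. One choice of syzygies per ideal
    is enough. *)
Lemma injdim_of_ext_some (k : fieldType) (io : {rmorphism k -> L}) d M :
  (forall a, is_ideal a ->
    exists p (G : 'cV_p), a = col_ideal G /\ ext_some d G M) ->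
  injdim_le d M.
Proof.
elim: d M => [|d IHd] M hM.
  apply/Injdim0/baer_injective => a f ida fD fZ.
  have [p [G [aE vG]]] := hM a ida; rewrite aE in fD fZ *.
  exact: ext_vanish_extend vG fD fZ.
have [E [f [injE inj_f]]] := enough_injectives io M.
pose D := [set e | exists m, f m = e].
have sD : submodule D.
  split; first by exists 0; rewrite linear0.
    by move=> _ _ [u <-] [v <-]; exists (u + v); rewrite linearD.
  by move=> a _ [u <-]; exists (a *: u); rewrite linearZ.
have [C [g [surj_g gD]]] := exists_quotient_lmodule sD.
apply: (InjdimS injE inj_f surj_g gD); apply: IHd => a ida.
have [p [G [aE extG]]] := hM a ida; exists p, G; split=> //.
have sesfg : ses f g by split.
exact: ext_some_cosyzygy injE sesfg extG.
Qed.

Lemma noetherian_col a : noetherian L -> is_ideal a ->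
  exists p (G : 'cV_p), a = col_ideal G.
Proof.
move=> noethL ida; have [s aE] := noethL a ida.
exists (size s), (\col_i s`_i); apply/seteqP; rewrite aE; split=> x.
  move=> /ideal_gen_seqP[c ->]; exists (\row_i c i); rewrite mxE.
  by apply: eq_bigr => i _; rewrite !mxE.
move=> [v ->]; rewrite mxE; apply: (ideal_sum (ideal_genP _)) => i _.
apply: (idealMl (ideal_genP _)); apply: sub_ideal_gen.
by rewrite /= mxE; apply: mem_nth.
Qed.

(** Induction on the number of coordinates: the first coordinates of [D] form an ideal, and the
    vectors of [D] with first coordinate 0 form a submodule in one coordinate less. *)
Lemma noetherian_rows p (D : set 'rV[L]_p) : noetherian L -> submodule D ->
  exists q (K : 'M_(q, p)), forall v, D v <-> exists w, v = w *m K.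
Proof.
move=> noethL; elim: p D => [|p IHp] D sD; case: (sD) => D0 DD DZ.
  exists 0, 0 => v.
  have -> : v = 0 by apply/matrixP => i [].
  by split=> // _; exists 0; rewrite mul0mx.
pose a := [set x : L | exists v : 'rV_p, D (row_mx x%:M v : 'rV_(1 + p))].
have ida : is_ideal a.
  split; first by exists 0; rewrite raddf0 row_mx0.
    move=> x y [v Dv] [w Dw]; exists (v + w); rewrite raddfD /= -add_row_mx.
    exact: DD.
  move=> x y [v Dv]; exists (x *: v).
  by rewrite -scale_scalar_mx -scale_row_mx; apply: DZ.
have [s [G aE]] := noetherian_col noethL ida.
have /choice[l lP] (i : 'I_s) : exists v : 'rV_p, D (row_mx (G i ord0)%:M v : 'rV_(1 + p)).
  have : a (G i ord0) by rewrite aE; exists (delta_mx ord0 i); rewrite -rowE mxE.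
  by [].
pose D' := [set v : 'rV_p | D (row_mx 0 v : 'rV_(1 + p))].
have sD' : submodule D'.
  split; first by rewrite /D' /= row_mx0.
    by move=> v w Dv Dw; rewrite /D' /= -[0]addr0 -add_row_mx; apply: DD.
  by move=> x v Dv; rewrite /D' /= -[0](scaler0 _ x) -scale_row_mx; apply: DZ.
have [q [K' K'E]] := IHp D' sD'.
pose K1 : 'M_(s, 1 + p) := row_mx G (\matrix_i l i).
have DK1 (w : 'rV_s) : D (w *m K1).
  rewrite mulmx_sum_row; apply: submodule_sum => // i _; apply: DZ.
  rewrite row_row_mx rowK; suff -> : row i G = (G i ord0)%:M by exact: lP.
  by apply/matrixP => x y; rewrite !ord1 !mxE eqxx.
exists (s + q)%N, (col_mx K1 (row_mx 0 K' : 'M_(q, 1 + p))) => v; split=> [Dv|].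
  have ax : a (lsubmx (v : 'rV_(1 + p)) ord0 ord0).
    exists (rsubmx (v : 'rV_(1 + p))).
    suff -> : (lsubmx (v : 'rV_(1 + p)) ord0 ord0)%:M = lsubmx (v : 'rV_(1 + p)).
      by rewrite hsubmxK.
    by apply/matrixP => x y; rewrite !ord1 !mxE eqxx.
  move: ax; rewrite aE => -[w wE].
  pose v' : 'rV_(1 + p) := v - w *m K1.
  have v'E : v' = row_mx 0 (rsubmx v').
    rewrite -[LHS]hsubmxK; congr row_mx; apply/matrixP => x y.
    have wK1 : w *m K1 = row_mx (w *m G) (w *m \matrix_i l i) := mul_mx_row _ _ _.
    have -> : lsubmx v' = lsubmx (v : 'rV_(1 + p)) - w *m G.
      by rewrite /v' wK1 raddfB /= row_mxKl.
    by rewrite !ord1 [LHS]mxE [X in _ + X]mxE -wE [RHS]mxE subrr.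
  have /K'E[w' w'E] : D' (rsubmx v').
    by rewrite /D' /= -v'E; apply: submoduleB.
  exists (row_mx w w'); rewrite mul_row_col -[LHS](subrK (w *m K1)) addrC.
  congr (_ + _); rewrite -/v' v'E w'E.
  have -> : w' *m (row_mx 0 K' : 'M_(q, 1 + p)) = row_mx (w' *m 0) (w' *m K').
    exact: mul_mx_row.
  by rewrite mulmx0.
move=> [w ->]; rewrite -[w]hsubmxK mul_row_col; apply: DD; first exact: DK1.
have -> : rsubmx w *m (row_mx 0 K' : 'M_(q, 1 + p)) =
    row_mx (rsubmx w *m 0) (rsubmx w *m K') by exact: mul_mx_row.
rewrite mulmx0; suff : D' (rsubmx w *m K') by [].
by apply/K'E; exists (rsubmx w).
Qed.

Lemma noetherian_syz p n (G : 'M[L]_(p, n)) : noetherian L ->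
  exists q (K : 'M_(q, p)), is_syz K G.
Proof.
move=> noethL; apply: (@noetherian_rows _ [set v | v *m G = 0]) => //.
split; first by rewrite /= mul0mx.
  by move=> u v /= uG vG; rewrite mulmxDl uG vG addr0.
by move=> a u /= uG; rewrite -scalemxAl uG scaler0.
Qed.

End MatrixExt.

(** * Noetherian local rings of finite injective dimension *)

Lemma noetherian_max (A : comNzRingType) (F : set (set A)) (I0 : set A) :
  noetherian A -> (forall I, F I -> is_ideal I) -> F I0 ->
  exists I, F I /\ forall J, F J -> I `<=` J -> J `<=` I.
Proof.
move=> noethA Fid FI0.
have [C Ctot|I [[FI|I0'] Imax]] := @Zorn_bigcup A [set X | F X \/ X = set0].
- move=> Ctot'; case: (pselect (exists2 X, C X & F X)) => [[X CX FX]|nF]; last first.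
    right; apply/seteqP; split=> // x [X CX Xx].
    by case: (Ctot X CX) => [FX|X0]; [case: nF; exists X | rewrite X0 in Xx].
  left; have idU : is_ideal (\bigcup_(X in C) X).
    split; first by exists X => //; exact: (ideal0 (Fid _ FX)).
      move=> a b [Y CY Ya] [Z CZ Zb].
      have FC W w : C W -> W w -> F W.
        by move=> CW Ww; case: (Ctot W CW) => // W0; rewrite W0 in Ww.
      have [YZ|ZY] := Ctot' _ _ CY CZ.
        by exists Z => //; apply: (idealD (Fid _ (FC _ _ CZ Zb))) => //; apply: YZ.
      by exists Y => //; apply: (idealD (Fid _ (FC _ _ CY Ya))) => //; apply: ZY.
    move=> a b [Y CY Yb]; exists Y => //; case: (Ctot Y CY) => [FY|Y0].
      exact: (idealMl (Fid _ FY)).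
    by rewrite Y0 in Yb.
  have [s sE] := noethA _ idU.
  (* The finitely many generators of the union already lie in one member of the chain. *)
  suff [Y CY sY] : exists2 Y, C Y /\ F Y & [set` s] `<=` Y.
    case: CY => CY FY; suff -> : \bigcup_(X in C) X = Y by [].
    apply/seteqP; split=> [|y Yy]; last by exists Y.
    by rewrite sE; apply: ideal_gen_sub => //; apply: Fid.
  have: [set` s] `<=` \bigcup_(X in C) X by rewrite sE; apply: sub_ideal_gen.
  elim: s {sE} => [|a s IHs] sU; first by exists X.
  have [|Y [CY FY] sY] := IHs.
    by move=> b /= bs; apply: sU; rewrite /= inE bs orbT.
  have [Z CZ Za] : (\bigcup_(X in C) X) a by apply: sU; rewrite /= inE eqxx.
  have FZ : F Z by case: (Ctot Z CZ) => // Z0; rewrite Z0 in Za.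
  have [YZ|ZY] := Ctot' _ _ CY CZ.
    exists Z => // b /=; rewrite inE => /orP[/eqP->//|bs].
    by apply/YZ/sY.
  exists Y => // b /=; rewrite inE => /orP[/eqP->|bs]; first exact: ZY.
  exact: sY.
- exists I; split=> // J FJ IJ; apply: contrapT => nJI.
  by apply: (Imax J); [split | left].
- exists I0; split=> // J FJ I0J; apply: contrapT => nJI.
  apply: (Imax I0); last by left.
  rewrite I0'; split=> // h; have := ideal0 (Fid _ FI0).
  by move=> /h.
Qed.

Lemma noetherian_quotient (A B : comNzRingType) (pi : {rmorphism A -> B}) :
  noetherian A -> (forall b, exists a, pi a = b) -> noetherian B.
Proof.
move=> noethA surj J idJ; pose I := [set a | J (pi a)].
have idI : is_ideal I.
  split; first by rewrite /I /= rmorph0; apply: ideal0.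
    by move=> a b Ia Ib; rewrite /I /= rmorphD; apply: idealD.
  by move=> a b Ib; rewrite /I /= rmorphM; apply: idealMl.
have [s sE] := noethA I idI; exists (map pi s); apply/seteqP; split=> [b Jb|].
  have [a ab] := surj b; have : I a by rewrite /I /= ab.
  rewrite sE => /ideal_gen_seqP[c aE]; apply/ideal_gen_seqP.
  exists (pi \o c); rewrite -ab aE rmorph_sum size_map; apply: eq_bigr => i _.
  by rewrite rmorphM /= (nth_map 0).
apply: ideal_gen_sub => // _ /= /mapP[a as_ ->].
suff: I a by [].
by rewrite sE; apply: sub_ideal_gen.
Qed.

Lemma noetherian_localization (A L : comNzRingType) (P : set A)
    (phi : {rmorphism A -> L}) :
  noetherian A -> is_localization P phi -> noetherian L.
Proof.
move=> noethA [inv frac _] J idJ; pose I := [set a | J (phi a)].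
have idI : is_ideal I.
  split; first by rewrite /I /= rmorph0; apply: ideal0.
    by move=> a b Ia Ib; rewrite /I /= rmorphD; apply: idealD.
  by move=> a b Ib; rewrite /I /= rmorphM; apply: idealMl.
have [s sE] := noethA I idI; exists (map phi s); apply/seteqP; split=> [b Jb|].
  have [a [t [nPt ta]]] := frac b; have [u tu] := inv t nPt.
  have : I a by rewrite /I /= -ta; apply: idealMl.
  rewrite sE => /ideal_gen_seqP[c aE].
  have -> : b = u * phi a by rewrite -ta mulrA [u * _]mulrC tu mul1r.
  apply: (idealMl (ideal_genP _)); rewrite aE rmorph_sum.
  apply: (ideal_sum (ideal_genP _)) => i _; rewrite rmorphM.
  apply: (idealMl (ideal_genP _)); apply: sub_ideal_gen => /=.
  by apply: map_f; apply: mem_nth.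
apply: ideal_gen_sub => // _ /= /mapP[a as_ ->].
suff: I a by [].
by rewrite sE; apply: sub_ideal_gen.
Qed.

Section RegularRing.
Variable L : comNzRingType.

Lemma ext_vanish_ring p n (G : 'M[L]_(p, n)) : ext_vanish G (L^o : lmodType L) <->
  forall h : 'cV_p, (forall v : 'rV_p, v *m G = 0 -> v *m h = 0) ->
    exists u, h = G *m u.
Proof.
have actE q r (B : 'M[L]_(q, r)) (h : 'cV_r) i :
    act B (fun j => h j ord0 : L^o) i = (B *m h) i ord0 by rewrite mxE.
split=> vG h Gh.
  have [|u uE] := vG (fun i => h i ord0).
    by move=> v vG0; rewrite actE Gh // mxE.
  exists (\col_j u j); apply/matrixP => i j; rewrite ord1 uE mxE /act.
  by apply: eq_bigr => l _; rewrite mxE.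
have [|u uE] := vG (\col_i h i).
  move=> v vG0; apply/matrixP => i j; rewrite !ord1 mxE [RHS]mxE -[RHS](Gh v vG0).
  by rewrite /act; apply: eq_bigr => l _; rewrite mxE.
exists (fun j => u j ord0) => i; rewrite actE -uE mxE //.
Qed.
End RegularRing.

(** * Change of rings modulo a nonzerodivisor *)

Section Rees.
Variables (L Lb : comNzRingType) (pi : {rmorphism L -> Lb}) (y : L).
Hypotheses (surj_pi : forall b, exists a, pi a = b)
  (ker_pi : forall a, pi a = 0 <-> exists l, a = y * l)
  (nzd_y : forall l, y * l = 0 -> l = 0) (noethL : noetherian Lb).

(** Second differential of a resolution over [L] of coker (map_mx pi G), the first one being
    [col_mx G y%:M]. Lifts of consecutive differentials over [Lb] compose to a multiple [y *: X]
    instead of 0, and the block [- X] corrects this. *)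
Let cone q p n (D : 'M[L]_(q, p)) (G : 'M[L]_(p, n)) (X : 'M[L]_(q, n)) :
    'M_(q + p, p + n) := block_mx D (- X) y%:M (- G).

Let lift_mx p n (G : 'M[Lb]_(p, n)) : exists G', G = map_mx pi G'.
Proof.
have [f fE] := choice surj_pi.
by exists (map_mx f G); apply/matrixP => i j; rewrite !mxE fE.
Qed.

Let ker_mx p n (G : 'M[L]_(p, n)) : map_mx pi G = 0 -> exists X, G = y *: X.
Proof.
move=> G0; have Gij i j : exists l, G i j = y * l.
  by apply/ker_pi; have /matrixP/(_ i j) := G0; rewrite !mxE.
exists (\matrix_(i, j) projT1 (cid (Gij i j))); apply/matrixP => i j.
by rewrite !mxE; case: cid.
Qed.

Let nzd_mx p n (G : 'M[L]_(p, n)) : y *: G = 0 -> G = 0.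
Proof.
move=> /matrixP yG; apply/matrixP => i j; have := yG i j; rewrite !mxE.
exact: nzd_y.
Qed.

(** This is Ext^(t+2)_L(N, L) = Ext^(t+1)_Lb(N, Lb) for N = coker (map_mx pi G), whose first syzygy
    over [L] is presented by the cone. For t = 0, a lifted cocycle [h] has D h = y w, and (w, h) is
    a cocycle for the cone. For larger t, the cone of the next pair of lifts is a syzygy matrix of
    the present one. *)
Lemma ext_some_rees t q p n (D : 'M_(q, p)) (G : 'M_(p, n)) (X : 'M_(q, n)) :
  D *m G = y *: X -> is_syz (map_mx pi D) (map_mx pi G) ->
  ext_all t (cone D G X) (L^o : lmodType L) ->
  ext_some t (map_mx pi G) (Lb^o : lmodType Lb).
Proof.
elim: t q p n D G X => [|t IHt] q p n D G X DG syzD.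
  move=> /ext_vanish_ring vC; apply/ext_vanish_ring => hb hbP.
  have [h hE] := lift_mx hb.
  have [w wE] : exists w, D *m h = y *: w.
    apply: ker_mx; rewrite map_mxM -hE; apply/row_matrixP => i.
    by rewrite row_mul row0; apply: hbP; rewrite -row_mul is_syz_mul // row0.
  have [|u uE] := vC (col_mx w h).
    move=> v; rewrite -[v]hsubmxK mul_row_block mul_row_col => vC0.
    have vD : lsubmx v *m D + y *: rsubmx v = 0.
      by move: vC0; rewrite -row_mx0 => /eq_row_mx[]; rewrite mul_mx_scalar.
    apply: nzd_mx; rewrite scalerDr scalemxAr -wE mulmxA scalemxAl -mulmxDl.
    by rewrite vD mul0mx.
  exists (map_mx pi (- dsubmx u)); rewrite hE -map_mxM.
  move: uE; rewrite -[u]vsubmxK mul_block_col => /eq_col_mx[_ ->].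
  rewrite map_mxD mul_scalar_mx map_mxZ (ker_pi y).2; last by exists 1; rewrite mulr1.
  by rewrite scale0r add0r vsubmxK mulNmx mulmxN.
move=> hC; have [q' [Eb syzE]] := noetherian_syz (map_mx pi D) noethL.
have [E EbE] := lift_mx Eb; rewrite EbE in syzE.
have [X' ED] : exists X', E *m D = y *: X'.
  by apply: ker_mx; rewrite map_mxM is_syz_mul.
have EX : E *m X = X' *m G.
  apply/eqP; rewrite -subr_eq0; apply/eqP/nzd_mx.
  by rewrite scalerBr scalemxAr -DG scalemxAl -ED mulmxA subrr.
exists q, (map_mx pi D); split=> //; apply: (IHt _ _ _ E D X') => //.
apply: hC => v; split=> [|[w ->]].
  rewrite -[v]hsubmxK mul_row_block -row_mx0 => /eq_row_mx[].
  rewrite !mulmxN mul_mx_scalar; move: (lsubmx v) (rsubmx v) => v1 v2 v1D _.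
  have [w1b w1bE] : exists w, map_mx pi v1 = w *m map_mx pi E.
    apply/syzE; rewrite -map_mxM.
    have -> : v1 *m D = y *: - v2 by apply/eqP; rewrite scalerN -addr_eq0 v1D.
    by rewrite map_mxZ (ker_pi y).2 ?scale0r //; exists 1; rewrite mulr1.
  have [w1 w1E] := lift_mx w1b.
  have [w2 w2E] : exists w2, v1 - w1 *m E = y *: w2.
    by apply: ker_mx; rewrite map_mxB map_mxM w1bE w1E subrr.
  exists (row_mx w1 w2); rewrite mul_row_block; congr row_mx.
    by rewrite mul_mx_scalar -w2E addrC subrK.
  apply/eqP; rewrite -subr_eq0; apply/eqP/nzd_mx.
  rewrite !mulmxN -opprD opprK !scalerDr [y *: (w1 *m X')]scalemxAr -ED.
  rewrite [y *: (w2 *m D)]scalemxAl -w2E.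
  by rewrite mulmxBl mulmxA [w1 *m E *m D + _]addrC subrK addrC v1D.
rewrite -[w]hsubmxK mul_row_block mul_row_block !mulmxN !mul_mx_scalar.
move: (lsubmx w) (rsubmx w) => w1 w2; rewrite -row_mx0; congr row_mx.
  rewrite mulmxDl -mulmxA ED -scalemxAl -scalemxAr scalerDr !scalerN addrACA.
  by rewrite !subrr addr0.
rewrite -opprD !mulmxDl !mulNmx -!mulmxA EX DG -scalemxAl -scalemxAr addrACA.
by rewrite !subrr addr0 oppr0.
Qed.

Lemma injdim_quotient (k : fieldType) (io : {rmorphism k -> Lb}) t :
  injdim_le t (L^o : lmodType L) -> injdim_le t (Lb^o : lmodType Lb).
Proof.
move=> injL; apply: (injdim_of_ext_some io) => a ida.
have [p [Gb aE]] := noetherian_col noethL ida; exists p, Gb; split=> //.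
have [G GbE] := lift_mx Gb; rewrite GbE.
have [q [Db syzD]] := noetherian_syz (map_mx pi G) noethL.
have [D DbE] := lift_mx Db; rewrite DbE in syzD.
have [X DG] : exists X, D *m G = y *: X.
  by apply: ker_mx; rewrite map_mxM is_syz_mul.
by apply: (ext_some_rees DG syzD); apply: injdim_ext_all.
Qed.
End Rees.

(** * Self-injectivity of local rings with a socle element *)

Section LocalRing.
Variables (L : comNzRingType) (m : set L).
Hypotheses (noethL : noetherian L) (idm : is_ideal m) (m1 : ~ m 1)
  (unit_m : forall x, ~ m x -> exists y, x * y = 1).

(* Nakayama's lemma for Ext^1(coker G, M). *)
Definition nakayama (M : lmodType L) : Prop :=
  forall p n (G : 'M[L]_(p, n)) x, m x ->
  (forall h : 'I_p -> M, cocycle G h -> exists h' u,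
    cocycle G h' /\ h =1 fun i => x *: h' i + act G u i) ->
  ext_vanish G M.

(** The cocycles are generated by the rows of a matrix N. The hypothesis gives N = x A N + B with
    coboundaries as rows of B, and det (1 - x A) is a unit because it is 1 modulo [m]. *)
Lemma nakayama_ring : nakayama (L^o : lmodType L).
Proof.
move=> p n G x mx hG; apply/ext_vanish_ring.
pose Z := [set r : 'rV[L]_p | forall v : 'rV_p, v *m G = 0 -> v *m r^T = 0].
have sZ : submodule Z.
  split; first by move=> v _; rewrite trmx0 mulmx0.
    by move=> r s Zr Zs v vG; rewrite linearD mulmxDr Zr // Zs // addr0.
  by move=> a r Zr v vG; rewrite linearZ -scalemxAr Zr // scaler0.
have [q [N ZN]] := noetherian_rows noethL sZ.
have rowZ i : exists w u, row i N = x *: (w *m N) + (G *m u)^T.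
  have Zi : Z (row i N) by apply/ZN; exists (delta_mx ord0 i); rewrite -rowE.
  have [|h' [u [Gh' hE]]] := hG (fun j => N i j).
    move=> v /Zi/matrixP/(_ ord0 ord0); rewrite [LHS]mxE [RHS]mxE => e.
    by rewrite -[RHS]e /act; apply: eq_bigr => j _; rewrite !mxE.
  have [w wE] : exists w, \row_j h' j = w *m N.
    apply/ZN => v vG; apply/matrixP => a b; rewrite !ord1 mxE [RHS]mxE -[RHS](Gh' v vG).
    by rewrite /act; apply: eq_bigr => j _; rewrite !mxE.
  exists w, (\col_j u j); rewrite -wE; apply/matrixP => a j.
  rewrite !mxE hE; congr (_ + _).
  by rewrite /act; apply: eq_bigr => l _; rewrite mxE.
have [w wE] := choice rowZ; have [u uE] := choice wE.
pose A := \matrix_i w i; pose B := \matrix_i (G *m u i)^T.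
have NAB : N = x *: (A *m N) + B.
  by apply/row_matrixP => i; rewrite uE linearD linearZ /= row_mul !rowK.
have NE : (1%:M - x *: A) *m N = B.
  by rewrite mulmxBl mul1mx {1}NAB -scalemxAl addrAC subrr add0r.
have [pi_] := exists_quotient idm m1; move=> [pi [_ kerpi]].
have [d dE] : exists d, \det (1%:M - x *: A) * d = 1.
  apply: unit_m => /kerpi; rewrite -det_map_mx map_mxB map_mx1 map_mxZ.
  by rewrite (kerpi x).2 // scale0r subr0 det1 => /eqP; rewrite oner_eq0.
have NB : N = d *: (\adj (1%:M - x *: A) *m B).
  by rewrite -NE mulmxA mul_adj_mx mul_scalar_mx scalerA mulrC dE scale1r.
move=> h Gh; have /ZN[v vE] : Z h^T by move=> v vG; rewrite trmxK; apply: Gh.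
pose c := d *: (v *m \adj (1%:M - x *: A)).
exists (\sum_i c ord0 i *: u i).
apply: (can_inj trmxK); rewrite vE NB -scalemxAr mulmxA scalemxAl -/c.
rewrite mulmx_sum_row mulmx_sumr linear_sum; apply: eq_bigr => i _.
by rewrite rowK -scalemxAr linearZ.
Qed.

(** As [C] need not be finitely generated, the property is not proved for it directly but
    transported from [M] by the dimension shift, with [K] in place of [G]. *)
Lemma nakayama_cosyzygy (M E C : lmodType L) (f : {linear M -> E})
    (g : {linear E -> C}) :
  injective_module E -> ses f g -> nakayama M -> nakayama C.
Proof.
move=> injE sesfg nakM p n G x mx hG.
have [q [K syzK]] := noetherian_syz G noethL.
apply: (ext_vanish_cosyzygy injE sesfg syzK); apply: (nakM _ _ _ x) => // k Kk.
case: (sesfg) => inj_f surj_g gf.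
have [|u' u'E] := injective_ext_vanish (G := K) injE (h := f \o k).
  by move=> v vK; rewrite act_linear /= (Kk v vK) linear0.
have [|h' [c [Gh' hE]]] := hG (g \o u').
  apply: (cocycle_of_syz syzK) => i; rewrite act_linear /= -u'E /=.
  exact: (ses_comp sesfg).
have [l' l'E] := choice (fun i => surj_g (h' i)).
have [c' c'E] := choice (fun i => surj_g (c i)).
have gKl i : g (act K l' i) = 0.
  rewrite -[LHS]/((g \o _) i) -act_linear -(act_syz_cocycle syzK Gh' i).
  by apply: act_ext => j /=.
have [k' k'E] := choice (fun i => (gf _).1 (gKl i)).
have gu i : g (u' i - x *: l' i - act G c' i) = 0.
  rewrite !linearB linearZ /= l'E [g (u' i)]hE -[g (act G c' i)]/((g \o _) i).
  rewrite -act_linear (act_ext G (c'E : g \o c' =1 c)).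
  by rewrite [_ + act G c i]addrC addrK subrr.
have [u uE] := choice (fun i => (gf _).1 (gu i)).
exists k', u; split.
  move=> v vK; apply: inj_f; rewrite linear0 -[LHS]/((f \o _) ord0) -act_linear.
  by rewrite (act_ext v (k'E : f \o k' =1 act K l')) -act_mul vK act0l.
move=> i; apply: inj_f; rewrite linearD linearZ /= k'E -[f (k i)]/((f \o k) i) u'E.
rewrite -[f (act K u i)]/((f \o _) i) -act_linear.
rewrite (act_ext K (uE : f \o u =1 fun i => u' i - x *: l' i - act G c' i)).
rewrite actB actB actZ -act_mul is_syz_mul // act0l subr0.
by rewrite addrC subrK.
Qed.

Section Socle.
Variable z : L.
Hypothesis annz : forall x, m x <-> x * z = 0.

(** Suppose that [a] is maximal with Ext^1(L/a, M) nonzero. If some x in [m] is injective on L/a,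
    then Ext^1 is divisible by x, as Ext^2 vanishes, and Nakayama applies. If some x in [m] lies
    outside [a], then L/a is built from quotients by larger ideals. Otherwise [a] is L or [m], and
    L/m embeds in L as zL. *)
Lemma injective_of_cosyzygy (M E C : lmodType L) (f : {linear M -> E})
    (g : {linear E -> C}) :
  injective_module E -> ses f g -> nakayama M -> injective_module C ->
  injective_module M.
Proof.
move=> injE sesfg nakM injC; case: (sesfg) => inj_f surj_g gf.
apply: baer_injective => a0 f0 ida0.
pose ext a := forall h : L -> M,
  (forall x y, a x -> a y -> h (x + y) = h x + h y) ->
  (forall c x, a x -> h (c * x) = c *: h x) ->
  exists e, forall x, a x -> h x = x *: e.
suff : ext a0 by apply.
apply: contrapT => next0.
have [a [[ida nexta] amax]] :=
  noetherian_max (F := [set a | is_ideal a /\ ~ ext a]) noethL (fun a h => h.1)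
    (conj ida0 next0).
have {}amax b : is_ideal b -> a `<=` b -> ext b \/ b `<=` a.
  move=> idb ab; case: (pselect (ext b)) => extb; [by left | right].
  exact: amax.
apply: nexta => h hD hZ; have [p [G aE]] := noetherian_col noethL ida.
have aG i : a (G i ord0) by rewrite aE; exists (delta_mx ord0 i); rewrite -rowE mxE.
(* Multiplication by x is injective on L/a, so Ext^1(L/a, M) = x Ext^1(L/a, M). *)
case: (pselect (exists2 x, m x & forall l, a (x * l) -> a l)) => [[x mx xa]|nx].
  rewrite aE in hD hZ *; apply: ext_vanish_extend hD hZ.
  apply: (nakM _ _ _ x) => // k Gk.
  have [|e eE] := injective_ext_vanish (G := G) injE (h := f \o k).
    by move=> v vK; rewrite act_linear /= (Gk v vK) linear0.
  have Ge i : G i ord0 *: g (e ord0) = 0.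
    have := eE i; rewrite /act big_ord_recl big_ord0 addr0 /= => ke.
    by rewrite -linearZ -ke (ses_comp sesfg).
  have ae b : a b -> b *: g (e ord0) = 0.
    rewrite aE => -[v ->]; rewrite mxE scaler_suml big1 // => i _.
    by rewrite -scalerA Ge scaler0.
  (* The system G c' = 0, x c' = g(e) is to be solved in [C]. It is consistent because [a] kills
     g(e) and [x] is injective on L/a. *)
  pose h0 := fun i : 'I_(p + 1) => if split i is inl _ then 0 else g (e ord0).
  have [|c' c'E] := injective_ext_vanish (G := col_mx G x%:M) injC (h := h0).
    move=> v; rewrite -[v]hsubmxK mul_row_col => vG.
    rewrite /act big_split_ord /= big1 ?add0r => [|i _]; last first.
      by rewrite /h0 (unsplitK (inl i)) scaler0.
    rewrite big_ord_recl big_ord0 addr0 /h0 (unsplitK (inr ord0)) row_mxEr.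
    apply: ae; apply: xa.
    have /matrixP/(_ ord0 ord0) := vG; rewrite mul_mx_scalar mxE.
    rewrite [X in _ + X]mxE [RHS]mxE => /eqP; rewrite addr_eq0 => /eqP vGx.
    rewrite -[x * _]opprK -vGx; apply: idealN => //.
    by rewrite aE; exists (lsubmx v).
  have Gc' i : G i ord0 *: c' ord0 = 0.
    have := c'E (lshift 1 i); rewrite /h0 (unsplitK (inl i)) /act.
    by rewrite big_ord_recl big_ord0 addr0 col_mxEu.
  have xc' : x *: c' ord0 = g (e ord0).
    have := c'E (rshift p ord0); rewrite /h0 (unsplitK (inr ord0)) /act.
    by rewrite big_ord_recl big_ord0 addr0 col_mxEd mxE eqxx.
  have [e' e'E] := surj_g (c' ord0).
  have gGe i : g (G i ord0 *: e') = 0 by rewrite linearZ /= e'E Gc'.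
  have [k' k'E] := choice (fun i => (gf _).1 (gGe i)).
  have gm0 : g (e ord0 - x *: e') = 0 by rewrite linearB linearZ /= e'E xc' subrr.
  have [m0 m0E] := (gf _).1 gm0.
  exists k', (fun=> m0); split.
    move=> v vG; apply: inj_f; rewrite linear0 -[LHS]/((f \o _) ord0) -act_linear.
    rewrite (act_ext v (w := act G (fun=> e'))); first by rewrite -act_mul vG act0l.
    by move=> i; rewrite /act big_ord_recl big_ord0 addr0 -k'E.
  move=> i; apply: inj_f; rewrite -[LHS]/((f \o k) i) eE /act !big_ord_recl !big_ord0.
  rewrite !addr0 linearD !linearZ /= k'E m0E scalerBr !scalerA mulrC.
  by rewrite addrC subrK.
have {}nx x : m x -> exists l, a (x * l) /\ ~ a l.
  move=> mx; apply: contrapT => nl; apply: nx; exists x => // l axl.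
  by apply: contrapT => nal; apply: nl; exists l.
case: (pselect (exists2 x, m x & ~ a x)) => [[x mx nax]|ma].
  (* L/a is an extension of L/(a + xL) by L/(a : x), and both ideals strictly contain [a]. *)
  pose b := [set l | a (x * l)].
  have idb : is_ideal b.
    split; first by rewrite /b /= mulr0; apply: ideal0.
      by move=> u v bu bv; rewrite /b /= mulrDr; apply: idealD.
    by move=> u v bv; rewrite /b /= mulrCA; apply: idealMl.
  have [||extb] := amax b idb; first by move=> l al; apply: idealMl.
    move=> extb; pose c := [set w | exists a' l, a a' /\ w = a' + x * l].
    have idc : is_ideal c.
      split; first by exists 0, 0; rewrite mulr0 addr0; split=> //; apply: ideal0.
        move=> _ _ [u [l [au ->]]] [v [l' [av ->]]]; exists (u + v), (l + l').
        by split; [apply: idealD | ring].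
      move=> d _ [u [l [au ->]]]; exists (d * u), (d * l).
      by split; [apply: idealMl | ring].
    have cx : c x by exists 0, 1; split; [apply: ideal0 | ring].
    have [||extc] := amax c idc.
    - by move=> u au; exists u, 0; split=> //; ring.
    - move=> extc.
      have [||c0 c0E] := extb (fun l => h (x * l)).
      + by move=> u v bu bv; rewrite mulrDr hD.
      + by move=> u v bv; rewrite -(hZ u (x * v)) // mulrCA.
      have h0 : h 0 = 0 by rewrite -(mulr0 0) hZ ?scale0r //; apply: ideal0.
      have hB u v : a u -> a v -> h (u - v) = h u - h v.
        move=> au av; rewrite hD //; last exact: idealN.
        by rewrite -mulN1r hZ // scaleN1r.
      (* [F] extends [h] to [c] by the value [c0] at [x]. It is well defined because [c0] represents
         the map l to h (x l) on [b]; the value 0 outside [c] is arbitrary. *)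
      have /choice[F FP] w : exists r, c w -> exists a' l,
          [/\ a a', w = a' + x * l & r = h a' + l *: c0].
        case: (pselect (c w)) => [[a' [l [aa' wE]]]|//]; last by exists 0.
        by exists (h a' + l *: c0) => _; exists a', l.
      have FE a' l : a a' -> F (a' + x * l) = h a' + l *: c0.
        move=> aa'; have [|a2 [l2 [aa2 e ->]]] := FP (a' + x * l); first by exists a', l.
        apply/eqP; rewrite -subr_eq0 opprD addrACA -hB // -scalerBl.
        have xl : x * (l - l2) = a2 - a'.
          by rewrite mulrBr -[x * l](addKr a') e; ring.
        rewrite -[l2 - l]opprB scaleNr -c0E ?xl ?subrr //.
        by rewrite /b /= xl; apply: idealB.
      have [||e eE] := extc F.
      + move=> _ _ [u [l [au ->]]] [v [l' [av ->]]].
        rewrite !FE // -[X in F X](_ : u + v + x * (l + l') = _); last by ring.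
        rewrite (FE _ _ (idealD ida au av)) (hD _ _ au av) scalerDl.
        exact: addrACA.
      + move=> d _ [u [l [au ->]]]; rewrite FE //.
        rewrite -[X in F X](_ : d * u + x * (d * l) = _); last by ring.
        by rewrite (FE _ _ (idealMl ida d au)) (hZ _ _ au) scalerDr scalerA.
      exists e => u au; rewrite -eE; last by exists u, 0; split=> //; ring.
      by rewrite -[X in F X](_ : u + x * 0 = _) ?FE ?scale0r ?addr0 //; ring.
    by case: nax; apply: extc.
  by have [l [al nal]] := nx x mx; case: nal; apply: extb.
have {}ma : m `<=` a.
  by move=> x mx; apply: contrapT => nax; apply: ma; exists x.
case: (pselect (a 1)) => [a1|na1].
  by exists (h 1) => x ax; rewrite -hZ // mulr1.
have am : a `<=` m.
  move=> x ax; apply: contrapT => /unit_m[y xy]; apply: na1.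
  by rewrite -xy; apply: idealMr.
(* Here L/a = L/m is the submodule zL of L. *)
have [||e eE] := ext_vanish_extend (injective_ext_vanish (G := G) injE) (f := f \o h).
- by move=> x y /=; rewrite -aE => ax ay; rewrite hD // linearD.
- by move=> c x /=; rewrite -aE => ax; rewrite hZ // linearZ.
rewrite -aE /= in eE.
have [|c' c'E] := injective_ext_vanish (G := z%:M : 'M_1) injC (h := fun=> g e).
  move=> v; rewrite mul_mx_scalar => /matrixP/(_ ord0 ord0); rewrite !mxE mulrC.
  move=> /annz/ma av; rewrite /act big_ord_recl big_ord0 addr0 -linearZ -eE //.
  exact: (ses_comp sesfg).
have zc' : z *: c' ord0 = g e.
  by have := c'E ord0; rewrite /act big_ord_recl big_ord0 addr0 mxE eqxx.
have [e' e'E] := surj_g (c' ord0).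
have gm0 : g (e - z *: e') = 0 by rewrite linearB linearZ /= e'E zc' subrr.
have [m0 m0E] := (gf _).1 gm0.
exists m0 => x ax; apply: inj_f; rewrite eE // linearZ /= m0E scalerBr scalerA.
by rewrite (annz x).1 ?scale0r ?subr0 //; apply: am.
Qed.

(** The resolution is shortened from its right end, where the last cosyzygy is injective; [z]
    expresses that the depth is zero. *)
Lemma injective_of_injdim d M : injdim_le d M -> nakayama M -> injective_module M.
Proof.
elim=> {d M} [//|d M E C f g injE inj_f surj_g gf _ IH nakM].
have sesfg : ses f g by split.
apply: (injective_of_cosyzygy injE sesfg) => //; apply: IH.
exact: nakayama_cosyzygy sesfg nakM.
Qed.

Variable d : nat.
Hypothesis injL : injdim_le d (L^o : lmodType L).

Lemma principal_extension (w h : L) : (forall v, v * w = 0 -> v * h = 0) ->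
  exists c, h = w * c.
Proof.
move=> wh; have injLL := injective_of_injdim injL nakayama_ring.
have [|u uE] := injective_ext_vanish (G := w%:M : 'M_1) injLL (h := fun=> h).
  move=> v; rewrite mul_mx_scalar => /matrixP/(_ ord0 ord0); rewrite !mxE mulrC.
  by move=> /wh vh; rewrite /act big_ord_recl big_ord0 addr0.
exists (u ord0); have := uE ord0; rewrite /act big_ord_recl big_ord0 addr0.
by rewrite mxE eqxx.
Qed.

(** The annihilators of the powers of [x] stabilize, so some power y has the same annihilator as its
    square. Self-injectivity gives y = y^2 c, and 1 - y c is a unit, whence y = 0. *)
Lemma maximal_ideal_nilpotent (x : L) : m x -> exists n, x ^+ n = 0.
Proof.
move=> mx; pose ann n := [set v : L | v * x ^+ n = 0].
have idann n : is_ideal (ann n).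
  split; first by rewrite /ann /= mul0r.
    by move=> u v /= uE vE; rewrite /ann /= mulrDl uE vE addr0.
  by move=> u v /= vE; rewrite /ann /= -mulrA vE mulr0.
have [||_ [[n _ <-] nmax]] := @noetherian_max L (range ann) (ann 0%N) noethL.
- by move=> _ [n _ <-]; apply: idann.
- by exists 0%N.
pose y := x ^+ n.+1.
have [c yE] : exists c, y = y * y * c.
  apply: principal_extension => v vy.
  have : ann n v.
    apply: (nmax (ann (n.+1 + n.+1)%N)); first by exists (n.+1 + n.+1)%N.
      move=> u /= un; rewrite /ann /= (_ : (n.+1 + n.+1 = n + n.+2)%N); last by lia.
      by rewrite exprD mulrA un mul0r.
    by rewrite /ann /= exprD.
  by rewrite /ann /= /y exprSr mulrA => ->; rewrite mul0r.
exists n.+1; rewrite -/y.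
have [c' c'E] : exists c', (1 - y * c) * c' = 1.
  apply: unit_m => m1y; apply: m1.
  have my : m (y * c) by rewrite /y exprS -mulrA; apply: idealMr.
  by rewrite -[1](subrK (y * c)); apply: idealD.
have : y * (1 - y * c) = 0 by rewrite mulrBr mulr1 mulrA -yE subrr.
by move=> /(congr1 ( *%R^~ c')); rewrite -mulrA c'E mulr1 mul0r.
Qed.

Lemma socle_principal (z' : L) : (forall x, m x -> x * z' = 0) -> exists c, z' = z * c.
Proof. by move=> mz'; apply: principal_extension => v /annz/mz'. Qed.
End Socle.
End LocalRing.

(** * Hilbert's basis theorem *)

Lemma noetherian_poly (A : comNzRingType) : noetherian A -> noetherian {poly A}.
Proof.
move=> noethA I idI.
pose lead i := [set a : A | exists f, [/\ I f, (size f <= i.+1)%N & f`_i = a]].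
have leadP i : is_ideal (lead i).
  split.
  - by exists 0; rewrite size_poly0 coef0; split=> //; apply: ideal0.
  - move=> _ _ [f [If sf <-]] [g [Ig sg <-]]; exists (f + g).
    rewrite coefD; split=> //; first exact: idealD.
    by rewrite (leq_trans (size_polyD _ _)) // geq_max sf.
  - move=> a _ [f [If sf <-]]; exists (a%:P * f); rewrite coefCM; split=> //.
      exact: idealMl.
    by rewrite mul_polyC (leq_trans (size_scale_leq _ _)).
have leadS i j : lead i `<=` lead (i + j)%N.
  move=> _ [f [If sf <-]]; exists ('X^j * f); split; first exact: idealMl.
    rewrite (leq_trans (size_polyMleq _ _)) // size_polyXn /=.
    by rewrite addnC -addSn leq_add2r.
  by rewrite coefXnM ltnNge leq_addl /= addnK.
have [||_ [[N _ <-] Nmax]] := @noetherian_max A (range lead) (lead 0%N) noethA.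
- by move=> _ [i _ <-]; apply: leadP.
- by exists 0%N.
have gens i : exists s : seq {poly A}, {in s, forall g, I g} /\
    forall a, lead i a -> exists h, [/\ ideal_gen [set` s] h, (size h <= i.+1)%N & h`_i = a].
  have [t tE] := noethA _ (leadP i).
  have /choice[F FP] a : exists f, lead i a -> [/\ I f, (size f <= i.+1)%N & f`_i = a].
    by case: (pselect (lead i a)) => [[f fP]|nl]; [exists f | exists 0].
  have leadt a : a \in t -> lead i a by rewrite tE => at_; apply: sub_ideal_gen.
  exists (map F t); split=> [_ /mapP[a at_ ->]|a]; first by case: (FP a (leadt a at_)).
  rewrite {1}tE => /ideal_gen_seqP[c ->].
  exists (\sum_(l < size t) (c l)%:P * F t`_l); split.
  - apply: (ideal_sum (ideal_genP _)) => l _; apply: (idealMl (ideal_genP _)).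
    by apply: sub_ideal_gen; apply/map_f/mem_nth.
  - apply: (leq_trans (size_sum _ _ _)); apply/bigmax_leqP => l _.
    rewrite mul_polyC (leq_trans (size_scale_leq _ _)) //.
    by case: (FP t`_l (leadt _ (mem_nth _ (ltn_ord l)))).
  - rewrite coef_sum; apply: eq_bigr => l _; rewrite coefCM.
    by case: (FP t`_l (leadt _ (mem_nth _ (ltn_ord l)))) => _ _ ->.
have /choice[S SP] := gens.
exists (flatten (map S (iota 0 N.+1))).
set J := ideal_gen _; have idJ : is_ideal J := ideal_genP _.
have SJ i : (i <= N)%N -> ideal_gen [set` S i] `<=` J.
  move=> iN; apply: ideal_gen_sub => // g gS; apply: sub_ideal_gen.
  suff: g \in flatten [seq S j | j <- iota 0 N.+1] by [].
  by apply/flatten_mapP; exists i; rewrite ?mem_iota.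
apply/seteqP; split; last first.
  apply: ideal_gen_sub => // g.
  move=> gs; have /flatten_mapP[i _ gS] : g \in flatten [seq S j | j <- iota 0 N.+1] := gs.
  exact: ((SP i).1 g gS).
suff H d (f : {poly A}) : (size f <= d)%N -> I f -> J f by move=> f If; apply: (H (size f)).
elim: d f => [|d IHd] f sf If.
  by move: sf; rewrite leqn0 size_poly_eq0 => /eqP ->; apply: ideal0.
pose i := minn d N; have iN : (i <= N)%N by rewrite geq_minr.
have id : (i <= d)%N by rewrite geq_minl.
(* Beyond [N] the ideals of leading coefficients no longer grow, so a generator of degree at most
   [N] times a power of 'X cancels the top term. *)
have lf : lead i f`_d.
  have ld : lead d f`_d by exists f.
  rewrite /i; case: (leqP d N) => // Nd.
  apply: (Nmax (lead d)) => //.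
  by have := @leadS N (d - N)%N; rewrite subnKC // ltnW.
have [_ Si] := SP i; have [h [Sh sh hE]] := Si _ lf.
have Ih : I h.
  suff SI : ideal_gen [set` S i] `<=` I by apply: SI.
  by apply: ideal_gen_sub => // g gS; exact: ((SP i).1 g gS).
rewrite -[f](subrK ('X^(d - i) * h)); apply: (idealD idJ); last first.
  by apply: (idealMl idJ); apply: (SJ i).
apply: IHd; last by apply: (idealB idI) => //; apply: (idealMl idI).
apply/leq_sizeP => j dj; rewrite coefB coefXnM.
have -> : (j < d - i)%N = false by lia.
move: dj; rewrite leq_eqVlt => /orP[/eqP<-|dj].
  by rewrite subKn // hE subrr.
rewrite !nth_default ?subrr //; first by rewrite (leq_trans sh) //; lia.
exact: leq_trans sf dj.
Qed.

Lemma noetherian_field (k : fieldType) : noetherian k.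
Proof.
move=> I idI; case: (pselect (exists2 x, I x & x != 0)) => [[x Ix x0]|nI].
  exists [:: x]; apply/seteqP; split; last first.
    by apply: ideal_gen_sub => // y /=; rewrite inE => /eqP ->.
  move=> y _; rewrite -[y](divfK x0); apply: (idealMl (ideal_genP _)).
  by apply: sub_ideal_gen; rewrite /= inE.
exists [::]; apply/seteqP; split; last exact: ideal_gen_sub.
move=> x Ix; have [->|x0] := eqVneq x 0; first exact: (ideal0 (ideal_genP _)).
by case: nI; exists x.
Qed.

Lemma noetherian_mpoly (k : fieldType) n : noetherian {mpoly k[n]}.
Proof.
elim: n => [|n IHn].
  apply: (noetherian_quotient (pi := (@mpolyC 0 k : {rmorphism k -> _}))).
    exact: noetherian_field.
  by move=> p; exists (p@_0%MM); rewrite [RHS]nvar0_mpolyC.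
pose f (p : {poly {mpoly k[n]}}) : {mpoly k[n.+1]} :=
  (map_poly (@mwiden n k) p).['X_ord_max].
have [f' f'E] : exists f' : {rmorphism _ -> _}, forall p, f' p = f p.
  apply: rmorphism_of_fun => [p q|p q|]; rewrite /f.
  - by rewrite rmorphD hornerD.
  - by rewrite rmorphM hornerM.
  - by rewrite rmorph1 hornerC.
apply: (noetherian_quotient (pi := f') (noetherian_poly IHn)) => p.
have imX i : exists q, f' q = 'X_i.
  have [j ->|->] := unliftP ord_max i; last by exists 'X; rewrite f'E /f map_polyX hornerX.
  exists ('X_j)%:P; rewrite f'E /f map_polyC hornerC /= mwidenX mnmwiden1.
  by congr mpolyX; congr mnm1; apply: val_inj; rewrite /= /bump leqNgt ltn_ord.
have [g gE] := choice imX.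
exists (\sum_(m <- msupp p) (p@_m)%:MP%:P * \prod_i g i ^+ m i).
rewrite rmorph_sum [RHS]mpolyE; apply: eq_bigr => m _.
rewrite rmorphM f'E /f map_polyC hornerC /= mwidenC mul_mpolyC; congr (_ *: _).
rewrite rmorph_prod [RHS]mpolyXE_id; apply: eq_bigr => i _.
by rewrite rmorphXn gE.
Qed.

(** * Homogeneous ideals *)

Lemma pihomog_mull (n : nat) (A : comNzRingType) d e (y f : {mpoly A[n]}) :
  y \is d.-homog -> pihomog mdeg (d + e) (y * f) = y * pihomog mdeg e f.
Proof.
move=> hy; rewrite {1}[f](@pihomog_partitionE _ _ mdeg _ f (leq_maxl (msize f) e.+1)).
rewrite mulr_sumr linear_sum /=.
have lte : (e < maxn (msize f) e.+1)%N by rewrite leq_max ltnSn orbT.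
rewrite (bigD1 (Ordinal lte)) //= big1 ?addr0 => [|j jE].
  by rewrite pihomog_dE //; apply: dhomogM => //; apply: pihomogP.
apply: (pihomog_ne0 (d := (d + j)%N)); first by rewrite eqn_add2l -val_eqE in jE *.
by apply: dhomogM => //; apply: pihomogP.
Qed.

Lemma pihomog_mull_lt (n : nat) (A : comNzRingType) d c (y f : {mpoly A[n]}) :
  y \is d.-homog -> (c < d)%N -> pihomog mdeg c (y * f) = 0.
Proof.
move=> hy cd; rewrite [f](@pihomog_partitionE _ _ mdeg _ f (leqnn _)) mulr_sumr linear_sum /=.
rewrite big1 // => j _; apply: (pihomog_ne0 (d := (d + j)%N)).
  by rewrite gtn_eqF // (leq_trans cd) // leq_addr.
by apply: dhomogM => //; apply: pihomogP.
Qed.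

Lemma dhomog_mpolyX (n : nat) (A : comNzRingType) (m : 'X_{1..n}) :
  ('X_[m] : {mpoly A[n]}) \is (mdeg m).-homog.
Proof. by rewrite dhomogX. Qed.

Lemma dhomog_mpolyXU (n : nat) (A : comNzRingType) (i : 'I_n) :
  ('X_i : {mpoly A[n]}) \is 1.-homog.
Proof. by have := dhomog_mpolyX A U_(i)%MM; rewrite mdeg1. Qed.

Lemma homog_sub (n : nat) (A : comNzRingType) (J : set {mpoly A[n]}) f :
  is_ideal J -> (forall d, J (pihomog mdeg d f)) -> J f.
Proof.
move=> idJ Jf; rewrite [f](@pihomog_partitionE _ _ mdeg _ f (leqnn _)).
by apply: ideal_sum.
Qed.

Lemma mnm_split (n : nat) (m : 'X_{1..n}) N : (N <= mdeg m)%N ->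
  exists m1 m2 : 'X_{1..n}, mdeg m1 = N /\ m = (m1 + m2)%MM.
Proof.
elim: N => [|N IHN] Nm; first by exists 0%MM, m; rewrite mdeg0 add0m.
have [m1 [m2 [m1N mE]]] := IHN (ltnW Nm).
have m20 : m2 != 0%MM by rewrite -mdeg_eq0; move: Nm; rewrite mE mdegD m1N; lia.
have [i m2i] : exists i, m2 i != 0%N.
  apply: contrapT => nm; case/eqP: m20; apply/mnmP => i; rewrite mnm0E; apply/eqP.
  by apply: contrapT => /negP m2i; apply: nm; exists i.
exists (m1 + U_(i))%MM, (m2 - U_(i))%MM; rewrite mdegD mdeg1 m1N addn1; split=> //.
by rewrite -addmA [(U_(i) + _)%MM]addmC submK // lep1mP.
Qed.

Section Sat.
Variables (n : nat) (A : comNzRingType) (I : set {mpoly A[n.+1]}).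
Hypothesis hI : homog_ideal I.
Let idI : is_ideal I := hI.1.

Lemma sat_ge f N : (forall m : 'X_{1..n.+1}, mdeg m = N -> I ('X_[m] * f)) ->
  forall m : 'X_{1..n.+1}, (N <= mdeg m)%N -> I ('X_[m] * f).
Proof.
move=> If m /mnm_split[m1 [m2 [m1N ->]]]; rewrite addmC mpolyXD -mulrA.
by apply: idealMl => //; apply: If.
Qed.

Lemma sat_ideal : is_ideal (sat I).
Proof.
split.
- by exists 0%N => m _; rewrite mulr0; apply: ideal0.
- move=> f g [N IN] [N' IN']; exists (maxn N N') => m mE; rewrite mulrDr.
  by apply: idealD => //; [apply: (sat_ge IN) | apply: (sat_ge IN')];
    rewrite mE ?leq_maxl ?leq_maxr.
- move=> f g [N IN]; exists N => m mN; rewrite mulrCA.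
  by apply: idealMl => //; apply: IN.
Qed.

Lemma sub_sat : I `<=` sat I.
Proof. by move=> f If; exists 0%N => m _; apply: idealMl. Qed.

Lemma sat_homog : homog_ideal (sat I).
Proof.
split; first exact: sat_ideal.
move=> f d [N IN]; exists N => m mN.
by rewrite -(pihomog_mull _ _ (dhomog_mpolyX A m)); apply: hI.2; apply: IN.
Qed.

End Sat.

(** * Homogeneous nonzerodivisors and socles *)

(** Lets the avoidance argument below work with finitely many elements taken from the given set. *)
Lemma noetherian_finite_gen (A : comNzRingType) (G : set A) : noetherian A ->
  exists s : seq A, {in s, forall g, G g} /\ ideal_gen G = ideal_gen [set` s].
Proof.
move=> noethA.
pose F := [set I | exists s : seq A, {in s, forall g, G g} /\ I = ideal_gen [set` s]].
have [||_ [[s [sG ->]] smax]] := @noetherian_max A F (ideal_gen [set` [::]]) noethA.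
- by move=> _ [s [_ ->]]; apply: ideal_genP.
- by exists [::].
exists s; split=> //; apply/seteqP; split; apply: ideal_gen_sub; try exact: ideal_genP.
  move=> g Gg; apply: (smax (ideal_gen [set` g :: s])).
  - exists (g :: s); split=> // h; rewrite inE => /orP[/eqP->//|hs]; exact: sG.
  - apply: ideal_gen_sub; first exact: ideal_genP.
    by move=> h /= hs; apply: sub_ideal_gen; rewrite /= inE hs orbT.
  - by apply: sub_ideal_gen; rewrite /= inE eqxx.
by move=> g /= gs; apply: sub_ideal_gen; apply: sG.
Qed.

Section Dichotomy.
Variables (n : nat) (k : fieldType) (J : set {mpoly k[n.+1]}).
Hypothesis hJ : homog_ideal J.
Let idJ : is_ideal J := hJ.1.
Let S := {mpoly k[n.+1]}.

Let hom (f : S) := exists d, f \is d.-homog.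

Let homM f g : hom f -> hom g -> hom (f * g).
Proof. by move=> [d fd] [e ge]; exists (d + e)%N; apply: dhomogM. Qed.

Let colon (z : S) := [set f | J (f * z)].

Let colon_ideal z : is_ideal (colon z).
Proof.
split; first by rewrite /colon /= mul0r; apply: ideal0.
  by move=> f g Jf Jg; rewrite /colon /= mulrDl; apply: idealD.
by move=> f g Jg; rewrite /colon /= -mulrA; apply: idealMl.
Qed.

Let colon_pick z z' f : hom z -> colon z f -> ~ colon z' f ->
  exists2 g, hom g & colon z g /\ ~ colon z' g.
Proof.
move=> [d zd] zf nf; apply: contrapT => ng; apply: nf.
apply: homog_sub => // e; apply: contrapT => nJe; apply: ng.
exists (pihomog mdeg e f); first by exists e; apply: pihomogP.
split=> //; rewrite /colon /= mulrC -(pihomog_mull _ _ zd) mulrC.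
exact: hJ.2.
Qed.

(** For such [z] the ideal [colon z] is a maximal annihilator of a nonzero class of a form in S/J.
    These are the primes to be avoided. *)
Let top z := [/\ hom z, ~ J z & forall z', hom z' -> ~ J z' ->
  colon z `<=` colon z' -> colon z' `<=` colon z].

(** If g z is not in [J], then [colon (g * z)] contains [colon z], hence equals it by maximality. *)
Let top_prime z f g : top z -> hom g -> colon z (f * g) -> colon z f \/ colon z g.
Proof.
move=> [hz Jz zmax] hg zfg; case: (pselect (colon z g)) => [|nzg]; [by right | left].
apply: (zmax (g * z)).
- exact: homM.
- exact: nzg.
- by move=> h Jh; rewrite /colon /= mulrCA; apply: idealMl.
- by rewrite /colon /= mulrA.
Qed.

Let top_above z : hom z -> ~ J z -> exists2 z', top z' & colon z `<=` colon z'.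
Proof.
move=> hz Jz.
pose F := [set I | exists z', [/\ hom z', ~ J z', colon z `<=` colon z' & I = colon z']].
have [||_ [[z' [hz' Jz' zz' ->]] zmax]] :=
    @noetherian_max S F (colon z) (@noetherian_mpoly k n.+1).
- by move=> _ [z' [_ _ _ ->]].
- by exists z; split.
exists z' => //; split=> // w hw Jw z'w; apply: zmax => //.
by exists w; split=> //; apply: (subset_trans zz').
Qed.

Let avoid_prod z (ws : seq S) : top z ->
  {in ws, forall w, exists2 g, hom g & colon w g /\ ~ colon z g} ->
  exists2 u, hom u & ~ colon z u /\ {in ws, forall w, colon w u}.
Proof.
move=> tz; elim: ws => [|w ws IHws] hws.
  exists 1; first by exists 0%N; apply: dhomog1.
  by split=> //; rewrite /colon /= mul1r; case: tz.
have [|u hu [nzu wsu]] := IHws.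
  by move=> v vs; apply: hws; rewrite inE vs orbT.
have [|g hg [wg nzg]] := hws w; first by rewrite inE eqxx.
exists (g * u); first exact: homM.
split=> [/(top_prime tz hu)[]//|v]; rewrite inE => /orP[/eqP ->|vs].
  exact: (idealMr (colon_ideal w)).
by apply: (idealMl (colon_ideal v)); apply: wsu.
Qed.

(** Homogeneous prime avoidance. If y avoids the tail but lies in [colon z], take a form v in all
    ideals of the tail but outside [colon z]; powers of y and v of equal degree have a sum that
    avoids every ideal of the list. *)
Let avoid_list (zs : seq S) : {in zs, forall z, top z} ->
  (forall z, ~ J z -> exists i, ~ J ('X_i * z)) ->
  exists y d, [/\ (0 < d)%N, y \is d.-homog & {in zs, forall z, ~ colon z y}].
Proof.
move=> + nsoc; elim: zs => [|z zs IHzs] tzs.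
  by exists 'X_ord0, 1%N; split=> //; apply: dhomog_mpolyXU.
have tz : top z by apply: tzs; rewrite inE eqxx.
have [|y [d [d0 yd ny]]] := IHzs.
  by move=> w ws; apply: tzs; rewrite inE ws orbT.
case: (pselect (colon z y)) => [zy|nzy]; last first.
  by exists y, d; split=> // w; rewrite inE => /orP[/eqP ->//|]; apply: ny.
have [|u [e ue] [nzu wsu]] := avoid_prod (ws := zs) tz.
  move=> w ws; have [hw Jw wmax] : top w by apply: tzs; rewrite inE ws orbT.
  have [f wf nzf] : exists2 f, colon w f & ~ colon z f.
    apply: contrapT => nf; apply: (ny w ws).
    have [hz Jz _] := tz; apply: (wmax z) => //.
    by move=> f wf; apply: contrapT => nzf; apply: nf; exists f.
  exact: colon_pick hw wf nzf.
have [i nJi] : exists i, ~ J ('X_i * z) by apply: nsoc; case: tz.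
(* As [u] may be the constant 1, it is multiplied by a variable outside [colon z]; the degree of
   [v], which becomes the exponent of [y], is then positive. *)
pose v := u * 'X_i.
have hX : hom ('X_i : S) by exists 1%N; apply: dhomog_mpolyXU.
have nzv : ~ colon z v by move=> /(top_prime tz hX)[].
have ve : v \is e.+1.-homog.
  by have := dhomogM ue (dhomog_mpolyXU k i); rewrite addn1.
have wv w : w \in zs -> colon w v by move=> ws; apply: (idealMr (colon_ideal w)); apply: wsu.
have powN w f j : top w -> hom f -> ~ colon w f -> ~ colon w (f ^+ j).
  move=> tw hf nwf; elim: j => [|j IHj]; first by rewrite expr0 /colon /= mul1r; case: tw.
  by rewrite exprSr => /(top_prime tw hf)[].
exists (y ^+ e.+1 + v ^+ d), (d * e.+1)%N; split.
- by rewrite muln_gt0 d0.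
- by apply: rpredD; [apply: dhomogMn | rewrite mulnC; apply: dhomogMn].
- move=> w; rewrite inE => /orP[/eqP ->|ws].
    rewrite (idealDr (colon_ideal z)); last by rewrite exprS; apply: (idealMr (colon_ideal z)).
    by apply: powN => //; exists e.+1.
  rewrite (idealDl (colon_ideal w)); last first.
    by rewrite -(prednK d0) exprS; apply: (idealMr (colon_ideal w)); apply: wv.
  apply: powN; [|by exists d | exact: ny].
  by apply: tzs; rewrite inE ws orbT.
Qed.

(** Without a socle element no [colon z] contains all variables, so some form of positive degree
    avoids them; a form that is a zero divisor modulo [J] would lie in one of them. *)
Lemma homog_nzd_or_socle :
  (exists y d, [/\ (0 < d)%N, y \is d.-homog & forall f, J (y * f) -> J f]) \/
  (exists2 z, ~ J z & forall i, J ('X_i * z)).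
Proof.
case: (pselect (exists2 z, ~ J z & forall i, J ('X_i * z))) => [|nsoc]; [by right | left].
have {}nsoc z : ~ J z -> exists i, ~ J ('X_i * z).
  move=> Jz; apply: contrapT => ni; apply: nsoc; exists z => // i.
  by apply: contrapT => nJi; apply: ni; exists i.
(* Finitely many top elements generate the ideal of all of them, and avoiding their colon ideals
   suffices: if y lay in [colon z] for another top z, a form outside [colon z] that kills all of [s]
   modulo [J] would kill z as well. *)
have [s [sG sE]] := noetherian_finite_gen top (@noetherian_mpoly k n.+1).
have [|y [d [d0 yd ny]]] := avoid_list (zs := s) _ nsoc; first exact: sG.
have nyt z : top z -> ~ colon z y.
  move=> tz zy; have [hz Jz zmax] := tz.
  have /avoid_prod[//|u hu [nzu wsu]] : {in s, forall w, exists2 g, hom g & colon w g /\ ~ colon z g}.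
    move=> w ws; have [hw Jw wmax] := sG w ws.
    apply: contrapT => ng; apply: (ny w ws).
    apply: (wmax z hz Jz) => // f wf; apply: contrapT => nzf.
    by apply: ng; apply: colon_pick nzf.
  apply: nzu; have : ideal_gen top z by apply: sub_ideal_gen.
  rewrite sE => /ideal_gen_seqP[c ->]; rewrite /colon /= mulr_sumr.
  apply: ideal_sum => // i _; rewrite mulrCA; apply: idealMl => //.
  by apply: wsu; apply: mem_nth.
exists y, d; split=> // f Jyf; apply: contrapT => nJf.
have [e nJe] : exists e, ~ J (pihomog mdeg e f).
  apply: contrapT => ne; apply: nJf; apply: homog_sub => // e.
  by apply: contrapT => nJe; apply: ne; exists e.
have [|z tz fz] := top_above _ nJe; first by exists e; apply: pihomogP.
apply: (nyt z tz); apply: fz; rewrite /colon /= -(pihomog_mull _ _ yd).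
exact: hJ.2.
Qed.
End Dichotomy.

(** * The homogeneous coordinate ring at a Gorenstein fibre *)

Lemma mcoeff_pihomog (n : nat) (A : comNzRingType) d (f : {mpoly A[n]}) m :
  (pihomog mdeg d f)@_m = if mdeg m == d then f@_m else 0.
Proof.
case: ifP => [/eqP <-|/negbT md]; last first.
  by apply: (dhomog_nemf_coeff (mf := mdeg) (d := d)) => //; apply: pihomogP.
rewrite [in RHS](@pihomog_partitionE _ _ mdeg _ f (leq_maxl _ (mdeg m).+1)).
have lt : (mdeg m < maxn (msize f) (mdeg m).+1)%N by rewrite leq_max ltnSn orbT.
rewrite [RHS]raddf_sum /= [RHS](bigD1 (Ordinal lt)) //=.
rewrite [X in _ + X]big1 ?addr0 // => j jm.
apply: (dhomog_nemf_coeff (mf := mdeg) (d := j)); first exact: pihomogP.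
by rewrite eq_sym -val_eqE in jm *.
Qed.

Lemma pihomog0E (n : nat) (A : comNzRingType) (f : {mpoly A[n]}) :
  pihomog mdeg 0 f = (f@_0%MM)%:MP.
Proof.
apply/mpolyP => m; rewrite mcoeff_pihomog mcoeffC mdeg_eq0.
by case: eqP => [->|_]; rewrite ?mulr1 ?mulr0.
Qed.

Lemma mcoeff0M (n : nat) (A : comNzRingType) (f g : {mpoly A[n]}) :
  (f * g)@_0%MM = f@_0%MM * g@_0%MM.
Proof. exact: rmorphM. Qed.

Lemma dhomog_coeff0 (n : nat) (A : comNzRingType) d (f : {mpoly A[n]}) :
  (0 < d)%N -> f \is d.-homog -> f@_0%MM = 0.
Proof.
move=> d0 hf; apply: (dhomog_nemf_coeff (mf := mdeg) hf).
by rewrite -[X in X != _]/(mdeg 0%MM) mdeg0 eq_sym -lt0n.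
Qed.

Lemma mpoly_coeff0_ind (n : nat) (A : comNzRingType) (J : set {mpoly A[n]})
    (z f : {mpoly A[n]}) :
  is_ideal J -> (forall i, J ('X_i * z)) -> f@_0%MM = 0 -> J (f * z).
Proof.
move=> idJ Jz f0; rewrite [f]mpolyE mulr_suml; apply: ideal_sum => // m _.
case: (eqVneq m 0%MM) => [->|m0].
  by rewrite f0 scale0r mul0r; apply: ideal0.
have [i mi] : exists i, m i != 0%N.
  apply: contrapT => nm; case/eqP: m0; apply/mnmP => i; rewrite mnm0E; apply/eqP.
  by apply: contrapT => /negP mi; apply: nm; exists i.
have im : (U_(i) <= m)%MM by rewrite lep1mP.
rewrite -[X in 'X_[X]](submK im) mpolyXD scalerAl -mulrA.
exact: idealMl.
Qed.

Lemma mpoly_socleE (n : nat) (A : comNzRingType) (J : set {mpoly A[n]})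
    (z f : {mpoly A[n]}) :
  is_ideal J -> (forall i, J ('X_i * z)) -> J (f * z - f@_0%MM *: z).
Proof.
move=> idJ Jz; rewrite -mul_mpolyC -mulrBl; apply: mpoly_coeff0_ind => //.
by rewrite mcoeffB mcoeffC eqxx mulr1 subrr.
Qed.

Section ConeLocal.
Variables (k : fieldType) (n : nat).
Let S := {mpoly k[n.+1]}.
Implicit Type J : set S.

(* The local ring of Spec (S / J) at the vertex has finite injective
   dimension. *)
Definition cone_finite_injdim J : Prop :=
  exists (L : comNzRingType) (lam : {rmorphism S -> L}) (t : nat),
  [/\ noetherian L, injdim_le t (L^o : lmodType L),
      forall s, s@_0%MM != 0 -> exists u, lam s * u = 1,
      forall l, exists a s, s@_0%MM != 0 /\ lam s * l = lam a
    & forall a, lam a = 0 <-> exists s, s@_0%MM != 0 /\ J (s * a)].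

Lemma homog_ideal_coeff0 J f : homog_ideal J -> ~ J 1 -> J f -> f@_0%MM = 0.
Proof.
move=> hJ J1 Jf; apply/eqP; apply: contrapT => /negP f0; apply: J1.
have := hJ.2 f 0%N Jf; rewrite pihomog0E => Jc.
rewrite -[1](_ : (f@_0%MM)^-1%:MP * (f@_0%MM)%:MP = _); last first.
  by rewrite -mpolyCM mulVf.
by apply: (idealMl hJ.1).
Qed.

Lemma gorenstein_cone J (Q : comNzRingType) (pi : {rmorphism S -> Q}) :
  homog_ideal J -> is_quotient J pi -> gorenstein_ring Q ->
  ~ J 1 /\ cone_finite_injdim J.
Proof.
move=> hJ [surj kerp] [noethQ gorQ].
have J1 : ~ J 1 by move=> /kerp/eqP; rewrite rmorph1 oner_eq0.
have J0 f : J f -> f@_0%MM = 0 by apply: homog_ideal_coeff0.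
split=> //; pose P := [set q | exists f, pi f = q /\ f@_0%MM = 0].
have PE f : P (pi f) <-> f@_0%MM = 0.
  split=> [[g [gf g0]]|f0]; last by exists f.
  have /J0 : J (f - g) by apply/kerp; rewrite rmorphB gf subrr.
  by rewrite mcoeffB g0 subr0.
have primeP : prime_ideal P.
  split.
  - split.
    + by exists 0; rewrite rmorph0 mcoeff0.
    + move=> _ _ [f [<- f0]] [g [<- g0]]; exists (f + g).
      by rewrite rmorphD mcoeffD f0 g0 addr0.
    + move=> a _ [g [<- g0]]; have [f <-] := surj a; exists (f * g).
      by rewrite rmorphM mcoeff0M g0 mulr0.
  - by rewrite -(rmorph1 pi) PE mcoeff1 eqxx => /eqP; rewrite oner_eq0.
  - move=> a b; have [f <-] := surj a; have [g <-] := surj b.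
    by rewrite -rmorphM !PE mcoeff0M => /eqP; rewrite mulf_eq0 => /orP[]/eqP; [left|right].
have [L [phi locL]] := exists_localization primeP.
have [t injL] := gorQ P L phi primeP locL.
have noethL := noetherian_localization noethQ locL.
case: locL => inv frac ker0.
have nP s : s@_0%MM != 0 -> ~ P (pi s) by move=> s0 /PE/eqP; apply/negP.
exists L, (phi \o pi : {rmorphism S -> L}), t; split=> //=.
- by move=> s s0; apply/inv/nP.
- move=> l; have [a [s [nPs e]]] := frac l.
  have [f fE] := surj a; have [g gE] := surj s; exists f, g; split; last by rewrite fE gE.
  by apply/eqP => g0; apply: nPs; rewrite -gE; apply/PE.
- move=> a; rewrite ker0; split=> [[s [nPs e]]|[s [s0 Jsa]]].
    have [g gE] := surj s; exists g; split; last by apply/kerp; rewrite rmorphM gE.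
    by apply/eqP => g0; apply: nPs; rewrite -gE; apply/PE.
  by exists (pi s); split; [apply: nP | rewrite -rmorphM; apply/kerp].
Qed.

Definition add_principal J (y : S) : set S := [set f | exists g, J (f - y * g)].

Lemma sub_add_principal J y : J `<=` add_principal J y.
Proof. by move=> f Jf; exists 0; rewrite mulr0 subr0. Qed.

Lemma add_principal_ideal J y : is_ideal J -> is_ideal (add_principal J y).
Proof.
move=> idJ; split.
- by exists 0; rewrite mulr0 subr0; apply: ideal0.
- move=> f g [a Ja] [b Jb]; exists (a + b); rewrite mulrDr opprD addrACA.
  exact: idealD.
- move=> f g [a Ja]; exists (f * a); rewrite mulrCA -mulrBr; exact: idealMl.
Qed.

Lemma add_principal_homog J y d : homog_ideal J -> y \is d.-homog ->
  homog_ideal (add_principal J y).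
Proof.
move=> hJ hy; split; first exact: add_principal_ideal hJ.1.
move=> f e [g Jg]; have := hJ.2 _ e Jg; rewrite linearB /=.
case: (leqP d e) => [de|ed]; last first.
  by rewrite (pihomog_mull_lt _ hy ed) subr0; apply: sub_add_principal.
rewrite -{2}(subnKC de) pihomog_mull // => Jg'.
by exists (pihomog mdeg (e - d) g).
Qed.

Lemma add_principal_proper J y d : homog_ideal J -> ~ J 1 -> y \is d.-homog ->
  (0 < d)%N -> ~ add_principal J y 1.
Proof.
move=> hJ J1 hy d0 [g Jg]; have := homog_ideal_coeff0 hJ J1 Jg.
rewrite mcoeffB mcoeff0M (dhomog_coeff0 d0 hy) mul0r subr0 mcoeff1 eqxx.
by move=> /eqP; rewrite oner_eq0.
Qed.

(** Localization commutes with the quotient by [y], which stays a nonzerodivisor in [L], so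
    [injdim_quotient] applies to L modulo [lam y]. *)
Lemma add_principal_cone J y d : homog_ideal J -> ~ J 1 -> y \is d.-homog ->
  (0 < d)%N -> (forall f, J (y * f) -> J f) ->
  cone_finite_injdim J -> cone_finite_injdim (add_principal J y).
Proof.
move=> hJ J1 hy d0 nzd [L [lam [t [noethL injL inv frac ker0]]]].
pose I := [set l | exists l', l = lam y * l'].
have idI : is_ideal I.
  split; first by exists 0; rewrite mulr0.
    by move=> _ _ [a ->] [b ->]; exists (a + b); rewrite mulrDr.
  by move=> a _ [b ->]; exists (a * b); rewrite mulrCA.
have cancel_s s l : s@_0%MM != 0 -> lam s * l = 0 -> l = 0.
  move=> /inv[u su] e; rewrite -[l]mul1r -su mulrAC e; exact: mul0r.
have nzs (s s' : S) : s@_0%MM != 0 -> s'@_0%MM != 0 -> (s * s')@_0%MM != 0.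
  by move=> s0 s'0; rewrite mcoeff0M mulf_neq0.
have I1 : ~ I 1.
  move=> [l' e]; have [a [s [s0 sl]]] := frac l'.
  have : lam (s - y * a) = 0.
    by rewrite rmorphB rmorphM -sl mulrCA -e mulr1 subrr.
  move=> /ker0[s' [s'0]] /(homog_ideal_coeff0 hJ J1).
  rewrite mcoeff0M mcoeffB mcoeff0M (dhomog_coeff0 d0 hy) mul0r subr0 => /eqP.
  by rewrite mulf_eq0 (negbTE s0) (negbTE s'0).
have [Lb [pi [surj kerp]]] := exists_quotient idI I1.
have nzdL l : lam y * l = 0 -> l = 0.
  move=> yl; have [a [s [s0 sl]]] := frac l.
  have : lam (y * a) = 0 by rewrite rmorphM -sl mulrCA yl mulr0.
  move=> /ker0[s' [s'0]]; rewrite mulrCA => /nzd Jsa.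
  have a0 : lam a = 0 by apply/ker0; exists s'.
  by apply: (cancel_s s) => //; rewrite sl.
have noethLb : noetherian Lb by apply: noetherian_quotient noethL surj.
exists Lb, (pi \o lam : {rmorphism S -> Lb}), t; split=> //=.
- pose io : {rmorphism k -> Lb} := pi \o lam \o (@mpolyC n.+1 k).
  exact: (injdim_quotient surj kerp nzdL noethLb io).
- by move=> s /inv[u su]; exists (pi u); rewrite -rmorphM su rmorph1.
- move=> l; have [l' <-] := surj l; have [a [s [s0 sl]]] := frac l'.
  by exists a, s; rewrite -rmorphM sl.
- move=> a; split=> [/kerp[l e]|[s [s0 [g Jg]]]].
    have [b [s [s0 sl]]] := frac l.
    have : lam (s * a - y * b) = 0.
      by rewrite rmorphB !rmorphM -sl e mulrCA subrr.
    move=> /ker0[s' [s'0 Js]]; exists (s' * s); split; first exact: nzs.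
    by exists (s' * b); rewrite -mulrA [y * _]mulrCA -mulrBr.
  have : lam (s * a - y * g) = 0.
    by apply/ker0; exists 1; rewrite mcoeff1 eqxx oner_eq0 mul1r.
  move=> /eqP; rewrite rmorphB !rmorphM subr_eq0 => /eqP e.
  have [u su] := inv s s0; apply/kerp; exists (u * lam g).
  by rewrite mulrCA -e mulrA [u * _]mulrC su mul1r.
Qed.

(** The image of [z] in the local ring has the maximal ideal as its annihilator, so that ring is
    self-injective. Homogeneity of [J] and constant terms of denominators bring nilpotence and the
    socle back to S/J. *)
Lemma cone_socle J z : homog_ideal J -> ~ J 1 -> ~ J z ->
  (forall i, J ('X_i * z)) -> cone_finite_injdim J ->
  (forall i, exists N, J ('X_i ^+ N)) /\
  (forall z', (forall i, J ('X_i * z')) -> exists c : k, J (z' - c *: z)).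
Proof.
move=> hJ J1 Jz zX [L [lam [t [noethL injL inv frac ker0]]]].
have idJ := hJ.1.
have cancel_s s l : s@_0%MM != 0 -> lam s * l = 0 -> l = 0.
  move=> /inv[u su] e; rewrite -[l]mul1r -su mulrAC e; exact: mul0r.
have nzs (s s' : S) : s@_0%MM != 0 -> s'@_0%MM != 0 -> (s * s')@_0%MM != 0.
  by move=> s0 s'0; rewrite mcoeff0M mulf_neq0.
pose m := [set l | exists a s, [/\ a@_0%MM = 0, s@_0%MM != 0 & lam s * l = lam a]].
have mE a s l : s@_0%MM != 0 -> lam s * l = lam a -> m l -> a@_0%MM = 0.
  move=> s0 sl [b [s' [b0 s'0 s'l]]].
  have : lam (s' * a - s * b) = 0.
    by rewrite rmorphB !rmorphM -sl -s'l mulrCA subrr.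
  move=> /ker0[s'' [s''0]] /(homog_ideal_coeff0 hJ J1).
  rewrite mcoeff0M mcoeffB !mcoeff0M b0 mulr0 subr0 => /eqP.
  by rewrite !mulf_eq0 (negbTE s'0) (negbTE s''0) => /eqP.
have idm : is_ideal m.
  split.
  - by exists 0, 1; rewrite mcoeff0 mcoeff1 eqxx oner_eq0 rmorph0 mulr0.
  - move=> x y [a [s [a0 s0 sx]]] [b [s' [b0 s'0 s'y]]].
    exists (s' * a + s * b), (s * s'); split.
    + by rewrite mcoeffD !mcoeff0M a0 b0 !mulr0 addr0.
    + exact: nzs.
    + by rewrite rmorphD !rmorphM -sx -s'y; ring.
  - move=> x y [b [s' [b0 s'0 s'y]]]; have [a [s [s0 sx]]] := frac x.
    exists (a * b), (s * s'); split; [|exact: nzs|].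
    + by rewrite mcoeff0M b0 mulr0.
    + by rewrite !rmorphM -sx -s'y; ring.
have m1 : ~ m 1.
  move=> h; have := mE 1 1 1 _ _ h.
  rewrite mcoeff1 eqxx oner_eq0 rmorph1 mulr1 => /(_ isT erefl)/eqP.
  by rewrite oner_eq0.
have unit_m x : ~ m x -> exists y, x * y = 1.
  move=> nmx; have [a [s [s0 sx]]] := frac x.
  have a0 : a@_0%MM != 0 by apply/eqP => a0; apply: nmx; exists a, s.
  have [u au] := inv a a0; exists (lam s * u).
  by rewrite mulrA [x * _]mulrC sx.
have annz x : m x <-> x * lam z = 0.
  split=> [[a [s [a0 s0 sx]]]|xz].
    apply: (cancel_s s) => //; rewrite mulrA sx -rmorphM; apply/ker0; exists 1.
    by rewrite mcoeff1 eqxx oner_eq0 mul1r; split=> //; apply: mpoly_coeff0_ind.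
  apply: contrapT => /unit_m[y xy].
  have : lam z = 0 by rewrite -[lam z]mul1r -xy mulrAC xz mul0r.
  move=> /ker0[s [s0 Jsz]]; apply: Jz.
  have : J (s@_0%MM *: z).
    by apply/(ideal_congr idJ _).1/Jsz; apply: mpoly_socleE.
  move=> h; rewrite -[z](scalerK s0) -mul_mpolyC.
  exact: (idealMl idJ).
split=> [i|z' zX'].
  have [|N XN] := maximal_ideal_nilpotent noethL idm m1 unit_m annz injL (x := lam 'X_i).
    exists 'X_i, 1; rewrite mcoeff1 eqxx oner_eq0 rmorph1 mul1r; split=> //.
    by rewrite mcoeffX mnm1_eq0.
  exists N; move: XN; rewrite -rmorphXn => /ker0[s [s0 Js]].
  have hX : ('X_i ^+ N : S) \is N.-homog.
    by have := dhomogMn N (dhomog_mpolyXU k i); rewrite mul1n.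
  (* The component of degree [N] of s X_i^N is the constant term of [s] times X_i^N. *)
  have := hJ.2 _ (N + 0)%N Js; rewrite mulrC pihomog_mull // pihomog0E mulrC => Jc.
  rewrite -['X_i ^+ N]mul1r -[1](_ : (s@_0%MM)^-1%:MP * (s@_0%MM)%:MP = _); last first.
    by rewrite -mpolyCM mulVf.
  by rewrite -mulrA; apply: (idealMl idJ).
have [|l e] := socle_principal noethL idm m1 unit_m annz injL (z' := lam z').
  move=> x [a [s [a0 s0 sx]]]; apply: (cancel_s s) => //; rewrite mulrA sx -rmorphM.
  apply/ker0; exists 1; rewrite mcoeff1 eqxx oner_eq0 mul1r; split=> //.
  exact: mpoly_coeff0_ind.
have [a [s [s0 sl]]] := frac l.
have : lam (s * z' - a * z) = 0.
  by rewrite rmorphB !rmorphM -sl e mulrCA mulrC subrr.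
move=> /ker0[s' [s'0 Js]]; exists ((s@_0%MM)^-1 * a@_0%MM).
pose c := s'@_0%MM * s@_0%MM.
have c0 : c != 0 by rewrite mulf_neq0.
have Jc : J (c *: z' - (s'@_0%MM * a@_0%MM) *: z).
  (* Modulo [J], multipliers act on socle elements through their constant terms. *)
  have E1 := mpoly_socleE (s' * s) idJ zX'.
  have E2 := mpoly_socleE (s' * a) idJ zX.
  rewrite !mcoeff0M -/c in E1 E2.
  rewrite -[_ - _](_ : s' * (s * z' - a * z) - (s' * s * z' - c *: z') +
     (s' * a * z - (s'@_0%MM * a@_0%MM) *: z) = _); last by ring.
  by apply: (idealD idJ) => //; apply: (idealB idJ).
have := idealMl idJ (c^-1)%:MP Jc; rewrite mul_mpolyC scalerBr !scalerA mulVf //.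
by rewrite scale1r /c invfM mulrACA mulVf // mul1r.
Qed.

(** * Maximal regular sequences of forms *)

Section RegularSequence.
(* [adm] singles out the forms with coefficients in a subring. *)
Variable adm : nat -> S -> Prop.
Hypotheses (adm_homog : forall d y, adm d y -> y \is d.-homog)
  (adm_scale : forall d y, y \is d.-homog -> exists c : k, c != 0 /\ adm d (c *: y)).

Fixpoint regular_seq J (ys : seq (nat * S)) : Prop :=
  if ys is y :: ys' then [/\ (0 < y.1)%N, adm y.1 y.2,
      forall f, J (y.2 * f) -> J f & regular_seq (add_principal J y.2) ys']
  else True.

Definition add_seq J (ys : seq (nat * S)) : set S :=
  foldl (fun J y => add_principal J y.2) J ys.

(** A nonzerodivisor is never in the proper ideal [J], so adding it enlarges [J] strictly;
    Noetherian induction ends, and by the dichotomy it ends only at an ideal with a socle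
    element. *)
Lemma regular_seq_exists J : homog_ideal J -> ~ J 1 -> cone_finite_injdim J ->
  exists ys, [/\ regular_seq J ys, homog_ideal (add_seq J ys), ~ add_seq J ys 1,
    cone_finite_injdim (add_seq J ys)
  & exists2 z, ~ add_seq J ys z & forall i, add_seq J ys ('X_i * z)].
Proof.
pose good J := [/\ homog_ideal J, ~ J 1 & cone_finite_injdim J].
pose concl J := exists ys, [/\ regular_seq J ys, homog_ideal (add_seq J ys),
  ~ add_seq J ys 1, cone_finite_injdim (add_seq J ys)
  & exists2 z, ~ add_seq J ys z & forall i, add_seq J ys ('X_i * z)].
move=> hJ J1 coneJ; suff: concl J by [].
apply: contrapT => nJ.
have [||I [[gI nI] Imax]] := @noetherian_max S [set J | good J /\ ~ concl J] J
  (@noetherian_mpoly k n.+1).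
- by move=> I [[[]]].
- by split.
have [hI I1 coneI] := gI.
have [[y [d [d0 yd nzd]]]|[z Iz zX]] := homog_nzd_or_socle hI; last first.
  by apply: nI; exists [::]; split=> //; exists z.
have [c [c0 adm_y]] := adm_scale yd; pose y' := c *: y.
have nzd' f : I (y' * f) -> I f.
  rewrite /y' -scalerAl => h; apply: nzd; rewrite -[y * f](scalerK c0).
  by rewrite -mul_mpolyC; apply: (idealMl hI.1).
have yd' := adm_homog adm_y.
have gI' : good (add_principal I y').
  split; [exact: add_principal_homog yd'|exact: add_principal_proper yd' d0|].
  exact: add_principal_cone yd' d0 nzd' coneI.
case: (pselect (concl (add_principal I y'))) => [[ys [ry h1 h2 h3 h4]]|nI'].
  by apply: nI; exists ((d, y') :: ys); split.
have /(_ y') := Imax _ (conj gI' nI') (@sub_add_principal I y').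
have Iy : add_principal I y' y' by exists 1; rewrite mulr1 subrr; apply: (ideal0 hI.1).
by move=> /(_ Iy) Iy'; apply: I1; apply: nzd'; rewrite mulr1.
Qed.

Lemma regular_seq_nth J ys i y0 : regular_seq J ys -> (i < size ys)%N ->
  let y := nth y0 ys i in
  [/\ (0 < y.1)%N, adm y.1 y.2 &
    forall f, add_seq J (take i ys) (y.2 * f) -> add_seq J (take i ys) f].
Proof.
elim: ys J i => [//|y ys IHys] J [|i] /= [d0 ady nzd rys] lti; first by [].
exact: IHys.
Qed.

Lemma add_seqS J ys i y0 : (i < size ys)%N ->
  add_seq J (take i.+1 ys) = add_principal (add_seq J (take i ys)) (nth y0 ys i).2.
Proof. by move=> lti; rewrite (take_nth y0 lti) /add_seq foldl_rcons. Qed.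
End RegularSequence.
End ConeLocal.

(** * Free bases over a polynomial subring *)

Lemma mcoeff_mulX (r : nat) (A : comNzRingType) (b a : 'X_{1..r}) (p : {mpoly A[r]}) :
  ('X_[b] * p)@_a = if (b <= a)%MM then p@_(a - b) else 0.
Proof.
case: ifP => [ba|/negP ba].
  by rewrite mulrC -{1}(submK ba) addmC mcoeffMX.
apply: memN_msupp_eq0; apply/negP; rewrite mulrC.
rewrite (perm_mem (msuppMX _ _)) => /mapP[c _ aE]; apply: ba; rewrite aE.
exact: lem_addr.
Qed.

(** The quotient of [p] by a monomial, forgetting the terms that the monomial does not divide. *)
Lemma mpoly_shift (r : nat) (A : comNzRingType) (b : 'X_{1..r}) (p : {mpoly A[r]}) :
  exists q : {mpoly A[r]}, forall a, q@_a = p@_(a + b).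
Proof.
exists (\sum_(a : 'X_{1..r < msize p}) p@_(a + b) *: 'X_[a]) => a.
case: (ltnP (mdeg a) (msize p)) => [lta|gea].
  exact: (mcoeff_mpoly (fun a => p@_(a + b)) lta).
rewrite [RHS]memN_msupp_eq0; last first.
  by apply: msize_mdeg_ge; rewrite mdegD (leq_trans gea) // leq_addr.
rewrite raddf_sum /= big1 // => c _; rewrite mcoeffZ mcoeffX.
case: eqP => [ca|_]; last by rewrite mulr0.
by have := bmdeg c; rewrite ca ltnNge gea.
Qed.

Lemma pihomog_sum (n : nat) (A : comNzRingType) d (I : Type) (s : seq I) (P : pred I)
    (F : I -> {mpoly A[n]}) :
  pihomog mdeg d (\sum_(i <- s | P i) F i) = \sum_(i <- s | P i) pihomog mdeg d (F i).
Proof. exact: linear_sum. Qed.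

(** * Combinations of monomials with coefficients in a polynomial ring *)

Section Comb.
Variables (A : comNzRingType) (n r m : nat).
Variables (y : 'I_r -> {mpoly A[n]}) (mu : 'I_m -> 'X_{1..n}).

Definition subst (q : {mpoly A[r]}) : {mpoly A[n]} := mmap (@mpolyC n A) y q.

Lemma substD p q : subst (p + q) = subst p + subst q.
Proof. exact: rmorphD. Qed.
Lemma substB p q : subst (p - q) = subst p - subst q.
Proof. exact: rmorphB. Qed.
Lemma substM p q : subst (p * q) = subst p * subst q.
Proof. exact: rmorphM. Qed.
Lemma subst0 : subst 0 = 0. Proof. exact: rmorph0. Qed.
Lemma substC c : subst c%:MP = c%:MP. Proof. exact: mmapC. Qed.
Lemma substZ c q : subst (c *: q) = c *: subst q.
Proof. by rewrite -!mul_mpolyC substM substC. Qed.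
Lemma substX i : subst 'X_i = y i. Proof. by rewrite /subst mmapX mmap1U. Qed.
Lemma substXm a : subst 'X_[a] = \prod_i y i ^+ a i.
Proof. by rewrite /subst mmapX. Qed.
Lemma subst_sum (I : Type) (s : seq I) (P : pred I) (F : I -> {mpoly A[r]}) :
  subst (\sum_(i <- s | P i) F i) = \sum_(i <- s | P i) subst (F i).
Proof. exact: rmorph_sum. Qed.

Definition comb (c : 'I_m -> {mpoly A[r]}) : {mpoly A[n]} :=
  \sum_l subst (c l) * 'X_[mu l].

Lemma eq_comb c c' : c =1 c' -> comb c = comb c'.
Proof. by move=> cc'; apply: eq_bigr => l _; rewrite cc'. Qed.

Lemma comb0 : comb (fun=> 0) = 0.
Proof. by apply: big1 => l _; rewrite subst0 mul0r. Qed.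

Lemma combD c c' : comb (fun l => c l + c' l) = comb c + comb c'.
Proof. by rewrite -big_split; apply: eq_bigr => l _; rewrite substD mulrDl. Qed.

Lemma combB c c' : comb (fun l => c l - c' l) = comb c - comb c'.
Proof. by rewrite -sumrB; apply: eq_bigr => l _; rewrite substB mulrBl. Qed.

Lemma combM q c : comb (fun l => q * c l) = subst q * comb c.
Proof. by rewrite mulr_sumr; apply: eq_bigr => l _; rewrite substM mulrA. Qed.

Lemma combZ a c : comb (fun l => a *: c l) = a *: comb c.
Proof. by rewrite scaler_sumr; apply: eq_bigr => l _; rewrite substZ scalerAl. Qed.

Lemma comb_sum (I : Type) (s : seq I) (P : pred I) (F : I -> 'I_m -> {mpoly A[r]}) :
  comb (fun l => \sum_(i <- s | P i) F i l) = \sum_(i <- s | P i) comb (F i).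
Proof.
rewrite exchange_big; apply: eq_bigr => l _.
by rewrite subst_sum mulr_suml.
Qed.

Lemma comb_const (al : 'I_m -> A) :
  comb (fun l => (al l)%:MP) = \sum_l al l *: 'X_[mu l].
Proof. by apply: eq_bigr => l _; rewrite substC mul_mpolyC. Qed.

Lemma comb_delta l q : comb (fun l' => if l' == l then q else 0) = subst q * 'X_[mu l].
Proof.
rewrite /comb (bigD1 l) //= eqxx big1 ?addr0 // => l' /negbTE ->.
by rewrite subst0 mul0r.
Qed.

Lemma comb_coeff0 (J : set {mpoly A[n]}) c : is_ideal J -> (forall i, J (y i)) ->
  J (comb c - \sum_l (c l)@_0%MM *: 'X_[mu l]).
Proof.
move=> idJ Jy; rewrite -comb_const -combB; apply: ideal_sum => // l _.
apply: idealMr => //.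
have idsub : is_ideal [set q | J (subst q)].
  split=> [|p q|p q] /=; first by rewrite subst0; apply: ideal0.
    by rewrite substD; apply: idealD.
  by rewrite substM; apply: idealMl.
have := @mpoly_coeff0_ind r A [set q | J (subst q)] 1 (c l - ((c l)@_0%MM)%:MP) idsub.
rewrite /= mulr1; apply; last by rewrite mcoeffB mcoeffC eqxx mulr1 subrr.
by move=> i; rewrite mulr1 substX.
Qed.

Variable d : 'I_r -> nat.
Hypothesis hy : forall i, y i \is (d i).-homog.

Definition wdeg (a : 'X_{1..r}) : nat := (\sum_i a i * d i)%N.

Lemma wdegD a b : wdeg (a + b) = (wdeg a + wdeg b)%N.
Proof. by rewrite -big_split; apply: eq_bigr => i _; rewrite mnmDE mulnDl. Qed.

Lemma wdeg0 : wdeg 0%MM = 0%N.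
Proof. by apply: big1 => i _; rewrite mnm0E. Qed.

Lemma wdeg1 i : wdeg U_(i)%MM = d i.
Proof.
rewrite /wdeg (bigD1 i) //= mnm1E eqxx mul1n big1 ?addn0 // => j ji.
by rewrite mnm1E eq_sym (negbTE ji).
Qed.

Lemma wdegMn a e : wdeg (a *+ e)%MM = (wdeg a * e)%N.
Proof. by rewrite /wdeg big_distrl; apply: eq_bigr => i _; rewrite mulmnE mulnAC. Qed.

Lemma wdeg_ge a : (forall i, 0 < d i)%N -> (mdeg a <= wdeg a)%N.
Proof. by move=> d0; rewrite mdegE; apply: leq_sum => i _; rewrite leq_pmulr. Qed.

Lemma substXm_homog a : subst 'X_[a] \is (wdeg a).-homog.
Proof.
rewrite substXm /wdeg; elim/big_rec2: _ => [|i p q _ hq]; first exact: dhomog1.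
by apply: dhomogM => //; rewrite mulnC; apply: dhomogMn.
Qed.

(* The basis vector [X_[mu l]] has degree [mdeg (mu l)]. *)
Definition comb_homog (e : nat) (c : 'I_m -> {mpoly A[r]}) : Prop :=
  forall l a, (c l)@_a != 0 -> (wdeg a + mdeg (mu l))%N = e.

Lemma comb_homogP e c : comb_homog e c -> comb c \is e.-homog.
Proof.
move=> hc; rewrite /comb; apply: rpred_sum => l _; rewrite [c l]mpolyE subst_sum mulr_suml.
rewrite big_seq; apply: rpred_sum => a; rewrite mcoeff_msupp => /hc <-.
rewrite substZ -scalerAl; apply: rpredZ; apply: dhomogM; first exact: substXm_homog.
exact: dhomog_mpolyX.
Qed.

Definition comb_proj e (c : 'I_m -> {mpoly A[r]}) l : {mpoly A[r]} :=
  \sum_(a <- msupp (c l) | (wdeg a + mdeg (mu l))%N == e) (c l)@_a *: 'X_[a].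

Lemma mcoeff_comb_proj e c l a : (comb_proj e c l)@_a =
  if (wdeg a + mdeg (mu l))%N == e then (c l)@_a else 0.
Proof.
rewrite /comb_proj raddf_sum /=.
case: (boolP (a \in msupp (c l))) => [ac|nac].
  rewrite big_mkcond (bigD1_seq a) //=.
  rewrite big1 ?addr0 => [|b ba]; last first.
    by case: ifP => // _; rewrite mcoeffZ mcoeffX (negbTE ba) mulr0.
  by case: ifP => // _; rewrite mcoeffZ mcoeffX eqxx mulr1.
rewrite (memN_msupp_eq0 nac) if_same big_seq_cond big1 // => b /andP[bc _].
rewrite mcoeffZ mcoeffX; case: eqP => [ba|_]; last by rewrite mulr0.
by rewrite -ba bc in nac.
Qed.

Lemma comb_proj_homog e c : comb_homog e (comb_proj e c).
Proof. by move=> l a; rewrite mcoeff_comb_proj; case: ifP => [/eqP //|_]; rewrite eqxx. Qed.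

Lemma pihomog_comb e c : pihomog mdeg e (comb c) = comb (comb_proj e c).
Proof.
rewrite /comb linear_sum; apply: eq_bigr => l _ /=.
rewrite {1}[c l]mpolyE /comb_proj !subst_sum !mulr_suml linear_sum /= [RHS]big_mkcond.
apply: eq_bigr => a _; rewrite substZ -scalerAl linearZ /=.
have ha : subst 'X_[a] * 'X_[mu l] \is (wdeg a + mdeg (mu l)).-homog.
  by apply: dhomogM; [apply: substXm_homog | apply: dhomog_mpolyX].
case: eqP => [<-|/eqP ne]; first by rewrite pihomog_dE.
by rewrite (pihomog_ne0 ne ha) scaler0.
Qed.
End Comb.

Section FreeBasis.
Variables (k : fieldType) (n : nat).
Let S := {mpoly k[n.+1]}.
Implicit Type J : set S.

(** A maximal set of monomials that are independent modulo [J] also spans. Only exponents are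
    recorded, so the same basis can be written over any coefficient ring. *)
Lemma monomial_basis J D : is_ideal J ->
  (forall a : 'X_{1..n.+1}, (D <= mdeg a)%N -> J 'X_[a]) ->
  exists m (mu : 'I_m -> 'X_{1..n.+1}),
    (forall f, exists al : 'I_m -> k, J (f - \sum_l al l *: 'X_[mu l])) /\
    (forall al : 'I_m -> k, J (\sum_l al l *: 'X_[mu l]) -> forall l, al l = 0).
Proof.
move=> idJ JD; pose T := 'X_{1..n.+1 < D}.
pose indep (B : {set T}) := `[< forall c : T -> k,
  J (\sum_(b in B) c b *: 'X_[b]) -> forall b, b \in B -> c b = 0 >].
have [B] : {B | maxset indep B}.
  apply: ex_maxset; exists finset.set0; apply/asboolP => c _ b.
  by rewrite finset.in_set0.
move=> /maxsetP[/asboolP indB maxB].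
pose sp f := exists c : T -> k, J (f - \sum_(b in B) c b *: 'X_[b]).
have sp0 f : J f -> sp f.
  by move=> Jf; exists (fun=> 0); rewrite big1 ?subr0 // => b _; rewrite scale0r.
have spD f g : sp f -> sp g -> sp (f + g).
  move=> [c Jc] [c' Jc']; exists (fun b => c b + c' b).
  have -> : \sum_(b in B) (c b + c' b) *: 'X_[b] =
      \sum_(b in B) c b *: 'X_[b] + \sum_(b in B) c' b *: 'X_[k, b].
    by rewrite -big_split; apply: eq_bigr => b _; rewrite scalerDl.
  by rewrite opprD addrACA; apply: idealD.
have spZ a f : sp f -> sp (a *: f).
  move=> [c Jc]; exists (fun b => a * c b).
  have -> : \sum_(b in B) (a * c b) *: 'X_[b] = a *: \sum_(b in B) c b *: 'X_[k, b].
    by rewrite scaler_sumr; apply: eq_bigr => b _; rewrite scalerA.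
  by rewrite -scalerBr -mul_mpolyC; apply: idealMl.
have spB (b : T) : b \in B -> sp 'X_[b].
  move=> bB; exists (fun b' => (b' == b)%:R); rewrite (bigD1 b) //= eqxx scale1r big1.
    by rewrite addr0 subrr; apply: ideal0.
  by move=> b' /andP[_ /negbTE ->]; rewrite scale0r.
have spX (b : T) : sp 'X_[b].
  case: (boolP (b \in B)) => [|bB]; first exact: spB.
  have : ~ indep (b |: B)%SET.
    move=> indbB; have /(_ (finset.subsetUr _ _)) := maxB _ indbB.
    by move=> e; rewrite -e finset.setU11 in bB.
  move=> nind; apply: contrapT => nsp; apply: nind; apply/asboolP => c Jc.
  rewrite finset.big_setU1 //= in Jc.
  have cb0 : c b = 0.
    apply/eqP; apply: contrapT => /negP cb; apply: nsp.
    exists (fun b' => - (c b)^-1 * c b').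
    have := idealMl idJ ((c b)^-1)%:MP Jc; rewrite mul_mpolyC scalerDr scalerA mulVf //.
    rewrite scale1r; congr J; congr (_ + _); rewrite -sumrN scaler_sumr.
    by apply: eq_bigr => b' _; rewrite scalerA mulNr scaleNr opprK.
  move=> b' /finset.setU1P[->//|b'B]; apply: indB => //.
  by move: Jc; rewrite cb0 scale0r add0r.
exists #|B|, (fun l : 'I_#|B| => (enum_val l : T) : 'X_{1..n.+1}); split.
  move=> f; suff [c Jc] : sp f.
    exists (fun l => c (enum_val l)).
    by rewrite -(big_enum_val (fun b : T => c b *: 'X_[b])).
  rewrite [f]mpolyE; elim/big_rec: _ => [|a g _ spg]; first by apply: sp0; apply: ideal0.
  apply: spD => //; apply: spZ; case: (leqP D (mdeg a)) => [Da|aD].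
    by apply: sp0; apply: JD.
  exact: (spX (BMultinom aD)).
move=> al Jal l.
have [B0|[b0 b0B]] := finset.set_0Vmem B.
  by move: (enum_val l) (enum_valP l) => b; have -> : (b \in B) = false by rewrite B0 finset.in_set0.
pose c b := al (enum_rank_in b0B b).
have := indB c; rewrite (big_enum_val (fun b : T => c b *: 'X_[b])) /=.
have -> : \sum_(i < #|B|) c (enum_val i) *: 'X_[(enum_val i : T)] =
    \sum_(l < #|B|) al l *: 'X_[k, (enum_val l : T)].
  by apply: eq_bigr => i _; rewrite /c enum_valK_in.
by move=> /(_ Jal (enum_val l) (enum_valP l)); rewrite /c enum_valK_in.
Qed.

(** * From a regular sequence to a free basis *)

Section RegularFree.
Variables (r m : nat) (y : 'I_r -> S) (mu : 'I_m -> 'X_{1..n.+1}) (d : 'I_r -> nat).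
Variable Ji : nat -> set S.
Hypotheses (idJi : forall i, is_ideal (Ji i))
  (JiS : forall i : 'I_r, Ji i.+1 = add_principal (Ji i) (y i))
  (nzd : forall (i : 'I_r) f, Ji i (y i * f) -> Ji i f)
  (hJ : homog_ideal (Ji 0)) (d0 : forall i, (0 < d i)%N)
  (hy : forall i, y i \is (d i).-homog)
  (gen0 : forall f, exists al : 'I_m -> k, Ji r (f - \sum_l al l *: 'X_[mu l]))
  (ind0 : forall al : 'I_m -> k, Ji r (\sum_l al l *: 'X_[mu l]) -> forall l, al l = 0).

Let free_below i (p : {mpoly k[r]}) :=
  forall a, p@_a != 0 -> forall j : 'I_r, (j < i)%N -> a j = 0%N.

(** Write c = c0 + X_i c1 with c0 free of X_i. Modulo [Ji i.+1] the combination of c0 vanishes, so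
    c0 = 0 by induction on the number of remaining variables; then y_i cancels, and c1 is smaller
    than c. *)
Let comb_ind_le e i c : (i + e)%N = r -> (forall l, free_below i (c l)) ->
  Ji i (comb y mu c) -> forall l, c l = 0.
Proof.
elim: e i c => [|e IHe] i c; rewrite ?addn0 => ir cfree Jc.
  have cE l : c l = ((c l)@_0%MM)%:MP.
    apply/mpolyP => a; rewrite mcoeffC; case: eqP => [->|a0]; rewrite ?mulr1 ?mulr0 //.
    apply/eqP; apply: contrapT => /negP ca; apply: a0; apply/mnmP => j.
    by rewrite mnm0E; apply: (cfree l a ca); rewrite ir.
  have Jc' : Ji r (\sum_l (c l)@_0%MM *: 'X_[mu l]).
    by move: Jc; rewrite (eq_comb y mu cE) comb_const ir.
  by move=> l; rewrite cE (ind0 Jc').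
have ltir : (i < r)%N by rewrite -ir -addSnnS leq_addr.
pose o := Ordinal ltir.
have [s] : exists s, forall l, (msize (c l) <= s)%N.
  by exists (\max_l msize (c l))%N => l; apply: (leq_bigmax l).
elim: s c cfree Jc => [|s IHs] c cfree Jc szc l.
  by apply/eqP; rewrite -(mmeasure_poly_eq0 mdeg) -leqn0.
have /choice[c1 c1E] := fun l => mpoly_shift U_(o)%MM (c l).
pose c0 l := c l - 'X_o * c1 l.
have c0E l' a : (c0 l')@_a = if a o == 0%N then (c l')@_a else 0.
  rewrite mcoeffB mcoeff_mulX lep1mP; case: eqP => [_|/eqP ao] /=; first by rewrite subr0.
  by rewrite c1E submK ?subrr // lep1mP.
have cE : comb y mu c = comb y mu c0 + y o * comb y mu c1.
  by rewrite -substX -combM -combD; apply: eq_comb => l'; rewrite subrK.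
have c00 : forall l', c0 l' = 0.
  apply: (IHe i.+1); first by rewrite addSnnS.
    move=> l' a; rewrite c0E; case: (eqVneq (a o) 0%N) => [ao ca j|_]; last by rewrite eqxx.
    rewrite ltnS leq_eqVlt => /orP[/eqP ji|]; last exact: cfree ca j.
    by rewrite -ao; congr (a _); apply: val_inj.
  have := JiS o; rewrite /= => ->; exists (- comb y mu c1).
  by rewrite mulrN opprK -cE.
have c10 : forall l', c1 l' = 0.
  apply: IHs.
  - move=> l' a; rewrite c1E => /cfree h j ji; have := h j ji.
    by rewrite mnmDE => /eqP; rewrite addn_eq0 => /andP[/eqP].
  - apply: (nzd (i := o)); move: Jc; rewrite cE (eq_comb y mu c00) comb0 add0r.
    by [].
  - move=> l'; rewrite msizeE; apply/bigmax_leqP_seq => a; rewrite mcoeff_msupp c1E => ca _.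
    have := msize_mdeg_lt (p := c l'); move=> /(_ (a + U_(o))%MM).
    rewrite mcoeff_msupp ca mdegD mdeg1 addn1 => /(_ isT) lt.
    by rewrite -ltnS (leq_trans lt).
by have := c00 l; rewrite /c0 c10 mulr0 subr0.
Qed.

Lemma regular_comb_ind c : Ji 0 (comb y mu c) -> forall l, c l = 0.
Proof. by apply: (comb_ind_le (e := r)). Qed.

Let Ji_sum i f : (i <= r)%N -> Ji i f ->
  exists g : 'I_r -> S, Ji 0 (f - \sum_j y j * g j).
Proof.
elim: i f => [|i IHi] f ir Jf.
  by exists (fun=> 0); rewrite big1 ?subr0 // => j _; rewrite mulr0.
move: Jf; have -> : i.+1 = (Ordinal ir : 'I_r).+1 by [].
rewrite JiS => -[g Jg]; have [g' Jg'] := IHi _ (ltnW ir) Jg.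
pose o := Ordinal ir.
exists (fun j => g' j + (if j == o then g else 0)).
have -> : \sum_j y j * (g' j + (if j == o then g else 0)) =
    y o * g + \sum_j y j * g' j.
  under eq_bigr do rewrite mulrDr; rewrite big_split addrC; congr (_ + _).
  rewrite (bigD1 o) //= eqxx big1 ?addr0 // => j /negbTE ->.
  by rewrite mulr0.
by rewrite opprD addrA.
Qed.

(** Graded Nakayama: in degree e a form is a combination of the basis monomials plus a sum of y_j
    h_j, and h_j can be taken of the smaller degree e - d_j. *)
Lemma regular_comb_gen f : exists c, Ji 0 (f - comb y mu c).
Proof.
have idJ := hJ.1.
suff H e g : g \is e.-homog -> exists c, Ji 0 (g - comb y mu c).
  have /choice[c Jc] e : exists c, Ji 0 (pihomog mdeg e f - comb y mu c).
    by apply: (H e); apply: pihomogP.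
  exists (fun l => \sum_(e < msize f) c e l).
  rewrite comb_sum {1}(@pihomog_partitionE _ _ mdeg _ f (leqnn _)) -sumrB.
  by apply: ideal_sum.
elim/ltn_ind: e g => e IHe g hg.
have [al Jal] := gen0 g; have [h Jh] := Ji_sum (leqnn r) Jal.
have := hJ.2 _ e Jh; rewrite !linearB /= !pihomog_sum (pihomog_dE hg) => {}Jh.
have /choice[c Jc] j : exists c, Ji 0 (pihomog mdeg e (y j * h j) - comb y mu c).
  case: (ltnP e (d j)) => [ed|de].
    exists (fun=> 0); rewrite (pihomog_mull_lt _ (hy j) ed) comb0 subr0.
    exact: ideal0.
  have [|c Jc] := IHe (e - d j)%N _ (pihomog mdeg (e - d j) (h j)) (pihomogP _ _ _).
    by have := d0 j; lia.
  exists (fun l => 'X_j * c l); rewrite combM substX -{1}(subnKC de).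
  by rewrite pihomog_mull // -mulrBr; apply: idealMl.
pose c0 l : {mpoly k[r]} := if mdeg (mu l) == e then (al l)%:MP else 0.
have c0E : comb y mu c0 = \sum_l pihomog mdeg e (al l *: 'X_[mu l]).
  apply: eq_bigr => l _; rewrite linearZ /= /c0; case: eqP => [le|/eqP le].
    by rewrite pihomog_dE -?le ?dhomog_mpolyX // substC mul_mpolyC.
  by rewrite (pihomog_ne0 le (dhomog_mpolyX _ _)) scaler0 subst0 mul0r.
exists (fun l => c0 l + \sum_j c j l); rewrite combD c0E comb_sum.
have Jsum : Ji 0 (\sum_j (pihomog mdeg e (y j * h j) - comb y mu (c j))).
  exact: ideal_sum.
have E (u v w x : S) : u - v - w + (w - x) = u - (v + x) by ring.
by have := idealD idJ Jh Jsum; rewrite sumrB E.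
Qed.
End RegularFree.

(** A vector in the left kernel gives f outside J' such that the l0-coordinate of f g vanishes for
    all g. But some multiple of f is a nonzero socle element, hence a scalar multiple of z, whose
    l0-coordinate is nonzero. *)
Lemma pairing_det J J' z (r m : nat) (y : 'I_r -> S) (mu : 'I_m -> 'X_{1..n.+1}) D
    (c : 'I_m -> 'I_m -> 'I_m -> {mpoly k[r]}) :
  is_ideal J' -> J `<=` J' -> (forall i, J' (y i)) ->
  (forall a : 'X_{1..n.+1}, (D <= mdeg a)%N -> J' 'X_[a]) ->
  (forall f, exists al : 'I_m -> k, J' (f - \sum_l al l *: 'X_[mu l])) ->
  (forall al : 'I_m -> k, J' (\sum_l al l *: 'X_[mu l]) -> forall l, al l = 0) ->
  (forall z', (forall i, J' ('X_i * z')) -> exists a : k, J' (z' - a *: z)) ->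
  (forall i j, J ('X_[mu i] * 'X_[mu j] - comb y mu (c i j))) ->
  forall (al : 'I_m -> k) l0, J' (z - \sum_l al l *: 'X_[mu l]) -> al l0 != 0 ->
  \det (\matrix_(i, j) (c i j l0)@_0%MM) != 0.
Proof.
move=> idJ JJ' Jy JD gen ind soc cE al l0 zE al0; apply/det0P => -[v v0 vA].
pose f := \sum_i v ord0 i *: 'X_[k, mu i].
have nJf : ~ J' f.
  move=> /ind v0'; case/eqP: v0; apply/matrixP => i j; rewrite ord1 [RHS]mxE.
  exact: v0'.
have [g [nJfg fgX]] : exists g, ~ J' (f * g) /\ forall i, J' ('X_i * (f * g)).
  (* A monomial multiple of [f] of the largest degree that stays outside [J'] lies in the socle. *)
  pose P e := `[< exists a : 'X_{1..n.+1}, mdeg a = e /\ ~ J' (f * 'X_[a]) >].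
  have P0 : exists e, P e.
    by exists 0%N; apply/asboolP; exists 0%MM; rewrite mdeg0 mpolyX0 mulr1.
  have PD e : P e -> (e <= D)%N.
    move=> /asboolP[a [<- nJ]]; rewrite leqNgt; apply/negP => /ltnW Da.
    by apply: nJ; apply: idealMl => //; apply: JD.
  case: (ex_maxnP P0 PD) => e /asboolP[a [ae nJ]] emax.
  exists 'X_[a]; split=> // i; rewrite mulrCA -mpolyXD; apply: contrapT => nJ'.
  have /emax : P e.+1.
    apply/asboolP; exists (U_(i) + a)%MM; split=> //.
    by rewrite mdegD mdeg1 ae add1n.
  by rewrite ltnn.
have [b fgE] := soc _ fgX; have [ga gE] := gen g.
have b0 : b != 0.
  by apply/eqP => b0; apply: nJfg; rewrite b0 scale0r subr0 in fgE.
have key l : b * al l = \sum_i \sum_j v ord0 i * ga j * (c i j l)@_0%MM.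
  apply/eqP; rewrite -subr_eq0; apply/eqP.
  move: l; apply: ind.
  have -> : \sum_l (b * al l - \sum_i \sum_j v ord0 i * ga j * (c i j l)@_0%MM) *: 'X_[mu l]
     = b *: (\sum_l al l *: 'X_[mu l]) - \sum_i \sum_j (v ord0 i * ga j) *:
       \sum_l (c i j l)@_0%MM *: 'X_[k, mu l].
    rewrite scaler_sumr.
    under [X in _ = _ - X]eq_bigr do under eq_bigr do rewrite scaler_sumr.
    under [X in _ = _ - X]eq_bigr do rewrite exchange_big /=.
    rewrite exchange_big -sumrB /=; apply: eq_bigr => l _.
    rewrite scalerBl scalerA; congr (_ - _); rewrite scaler_suml.
    apply: eq_bigr => i _; rewrite scaler_suml; apply: eq_bigr => j _.
    by rewrite scalerA.
  have e1 : J' (b *: (\sum_l al l *: 'X_[mu l]) - f * g).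
    have := idealMl idJ b%:MP zE; rewrite mul_mpolyC scalerBr => h.
    apply: (ideal_sub_trans idJ (b := b *: z)); apply: ideal_subC => //.
  apply: (ideal_sub_trans idJ e1).
  apply: (ideal_sub_trans idJ (b := f * \sum_j ga j *: 'X_[mu j])).
    by rewrite -mulrBr; apply: idealMl.
  rewrite /f mulr_suml -sumrB; apply: ideal_sum => // i _.
  rewrite mulr_sumr -sumrB; apply: ideal_sum => // j _.
  rewrite -scalerAl -scalerAr scalerA -scalerBr -mul_mpolyC; apply: idealMl => //.
  apply: (ideal_sub_trans idJ (JJ' _ (cE i j))).
  exact: comb_coeff0.
have : b * al l0 = 0.
  rewrite key exchange_big big1 //= => j _.
  have vAj : \sum_i v ord0 i * (c i j l0)@_0%MM = 0.
    have /matrixP/(_ ord0 j) := vA; rewrite !mxE => e.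
    by rewrite -[RHS]e; apply: eq_bigr => i _; rewrite mxE.
  transitivity (ga j * \sum_i v ord0 i * (c i j l0)@_0%MM); last by rewrite vAj mulr0.
  by rewrite mulr_sumr; apply: eq_bigr => i _; rewrite mulrCA mulrA.
by move=> /eqP; rewrite mulf_eq0 (negbTE b0) (negbTE al0).
Qed.
End FreeBasis.

Section GorensteinBasis.
Variables (k : fieldType) (n : nat).
Let S := {mpoly k[n.+1]}.

Lemma mem_monomial_big (J : set S) (N : 'I_n.+1 -> nat) : is_ideal J ->
  (forall i, J ('X_i ^+ N i)) ->
  forall a : 'X_{1..n.+1}, (\sum_i N i <= mdeg a)%N -> J 'X_[a].
Proof.
move=> idJ JN a Na; have [i Ni] : exists i, (N i <= a i)%N.
  apply: contrapT => nN; move: Na; rewrite leqNgt => /negP; apply.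
  have lt i : (a i < N i)%N by rewrite ltnNge; apply/negP => h; apply: nN; exists i.
  have : (\sum_i (a i).+1 <= \sum_i N i)%N by apply: leq_sum => i _; apply: lt.
  under eq_bigr do rewrite -addn1.
  by rewrite big_split /= -mdegE sum_nat_const card_ord muln1; lia.
have le : (U_(i) *+ N i <= a)%MM.
  apply/mnm_lepP => j; rewrite mulmnE mnm1E; case: eqP => [<-|_]; last by rewrite mul0n.
  by rewrite mul1n.
rewrite -(submK le) mpolyXD -mpolyXn.
exact: (idealMl idJ).
Qed.

Lemma sub_add_seq (J : set S) ys : J `<=` add_seq J ys.
Proof.
elim: ys J => [|y ys IHys] J f Jf //=.
by apply: IHys; apply: sub_add_principal.
Qed.

Lemma gorenstein_free_basis (adm : nat -> S -> Prop) (J : set S)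
    (Q : comNzRingType) (pi : {rmorphism S -> Q}) :
  (forall d y, adm d y -> y \is d.-homog) ->
  (forall d y, y \is d.-homog -> exists c : k, c != 0 /\ adm d (c *: y)) ->
  homog_ideal J -> is_quotient J pi -> gorenstein_ring Q ->
  exists r m (d : 'I_r -> nat) (y : 'I_r -> S) (mu : 'I_m -> 'X_{1..n.+1}) (l0 : 'I_m),
  [/\ forall i, (0 < d i)%N /\ adm (d i) (y i),
      forall f, exists c, J (f - comb y mu c),
      forall c, J (comb y mu c) -> forall l, c l = 0
    & forall c, (forall i j, J ('X_[mu i] * 'X_[mu j] - comb y mu (c i j))) ->
      \det (\matrix_(i, j) (c i j l0)@_0%MM) != 0].
Proof.
move=> admh adms hJ quot gor; have [J1 cone] := gorenstein_cone hJ quot gor.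
have [ys [reg hJ' J'1 cone' [z J'z zX]]] := regular_seq_exists admh adms hJ J1 cone.
have [nil soc] := cone_socle hJ' J'1 J'z zX cone'.
have [N NP] := choice nil; set J' := add_seq J ys in hJ' J'1 cone' J'z zX nil soc N NP.
have idJ' := hJ'.1; have JD := mem_monomial_big idJ' NP.
have [m [mu [gen0 ind0]]] := monomial_basis idJ' JD.
pose y0 : nat * S := (0%N, 0).
pose r := size ys; pose y (i : 'I_r) := (nth y0 ys i).2; pose d (i : 'I_r) := (nth y0 ys i).1.
pose Ji i := add_seq J (take i ys).
have yP (i : 'I_r) : [/\ (0 < d i)%N, adm (d i) (y i) & forall f, Ji i (y i * f) -> Ji i f].
  exact: (regular_seq_nth y0 reg (ltn_ord i)).
have JiS (i : 'I_r) : Ji i.+1 = add_principal (Ji i) (y i) by apply: add_seqS.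
have idJi i : is_ideal (Ji i).
  rewrite /Ji; move: (take i ys) => s; move: (hJ.1); elim: s (J) => [//|x s IHs] I idI /=.
  by apply: IHs; apply: add_principal_ideal.
have Jir : Ji r = J' by rewrite /Ji take_size.
have Ji0 : Ji 0%N = J by rewrite /Ji take0.
have hJi0 : homog_ideal (Ji 0%N) by rewrite Ji0.
have nzd (i : 'I_r) f : Ji i (y i * f) -> Ji i f by case: (yP i) => _ _; apply.
have d0 i : (0 < d i)%N by case: (yP i).
have hy i : y i \is (d i).-homog by case: (yP i) => _ + _; apply: admh.
have J'y i : J' (y i).
  have : Ji i.+1 (y i) by rewrite JiS; exists 1; rewrite mulr1 subrr; apply: ideal0.
  have -> : J' = add_seq (Ji i.+1) (drop i.+1 ys).
    by rewrite /J' -{1}(cat_take_drop i.+1 ys) /add_seq foldl_cat.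
  exact: sub_add_seq.
have [al zE] := gen0 z.
(* The pairing is taken at any coordinate in which the socle generator [z] is nonzero. *)
have [l0 al0] : exists l0, al l0 != 0.
  apply: contrapT => nal; apply: J'z; apply/(ideal_congr idJ' zE).
  rewrite big1 => [|l _]; first exact: ideal0.
  suff -> : al l = 0 by rewrite scale0r.
  by apply/eqP; apply: contrapT => /negP al0; apply: nal; exists l.
exists r, m, d, y, mu, l0; split=> //.
- by move=> i; case: (yP i).
- move=> f; rewrite -Ji0; apply: (regular_comb_gen JiS hJi0 d0 hy).
  by rewrite Jir.
- move=> c Jc; apply: (regular_comb_ind JiS nzd _ (c := c) (mu := mu)); last by rewrite Ji0.
  by rewrite Jir.
- move=> c cE; exact: (pairing_det idJ' (@sub_add_seq J ys) J'y JD gen0 ind0 soc cE zE al0).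
Qed.
End GorensteinBasis.

(** * Frobenius algebras over polynomial rings are Gorenstein *)

(** Says that coker G is a [c]-th syzygy module: it is isomorphic to the row space of G', and so
    on. *)
Fixpoint is_higher_syz (R : comNzRingType) c q p (G : 'M[R]_(q, p)) : Prop :=
  if c is c'.+1 then exists s (G' : 'M_(p, s)), is_syz G G' /\ is_higher_syz c' G'
  else True.

Lemma is_higher_syzW (R : comNzRingType) c q p (G : 'M[R]_(q, p)) :
  is_higher_syz c.+1 G -> is_higher_syz c G.
Proof.
elim: c q p G => [//|c IHc] q p G [s [G' [syzG hG']]].
by exists s, G'; split=> //; apply: IHc.
Qed.

Section Frobenius.
Variables (k : fieldType) (r m : nat) (R : comNzRingType).
Let B := {mpoly k[r]}.
Variables (sg : {rmorphism B -> R}) (e : 'I_m -> R).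
Hypotheses (gen : forall a, exists c : 'I_m -> B, a = \sum_l sg (c l) * e l)
  (ind : forall c : 'I_m -> B, \sum_l sg (c l) * e l = 0 -> forall l, c l = 0).

Lemma exists_coord : exists ka : R -> 'I_m -> B,
  [/\ forall a, a = \sum_l sg (ka a l) * e l,
      forall a b l, ka (a + b) l = ka a l + ka b l,
      forall b a l, ka (sg b * a) l = b * ka a l
    & forall c l, ka (\sum_l sg (c l) * e l) l = c l].
Proof.
have [ka kaE] := choice gen.
have kaK c l : ka (\sum_l sg (c l) * e l) l = c l.
  apply/eqP; rewrite -subr_eq0; apply/eqP; move: l.
  apply: (ind (c := fun l => ka (\sum_l sg (c l) * e l) l - c l)).
  under eq_bigr do rewrite rmorphB mulrBl.
  by rewrite sumrB -kaE subrr.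
exists ka; split=> // [a b l|b a l].
  rewrite {1}[a]kaE {1}[b]kaE -big_split /=.
  under eq_bigr do rewrite -mulrDl -rmorphD.
  by rewrite (kaK (fun l => ka a l + ka b l)).
rewrite {1}[a]kaE mulr_sumr; under eq_bigr do rewrite mulrA -rmorphM.
by rewrite (kaK (fun l => b * ka a l)).
Qed.

(** Linearity over the first [c] variables only; the extension argument below raises [c] one
    variable at a time. *)
Let lin c q (h : 'rV[R]_q -> B) := [/\ forall u v, h (u + v) = h u + h v,
  forall (a : k) v, h (sg a%:MP *: v) = a%:MP * h v
  & forall i : 'I_r, (i < c)%N -> forall v, h (sg 'X_i *: v) = 'X_i * h v].

Let lin0 c q (h : 'rV_q -> B) : lin c h -> h 0 = 0.
Proof. by move=> [hD _ _]; apply: (addrI (h 0)); rewrite -hD !addr0. Qed.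

Let lin_sum c q (h : 'rV_q -> B) (I : Type) (s : seq I) (P : pred I) F : lin c h ->
  h (\sum_(i <- s | P i) F i) = \sum_(i <- s | P i) h (F i).
Proof.
move=> lh; elim/big_rec2: _ => [|i u v _ <-]; first exact: lin0 lh.
by case: lh.
Qed.

(* Division by the variable o on the free B-module of row vectors. *)
Let exists_shift (o : 'I_r) q : exists sh : 'rV[R]_q -> 'rV[R]_q,
  [/\ forall u v, sh (u + v) = sh u + sh v,
      forall (a : k) v, sh (sg a%:MP *: v) = sg a%:MP *: sh v,
      forall i : 'I_r, i != o -> forall v, sh (sg 'X_i *: v) = sg 'X_i *: sh v,
      forall v, sh (sg 'X_o *: v) = v
    & forall v, exists K, forall K', (K <= K')%N -> iter K' sh v = 0].
Proof.
have [ka [kaE kaD kaM kaK]] := exists_coord.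
have /choice[s sE] := @mpoly_shift r k U_(o)%MM.
have sD p p' : s (p + p') = s p + s p'.
  by apply/mpolyP => a; rewrite mcoeffD !sE mcoeffD.
have sZ c p : s (c%:MP * p) = c%:MP * s p.
  by apply/mpolyP => a; rewrite mcoeffCM !sE mcoeffCM.
have sX (i : 'I_r) p : i != o -> s ('X_i * p) = 'X_i * s p.
  move=> io; have oi : (o == i) = false by rewrite eq_sym (negbTE io).
  apply/mpolyP => a; rewrite sE !mcoeff_mulX !lep1mP mnmDE mnm1E oi addn0.
  case: ifP => // ai; rewrite sE; congr (_@__); apply/mnmP => j.
  rewrite !(mnmDE, mnmBE, mnm1E); case: (eqVneq i j) => [<-|_]; last by rewrite !subn0.
  by rewrite oi !addn0.
have sXo p : s ('X_o * p) = p.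
  apply/mpolyP => a; rewrite sE mcoeff_mulX lem_addl addmK //.
have sK p j : (msize p <= j)%N -> iter j s p = 0.
  move=> pj; apply/mpolyP => a; rewrite mcoeff0.
  have -> : (iter j s p)@_a = p@_(a + U_(o) *+ j).
    elim: j a {pj} => [|j IHj] a; first by rewrite mulm0n addm0.
    by rewrite iterS sE IHj mulmS addmA.
  apply: memN_msupp_eq0; apply: msize_mdeg_ge.
  by rewrite mdegD mdegMn mdeg1 mul1n (leq_trans pj) // leq_addl.
pose shR a := \sum_l sg (s (ka a l)) * e l.
have shRD a b : shR (a + b) = shR a + shR b.
  by rewrite -big_split; apply: eq_bigr => l _; rewrite kaD sD rmorphD mulrDl.
have shRM (b : B) : (forall p, s (b * p) = b * s p) -> forall a, shR (sg b * a) = sg b * shR a.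
  move=> sb a; rewrite mulr_sumr; apply: eq_bigr => l _.
  by rewrite kaM sb rmorphM mulrA.
have shR0 : shR 0 = 0 by apply: (addrI (shR 0)); rewrite -shRD !addr0.
have shRo a : shR (sg 'X_o * a) = a.
  by rewrite [RHS]kaE; apply: eq_bigr => l _; rewrite kaM sXo.
have shRK a : exists K, forall K', (K <= K')%N -> iter K' shR a = 0.
  exists (\max_l msize (ka a l))%N => K' KK'.
  have -> : iter K' shR a = \sum_l sg (iter K' s (ka a l)) * e l.
    elim: K' {KK'} => [|K' IH]; first exact: kaE.
    by rewrite iterS IH; apply: eq_bigr => l _; rewrite kaK.
  rewrite big1 // => l _; rewrite sK ?rmorph0 ?mul0r //.
  by apply: leq_trans KK'; apply: (leq_bigmax l).
exists (map_mx shR); split.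
- by move=> u v; apply/matrixP => i j; rewrite !mxE.
- by move=> a v; apply/matrixP => i j; rewrite !mxE shRM.
- by move=> i io v; apply/matrixP => i' j; rewrite !mxE shRM // => p; apply: sX.
- by move=> v; apply/matrixP => i j; rewrite !mxE.
- move=> v; have [K KP] := choice (fun j => shRK (v ord0 j)).
  exists (\max_j K j)%N => K' KK'; apply/matrixP => i j; rewrite ord1 [RHS]mxE.
  have -> : (iter K' (map_mx shR) v) ord0 j = iter K' shR (v ord0 j).
    elim: K' {KK'} => [//|K' IH]; by rewrite !iterS mxE IH.
  by apply: KP; apply: leq_trans KK'; apply: (leq_bigmax j).
Qed.

(* The functional z(v) = - sum_j X_o^j w(sh^(j+1) v). *)
Let solve_commutator (o : 'I_r) q (w : 'rV[R]_q -> B) : lin o w ->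
  exists z, lin o z /\ forall v, 'X_o * z v - z (sg 'X_o *: v) = w v.
Proof.
move=> lw; case: (lw) => wD wZ wX.
have [sh [shD shZ shX sho shK]] := exists_shift o q.
have [K KP] := choice shK.
(* On each [v] the sum is finite, and every cut-off beyond [K v] gives the same value; this allows a
   common cut-off for several vectors. *)
pose zK N v := \sum_(j < N) - ('X_o ^+ j * w (iter j.+1 sh v)).
have zKE N v : (K v <= N)%N -> zK N v = zK (K v) v.
  move=> /subnKC <-; rewrite /zK big_split_ord -[RHS]addr0; congr (_ + _).
  apply: big1 => j _.
  rewrite (KP v (rshift _ j).+1); first by rewrite (lin0 lw) mulr0 oppr0.
  by rewrite /= -addnS leq_addr.
have itD j u v : iter j sh (u + v) = iter j sh u + iter j sh v.
  by elim: j => [//|j IH]; rewrite !iterS IH shD.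
have itZ a j v : iter j sh (sg a%:MP *: v) = sg a%:MP *: iter j sh v.
  by elim: j => [//|j IH]; rewrite !iterS IH shZ.
have itX (i : 'I_r) j v : i != o -> iter j sh (sg 'X_i *: v) = sg 'X_i *: iter j sh v.
  by move=> io; elim: j => [//|j IH]; rewrite !iterS IH shX.
exists (fun v => zK (K v) v); split.
  split.
  - move=> u v; pose N := maxn (K (u + v)) (maxn (K u) (K v)).
    rewrite -(zKE N) ?leq_maxl // -(zKE N u) ?leq_max ?leqnn ?orbT //.
    rewrite -(zKE N v) ?leq_max ?leqnn ?orbT // -big_split; apply: eq_bigr => j _.
    by rewrite itD wD mulrDr opprD.
  - move=> a v; pose N := maxn (K (sg a%:MP *: v)) (K v).
    rewrite -(zKE N) ?leq_maxl // -(zKE N v) ?leq_max ?leqnn ?orbT // mulr_sumr.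
    by apply: eq_bigr => j _; rewrite itZ wZ mulrN mulrCA.
  - move=> i io v; pose N := maxn (K (sg 'X_i *: v)) (K v).
    rewrite -(zKE N) ?leq_maxl // -(zKE N v) ?leq_max ?leqnn ?orbT // mulr_sumr.
    apply: eq_bigr => j _; rewrite itX ?wX //; first by rewrite mulrN mulrCA.
    by rewrite -val_eqE /= ltn_eqF.
move=> v; pose N := maxn (K (sg 'X_o *: v)) (K v).
rewrite -(zKE N.+1 (sg _ *: v)); last exact: leq_trans (leq_maxl _ _) (leqnSn _).
rewrite -(zKE N v) ?leq_max ?leqnn ?orbT //.
have -> : zK N.+1 (sg 'X_o *: v) = - w v + 'X_o * zK N v.
  rewrite /zK big_ord_recl expr0 mul1r mulr_sumr; congr (- w _ + _); first exact: sho.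
  apply: eq_bigr => j _; rewrite (iterSr (lift ord0 j)) sho mulrN exprS mulrA.
  by [].
by rewrite opprD opprK addrCA subrr addr0.
Qed.

(** For c = 0 this is extension of a [k]-linear map. In the step, the defect of u at the new
    variable, x to X_o u(x) - u(X_o x), vanishes on the rows of [G], so it factors through G' by
    induction. Written there as the commutator of X_o with some z, it is removed by subtracting z(x
    G'), which vanishes on the rows of [G]. *)
Let syz_functional c q p (G : 'M[R]_(q, p)) (h : 'rV[R]_q -> B) : (c <= r)%N ->
  is_higher_syz c G -> lin c h -> (forall v, v *m G = 0 -> h v = 0) ->
  exists2 u : 'rV[R]_p -> B, lin c u & forall v, h v = u (v *m G).
Proof.
elim: c q p G h => [|c IHc] q p G h cr.
  move=> _ [hD hZ _] hG.
  pose rho : {rmorphism k -> R} := sg \o @mpolyC r k.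
  have [N [cN [dN [cdN dcN cND cNZ]]]] := exists_restriction_of_scalars_of_scalars rho 'rV[R]_p.
  have dND u v : dN (u + v) = dN u + dN v by apply: (can_inj cdN); rewrite cND !dcN.
  have dNZ a u : dN (a *: u) = rho a *: dN u by apply: (can_inj cdN); rewrite cNZ !dcN.
  have cN0 : cN 0 = 0 by apply: (addrI (cN 0)); rewrite -cND !addr0.
  pose D := [set x : N | exists v, x = cN (v *m G)].
  have sD : submodule D.
    split; first by exists 0; rewrite mul0mx.
      by move=> _ _ [u ->] [v ->]; exists (u + v); rewrite mulmxDl cND.
    by move=> a _ [u ->]; exists (rho a *: u); rewrite -scalemxAl cNZ.
  have [W [i [inj_i iD]]] := exists_submodule sD.
  have /choice[s sP] w : exists v, i w = cN (v *m G) by apply/iD; exists w.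
  have hE u v : u *m G = v *m G -> h u = h v.
    move=> uv; have : h (u - v) = 0 by apply: hG; rewrite mulmxBl uv subrr.
    move=> huv; apply/eqP; rewrite -subr_eq0 -huv; apply/eqP.
    by apply: (addIr (h v)); rewrite subrK -hD subrK.
  have [f fE] : exists f : {linear W -> {mpoly k[r]}}, forall w, f w = h (s w).
    apply: linear_of_fun => [u v|a u].
      rewrite -hD; apply: hE; apply: (can_inj cdN).
      by rewrite mulmxDl cND -!sP linearD.
    rewrite -mul_mpolyC -hZ; apply: hE; apply: (can_inj cdN).
    by rewrite -scalemxAl -sP linearZ /= sP -[sg _]/(rho a) cNZ.
  have [g gE] := vector_space_injective f inj_i.
  exists (fun x => g (cN x)).
    split=> // [u v|a v]; first by rewrite cND linearD.
    by rewrite -[sg _]/(rho a) cNZ linearZ /= mul_mpolyC.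
  move=> v; have [w iw] : exists w, i w = cN (v *m G) by apply/iD; exists v.
  rewrite -iw gE fE; apply: hE; apply: (can_inj cdN).
  by rewrite -iw sP.
move=> hsyz lh hG; pose o := Ordinal cr; case: (lh) => hD hZ hX.
have lhc : lin c h by split=> // i ic; apply: hX; rewrite ltnS ltnW.
have [u lu uE] := IHc _ _ _ _ (ltnW cr) (is_higher_syzW hsyz) lhc hG.
case: (lu) => uD uZ uX; case: hsyz => s [G' [syzG hsyz']].
pose v1 x := 'X_o * u x - u (sg 'X_o *: x).
have comm (b b' : B) (x : 'rV[R]_p) : sg b *: (sg b' *: x) = sg b' *: (sg b *: x).
  by rewrite !scalerA mulrC.
have lv1 : lin c v1.
  split=> [x x'|a x|i ic x]; rewrite /v1.
  - by rewrite scalerDr !uD mulrDr opprD addrACA.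
  - by rewrite comm !uZ mulrBr mulrCA.
  - by rewrite comm !(uX i ic) mulrBr mulrCA.
have [|w lw wE] := IHc _ _ G' v1 (ltnW cr) hsyz' lv1.
  move=> x /syzG[v ->]; rewrite /v1 -uE scalemxAl -uE hX ?subrr //.
have [z [lz zE]] := solve_commutator (o := o) lw; case: (lz) => zD zZ zX.
exists (fun x => u x - z (x *m G')).
  split=> [x x'|a x|i ic x].
  - by rewrite uD mulmxDl zD opprD addrACA.
  - by rewrite uZ -scalemxAl zZ -mulrBr.
  - rewrite -scalemxAl; move: ic; rewrite ltnS leq_eqVlt => /orP[/eqP ic|ic].
      have -> : i = o by apply: val_inj.
      have -> : u (sg 'X_o *: x) = 'X_o * u x - w (x *m G').
        by rewrite -wE opprB addrCA subrr addr0.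
      have -> : z (sg 'X_o *: (x *m G')) = 'X_o * z (x *m G') - w (x *m G').
        by rewrite -zE opprB addrCA subrr addr0.
      by rewrite mulrBr opprB addrA subrK.
    by rewrite uX // zX // -mulrBr.
by move=> v; rewrite -mulmxA (is_syz_mul syzG) mulmx0 (lin0 lz) subr0.
Qed.

Variables (l0 : 'I_m) (c : 'I_m -> 'I_m -> 'I_m -> B) (dinv : B).
Hypotheses (mulE : forall i j, e i * e j = \sum_l sg (c i j l) * e l)
  (det_unit : \det (\matrix_(i, j) c i j l0) * dinv = 1).

Let T := \matrix_(i, j) c i j l0.

(** The functional is the l0-coordinate. [T] is its Gram matrix in the basis [e], and invertibility
    of [T] makes multiplication into it an isomorphism from R to Hom_B(R, B). *)
Let trace : exists ph : R -> B,
  [/\ forall a b, ph (a + b) = ph a + ph b,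
      forall b a, ph (sg b * a) = b * ph a,
      forall a, (forall b, ph (b * a) = 0) -> a = 0
    & forall ps : R -> B, (forall a b, ps (a + b) = ps a + ps b) ->
        (forall b a, ps (sg b * a) = b * ps a) ->
        exists g, forall a, ps a = ph (a * g)].
Proof.
have [ka [kaE kaD kaM kaK]] := exists_coord.
pose ph a := ka a l0.
have phD a b : ph (a + b) = ph a + ph b by apply: kaD.
have phM b a : ph (sg b * a) = b * ph a by apply: kaM.
have ph0 : ph 0 = 0 by apply: (addrI (ph 0)); rewrite -phD !addr0.
have ph_sum (F : 'I_m -> R) : ph (\sum_l F l) = \sum_l ph (F l).
  by elim/big_rec2: _ => // i y x _ <-.
have phT i j : ph (e i * e j) = T i j by rewrite mulE /ph kaK mxE.
have phv (v : 'rV[B]_m) j : ph ((\sum_i sg (v ord0 i) * e i) * e j) = (v *m T) ord0 j.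
  rewrite mulr_suml ph_sum mxE; apply: eq_bigr => i _.
  by rewrite -mulrA phM phT.
exists ph; split=> // [a ha|ps psD psM].
  pose v := \row_i ka a i.
  have aE : a = \sum_i sg (v ord0 i) * e i.
    by rewrite [LHS]kaE; apply: eq_bigr => i _; rewrite mxE.
  have vT : v *m T = 0.
    by apply/matrixP => i j; rewrite ord1 -phv -aE mulrC ha mxE.
  have v0 : v = 0.
    have : v *m T *m \adj T = 0 by rewrite vT mul0mx.
    rewrite -mulmxA mul_mx_adj mul_mx_scalar => /(congr1 (fun M => dinv *: M)).
    by rewrite scalerA mulrC det_unit scale1r scaler0.
  by rewrite aE big1 // => i _; rewrite v0 mxE rmorph0 mul0r.
pose v := dinv *: ((\row_j ps (e j)) *m \adj T).
pose g := \sum_i sg (v ord0 i) * e i.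
have vT : v *m T = \row_j ps (e j).
  by rewrite -scalemxAl -mulmxA mul_adj_mx mul_mx_scalar scalerA mulrC det_unit scale1r.
have ps0 : ps 0 = 0 by apply: (addrI (ps 0)); rewrite -psD !addr0.
have ps_sum (F : 'I_m -> R) : ps (\sum_l F l) = \sum_l ps (F l).
  by elim/big_rec2: _ => // i y x _ <-.
exists g => a; rewrite [a]kaE mulr_suml ps_sum ph_sum; apply: eq_bigr => j _.
by rewrite psM -mulrA phM [e j * g]mulrC phv vT mxE.
Qed.

(** Through the trace, R-linear maps to R are B-linear maps to B. The functional attached to a
    cocycle extends by [syz_functional], and the representing elements of the extension form the
    solution. *)
Lemma frobenius_ext_vanish q p (G : 'M[R]_(q, p)) : is_higher_syz r G ->
  ext_vanish G (R^o : lmodType R).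
Proof.
move=> hsyz; have [ph [phD phM ph_nd ph_rep]] := trace.
have ph0 : ph 0 = 0 by apply: (addrI (ph 0)); rewrite -phD !addr0.
have phN a : ph (- a) = - ph a.
  by apply/eqP; rewrite -addr_eq0 -phD addNr ph0.
apply/ext_vanish_ring => h hG.
pose H (v : 'rV[R]_q) := ph ((v *m h) ord0 ord0).
have lH : lin r H.
  split=> [u v|a v|i _ v]; rewrite /H.
  - by rewrite mulmxDl mxE phD.
  - by rewrite -scalemxAl mxE phM.
  - by rewrite -scalemxAl mxE phM.
have [|u lu uE] := syz_functional (leqnn r) hsyz lH.
  by move=> v /hG vh; rewrite /H vh mxE ph0.
case: (lu) => uD uZ uX.
have uB b : forall v, u (sg b *: v) = b * u v.
  pose hom b := forall v, u (sg b *: v) = b * u v.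
  have homM b1 b2 : hom b1 -> hom b2 -> hom (b1 * b2).
    by move=> h1 h2 v; rewrite rmorphM -scalerA h1 h2 mulrA.
  have hom1 : hom 1 by move=> v; rewrite rmorph1 scale1r mul1r.
  have homX i t : hom ('X_i ^+ t).
    elim: t => [|t IHt]; first by rewrite expr0.
    by rewrite exprS; apply: homM => // v; apply: uX.
  elim/mpolyind: b => [|a mon b _ _ IHb] v.
    by rewrite rmorph0 scale0r mul0r (lin0 lu).
  rewrite rmorphD scalerDl uD IHb mulrDl; congr (_ + _).
  rewrite -mul_mpolyC; apply: (homM) => [w|]; first exact: uZ.
  by rewrite mpolyXE_id; apply: (big_ind hom).
have repj (j : 'I_p) : exists g, forall a, u (a *: delta_mx ord0 j) = ph (a * g).
  apply: ph_rep => [a b|b a]; first by rewrite scalerDl uD.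
  by rewrite -scalerA uB.
have [g gE] := choice repj; exists (\col_j g j).
have uE' x : u x = ph ((x *m \col_j g j) ord0 ord0).
  rewrite {1}[x]row_sum_delta (lin_sum _ _ _ lu) mxE.
  elim/big_rec2: _ => [|j a b _ ->]; first by rewrite ph0.
  by rewrite gE phD mxE.
apply/eqP; rewrite -subr_eq0; apply/eqP/matrixP => i j; rewrite ord1 [RHS]mxE.
apply: ph_nd => b.
have := uE (b *: delta_mx ord0 i); rewrite uE' /H -mulmxA -!scalemxAl -!rowE.
rewrite !mxE => e1; rewrite mulrDr mulrN phD phN e1.
by rewrite subrr.
Qed.
End Frobenius.

(** * Vanishing of Ext after localization *)

Lemma ext_some_higher_syz (R : comNzRingType) (M : lmodType R) r :
  noetherian R -> (forall q p (G : 'M_(q, p)), is_higher_syz r G -> ext_vanish G M) ->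
  forall d c q p (G : 'M_(q, p)), (d + c)%N = r -> is_higher_syz c G -> ext_some d G M.
Proof.
move=> noethR hM; elim=> [|d IHd] c q p G dc hG; first by apply: hM; rewrite -dc.
have [s [K syzK]] := noetherian_syz G noethR.
exists s, K; split=> //; apply: (IHd c.+1); first by rewrite addnS.
by exists p, G.
Qed.

(** A matrix over [L] becomes one over [R] after a common denominator, and a relation over [L] holds
    over [R] after one more factor outside [P]; hence syzygies and solutions localize. *)
Lemma ext_some_localization (R L : comNzRingType) (P : set R)
    (phi : {rmorphism R -> L}) d q p (G : 'M_(q, p)) :
  noetherian R -> prime_ideal P -> is_localization P phi ->
  ext_some d G (R^o : lmodType R) -> ext_some d (map_mx phi G) (L^o : lmodType L).
Proof.
move=> noethR primeP [inv frac ker0].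
have idP := prime_ideal_ideal primeP.
have nP1 := prime_ideal_n1 primeP.
have clear a b (M : 'M[L]_(a, b)) : exists s (M' : 'M[R]_(a, b)),
    ~ P s /\ phi s *: M = map_mx phi M'.
  have H (i : 'I_a) : exists (s : R) (v : 'I_b -> R), ~ P s /\
      forall j, phi s * M i j = phi (v j).
    have /choice[nd ndP] j : exists x : R * R, ~ P x.2 /\ phi x.2 * M i j = phi x.1.
      by have [x [s [nPs e]]] := frac (M i j); exists (x, s).
    exists (\prod_j (nd j).2), (fun j => (\prod_(j' | j' != j) (nd j').2) * (nd j).1).
    split.
      elim/big_rec: _ => // j x _ nPx; apply: prime_idealM => //.
      by case: (ndP j).
    move=> j; have [_ e1] := ndP j.
    by rewrite (bigD1 j) //= !rmorphM /= -e1 mulrAC mulrC.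
  have /choice[sv svP] i : exists x : R * ('I_b -> R), ~ P x.1 /\
      forall j, phi x.1 * M i j = phi (x.2 j).
    by have [s [v sv]] := H i; exists (s, v).
  exists (\prod_i (sv i).1),
    (\matrix_(i, j) ((\prod_(i' | i' != i) (sv i').1) * (sv i).2 j)).
  split.
    elim/big_rec: _ => // j x _ nPx; apply: prime_idealM => //.
    by case: (svP j).
  apply/matrixP => i j; rewrite !mxE (bigD1 i) //= !rmorphM.
  by have [_ /(_ j) <-] := svP i; rewrite mulrAC mulrC.
have kill a b (M : 'M[R]_(a, b)) : map_mx phi M = 0 -> exists s, ~ P s /\ s *: M = 0.
  move=> M0; have /choice[s sP] (ij : 'I_a * 'I_b) : exists s, ~ P s /\ s * M ij.1 ij.2 = 0.
    by apply/ker0; have /matrixP/(_ ij.1 ij.2) := M0; rewrite !mxE.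
  exists (\prod_ij s ij); split.
    elim/big_rec: _ => // j x _ nPx; apply: prime_idealM => //.
    by case: (sP j).
  apply/matrixP => i j; rewrite !mxE (bigD1 (i, j)) //=.
  by have [_ /= e] := sP (i, j); rewrite mulrAC e mul0r.
have syz_loc a b c' (K : 'M[R]_(a, b)) (G' : 'M[R]_(b, c')) :
    is_syz K G' -> is_syz (map_mx phi K) (map_mx phi G').
  move=> syzK v; split=> [vG|[w ->]]; last first.
    by rewrite -mulmxA -map_mxM (is_syz_mul syzK) map_mx0 mulmx0.
  have [s [v' [nPs sv]]] := clear _ _ v.
  have [|s' [nPs' sv']] := kill _ _ (v' *m G').
    by rewrite map_mxM -sv -scalemxAl vG scaler0.
  have [w wE] : exists w, s' *: v' = w *m K by apply/syzK; rewrite -scalemxAl.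
  have [t tE] := inv (s' * s) (prime_idealM primeP nPs' nPs).
  exists (t *: map_mx phi w); rewrite -scalemxAl -map_mxM -wE map_mxZ -sv !scalerA.
  by rewrite -mulrA -rmorphM mulrC tE scale1r.
elim: d q p G => [|d IHd] q p G; last first.
  move=> [s [K [syzK hK]]]; exists s, (map_mx phi K); split; first exact: syz_loc.
  exact: IHd.
move=> /ext_vanish_ring vG; apply/ext_vanish_ring => h hG.
have [s [h' [nPs sh]]] := clear _ _ h.
have [a [K syzK]] := noetherian_syz G noethR.
have [|s' [nPs' sK]] := kill _ _ (K *m h').
  rewrite map_mxM -sh -scalemxAr.
  suff -> : map_mx phi K *m h = 0 by rewrite scaler0.
  apply/row_matrixP => i; rewrite row_mul row0; apply: hG.
  by rewrite -row_mul -map_mxM (is_syz_mul syzK) map_mx0 row0.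
have [|u uE] := vG (s' *: h').
  by move=> v /syzK[w ->]; rewrite -mulmxA -scalemxAr sK mulmx0.
have [t tE] := inv (s' * s) (prime_idealM primeP nPs' nPs).
exists (t *: map_mx phi u); rewrite -scalemxAr -map_mxM -uE map_mxZ -sh !scalerA.
by rewrite -mulrA -rmorphM mulrC tE scale1r.
Qed.

Lemma frobenius_gorenstein (k : fieldType) (r m : nat) (R : comNzRingType)
    (sg : {rmorphism {mpoly k[r]} -> R}) (e : 'I_m -> R) (l0 : 'I_m)
    (c : 'I_m -> 'I_m -> 'I_m -> {mpoly k[r]}) (dinv : {mpoly k[r]}) :
  noetherian R ->
  (forall a, exists c : 'I_m -> {mpoly k[r]}, a = \sum_l sg (c l) * e l) ->
  (forall c : 'I_m -> {mpoly k[r]}, \sum_l sg (c l) * e l = 0 -> forall l, c l = 0) ->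
  (forall i j, e i * e j = \sum_l sg (c i j l) * e l) ->
  \det (\matrix_(i, j) c i j l0) * dinv = 1 ->
  gorenstein_ring R.
Proof.
move=> noethR gen ind mulE det1; split=> // P L phi primeP locL.
exists r; pose io : {rmorphism k -> L} := phi \o sg \o @mpolyC r k.
apply: (injdim_of_ext_some io) => a ida.
case: (locL) => inv frac ker0.
pose a0 := [set x : R | a (phi x)].
have ida0 : is_ideal a0.
  split; first by rewrite /a0 /= rmorph0; apply: ideal0.
    by move=> x y ax ay; rewrite /a0 /= rmorphD; apply: idealD.
  by move=> x y ay; rewrite /a0 /= rmorphM; apply: idealMl.
have [p [G aE]] := noetherian_col noethR ida0; exists p, (map_mx phi G); split.
  apply/seteqP; split=> [l al|_ [v ->]].
    have [x [s [nPs e1]]] := frac l; have [t st] := inv s nPs.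
    have : a0 x by rewrite /a0 /= -e1; apply: idealMl.
    rewrite aE => -[v xE]; exists (t *: map_mx phi v).
    rewrite -scalemxAl -map_mxM [RHS]mxE [X in _ * X]mxE -xE -e1 mulrA [t * _]mulrC.
    by rewrite st mul1r.
  rewrite mxE; apply: ideal_sum => // i _; apply: idealMl => //.
  rewrite mxE; suff: a0 (G i ord0) by [].
  by rewrite aE; exists (delta_mx ord0 i); rewrite -rowE mxE.
apply: (ext_some_localization noethR primeP locL).
apply: (ext_some_higher_syz (r := r) noethR _ (c := 0%N)) => //; last by rewrite addn0.
move=> q s K hK; exact: (frobenius_ext_vanish gen ind mulE det1 hK).
Qed.

(** * Spreading out a free basis *)

Lemma sat_mul_homog (n : nat) (A : comNzRingType) (I : set {mpoly A[n]})
    N e (f g : {mpoly A[n]}) : is_ideal I ->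
  (forall m : 'X_{1..n}, (N <= mdeg m)%N -> I ('X_[m] * f)) ->
  g \is e.-homog -> (N <= e)%N -> I (g * f).
Proof.
move=> idI If hg Ne; rewrite [g]mpolyE mulr_suml big_seq; apply: ideal_sum => // m mg.
rewrite -scalerAl -mul_mpolyC; apply: idealMl => //; apply: If.
by rewrite (dhomog_mf hg mg).
Qed.

Lemma mcoeff_map (n : nat) (A B : comNzRingType) (f : {rmorphism A -> B})
    (p : {mpoly A[n]}) m : (map_mpoly f p)@_m = f p@_m.
Proof. exact: mcoeff_map_mpoly. Qed.

Section MapMPoly.
Variables (n : nat) (A B : comNzRingType) (f : {rmorphism A -> B}).
Implicit Types p q : {mpoly A[n]}.

Lemma mapm0 : map_mpoly f (0 : {mpoly A[n]}) = 0. Proof. exact: rmorph0. Qed.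
Lemma mapmD p q : map_mpoly f (p + q) = map_mpoly f p + map_mpoly f q.
Proof. exact: rmorphD. Qed.
Lemma mapmB p q : map_mpoly f (p - q) = map_mpoly f p - map_mpoly f q.
Proof. exact: rmorphB. Qed.
Lemma mapmM p q : map_mpoly f (p * q) = map_mpoly f p * map_mpoly f q.
Proof. exact: rmorphM. Qed.
Lemma mapmZ c p : map_mpoly f (c *: p) = f c *: map_mpoly f p.
Proof. exact: map_mpolyZ. Qed.
Lemma mapmX a : map_mpoly f ('X_[a] : {mpoly A[n]}) = 'X_[a].
Proof. exact: map_mpolyX. Qed.
Lemma mapmXn p i : map_mpoly f (p ^+ i) = map_mpoly f p ^+ i.
Proof. exact: rmorphXn. Qed.
Lemma mapm_sum (T : Type) (s : seq T) (P : pred T) (F : T -> {mpoly A[n]}) :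
  map_mpoly f (\sum_(i <- s | P i) F i) = \sum_(i <- s | P i) map_mpoly f (F i).
Proof. exact: rmorph_sum. Qed.
End MapMPoly.

Lemma pihomog_map (n : nat) (A B : comNzRingType) (f : {rmorphism A -> B}) d
    (p : {mpoly A[n]}) :
  pihomog mdeg d (map_mpoly f p) = map_mpoly f (pihomog mdeg d p).
Proof.
apply/mpolyP => m; rewrite mcoeff_pihomog !mcoeff_map mcoeff_pihomog.
by rewrite (fun_if f) rmorph0.
Qed.

Lemma map_mpoly_homog (n : nat) (A B : comNzRingType) (f : {rmorphism A -> B}) d
    (p : {mpoly A[n]}) : p \is d.-homog -> map_mpoly f p \is d.-homog.
Proof. by move=> hp; rewrite -(pihomog_dE hp) -pihomog_map; apply: pihomogP. Qed.

Lemma map_subst (A B : comNzRingType) (f : {rmorphism A -> B}) (n r : nat)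
    (Y : 'I_r -> {mpoly A[n]}) (q : {mpoly A[r]}) :
  map_mpoly f (subst Y q) = subst (fun i => map_mpoly f (Y i)) (map_mpoly f q).
Proof.
elim/mpolyind: q => [|c a q _ _ IHq]; first by rewrite !(mapm0, subst0).
rewrite substD !mapmD IHq substD.
congr (_ + _).
rewrite substZ substXm !mapmZ mapmX substZ substXm (rmorph_prod (map_mpoly f)).
by congr (_ *: _); apply: eq_bigr => i _; rewrite rmorphXn.
Qed.

Lemma map_comb (A B : comNzRingType) (f : {rmorphism A -> B}) (n r m : nat)
    (Y : 'I_r -> {mpoly A[n]}) (mu : 'I_m -> 'X_{1..n}) (c : 'I_m -> {mpoly A[r]}) :
  map_mpoly f (comb Y mu c) =
  comb (fun i => map_mpoly f (Y i)) mu (fun l => map_mpoly f (c l)).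
Proof.
rewrite /comb mapm_sum; apply: eq_bigr => l _.
by rewrite mapmM map_subst mapmX.
Qed.

(** * Extension of homogeneous ideals *)

Section Extension.
Variables (n : nat) (A : comNzRingType) (I : set {mpoly A[n.+1]}).
Hypothesis hI : homog_ideal I.

Lemma ext_ideal_ideal (B : comNzRingType) (f : A -> B) : is_ideal (ext_ideal f I).
Proof. exact: ideal_genP. Qed.

Lemma map_ext_ideal (B : comNzRingType) (f : {rmorphism A -> B}) g :
  I g -> ext_ideal f I (map_mpoly f g).
Proof. by move=> Ig; apply: sub_ideal_gen; exists g. Qed.

Lemma ext_ideal_homog (B : comNzRingType) (f : {rmorphism A -> B}) :
  homog_ideal (ext_ideal f I).
Proof.
have idE := ext_ideal_ideal f; split=> // g d Eg; move: g Eg d.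
suff: ext_ideal f I `<=` [set g | forall d, ext_ideal f I (pihomog mdeg d g)] by [].
apply: ideal_gen_sub; last first.
  move=> _ [g Ig <-] d; rewrite pihomog_map; apply: map_ext_ideal.
  exact: hI.2.
split.
- by move=> d; rewrite linear0; exact: (ideal0 idE).
- by move=> g h Eg Eh d; rewrite linearD; exact: (idealD idE (Eg d) (Eh d)).
- move=> g h Eh d; rewrite [g](@pihomog_partitionE _ _ mdeg _ g (leqnn _)).
  rewrite mulr_suml pihomog_sum; apply: (ideal_sum idE) => i _.
  case: (leqP i d) => [id|di].
    rewrite -(subnKC id) (pihomog_mull _ _ (pihomogP _ _ _)).
    exact: (idealMl idE).
  by rewrite (pihomog_mull_lt _ (pihomogP _ _ _) di); exact: (ideal0 idE).
Qed.
End Extension.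

Lemma homog_monomials (B : comNzRingType) q u : exists N (X : 'I_N -> 'X_{1..q}),
  (forall i, mdeg (X i) = u) /\
  forall g : {mpoly B[q]}, g \is u.-homog -> g = \sum_i g@_(X i) *: 'X_[X i].
Proof.
pose T := {a : 'X_{1..q < u.+1} | mdeg a == u}.
pose X (i : 'I_#|{: T}|) : 'X_{1..q} := val (val (enum_val i : T)).
have Xu i : mdeg (X i) = u by apply/eqP; exact: (valP (enum_val i : T)).
have Xinj : injective X by move=> i j /val_inj/val_inj/enum_val_inj.
exists #|{: T}|, X; split=> // g hg; apply/mpolyP => a; rewrite (raddf_sum (mcoeff a)) /=.
have [au|au] := eqVneq (mdeg a) u; last first.
  rewrite big1 => [|i _]; first by apply: (dhomog_nemf_coeff hg).
  by rewrite mcoeffZ mcoeffX; case: eqP => [e|]; [rewrite -e Xu eqxx in au | rewrite mulr0].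
have au' : (mdeg a < u.+1)%N by rewrite au.
have aT : mdeg (BMultinom au') == u by rewrite /= au.
have XE : X (enum_rank (exist _ (BMultinom au') aT : T)) = a by rewrite /X enum_rankK.
rewrite (bigD1 (enum_rank (exist _ (BMultinom au') aT : T))) //= mcoeffZ mcoeffX XE eqxx mulr1.
rewrite big1 ?addr0 // => i ine; rewrite mcoeffZ mcoeffX; case: eqP => [e|]; rewrite ?mulr0 //.
by case/eqP: ine; apply: Xinj; rewrite XE.
Qed.

Lemma comb_homog_sum (B : comNzRingType) n r m (mu : 'I_m -> 'X_{1..n.+1}) d u N
    (b : 'I_N -> B) (C : 'I_N -> 'I_m -> {mpoly B[r]}) :
  (forall i, comb_homog mu d u (C i)) ->
  comb_homog mu d u (fun l => \sum_i b i *: C i l).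
Proof.
move=> hC l a; rewrite (raddf_sum (mcoeff a)) /= => h.
have [i Ci] : exists i, (C i l)@_a != 0; last exact: hC Ci.
apply: contrapT => nC; move/eqP: h; apply; apply: big1 => i _.
rewrite mcoeffZ; case: (eqVneq (C i l)@_a 0) => [->|/eqP e]; first by rewrite mulr0.
by case: nC; exists i; apply/eqP.
Qed.

(** * Lifting relations from a residue field *)

Section Fibre.
Variables (n : nat) (A : comNzRingType) (I : set {mpoly A[n.+1]}).
Hypothesis hI : homog_ideal I.
Variables (k : fieldType) (phi : {rmorphism A -> k}).
Hypothesis frac : forall c : k, exists a s, phi s != 0 /\ phi s * c = phi a.

Lemma clear_denominators q (p : {mpoly k[q]}) :
  exists s P, phi s != 0 /\ phi s *: p = map_mpoly phi P.
Proof.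
elim/mpolyind: p => [|c a p _ _ [s [P [s0 sP]]]].
  by exists 1, 0; rewrite rmorph1 oner_eq0 scaler0 mapm0.
have [b [t [t0 tc]]] := frac c.
exists (s * t), ((s * b) *: 'X_[a] + t *: P); split; first by rewrite rmorphM mulf_neq0.
rewrite mapmD !mapmZ mapmX scalerDr scalerA !rmorphM -sP -mulrA tc.
by rewrite !scalerA [phi t * _]mulrC.
Qed.

Lemma clear_denominators_fin q (T : finType) (p : T -> {mpoly k[q]}) :
  exists s P, phi s != 0 /\ forall i, phi s *: p i = map_mpoly phi (P i).
Proof.
have /choice[x xP] i : exists x : A * {mpoly A[q]},
    phi x.1 != 0 /\ phi x.1 *: p i = map_mpoly phi x.2.
  by have [s [P [s0 sP]]] := clear_denominators (p i); exists (s, P).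
exists (\prod_i (x i).1), (fun i => (\prod_(j | j != i) (x j).1) *: (x i).2); split.
  by rewrite rmorph_prod; apply/prodf_neq0 => i _; case: (xP i).
move=> i; have [_ e] := xP i.
by rewrite mapmZ -e scalerA -rmorphM mulrC (bigD1 i).
Qed.

Lemma ext_ideal_lift g : ext_ideal phi I g ->
  exists s i, [/\ phi s != 0, I i & phi s *: g = map_mpoly phi i].
Proof.
move: g; suff: ext_ideal phi I `<=`
  [set g | exists s i, [/\ phi s != 0, I i & phi s *: g = map_mpoly phi i]] by [].
apply: ideal_gen_sub; last first.
  by move=> _ [i Ii <-]; exists 1, i; rewrite rmorph1 oner_eq0 scale1r.
have idI := hI.1; split.
- by exists 1, 0; rewrite rmorph1 oner_eq0 scaler0 mapm0; split=> //; apply: ideal0.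
- move=> g h [s [i [s0 Ii sg]]] [t [j [t0 Ij th]]].
  exists (s * t), (t *: i + s *: j); split; first by rewrite rmorphM mulf_neq0.
    by rewrite -!mul_mpolyC; apply: idealD => //; apply: idealMl.
  by rewrite mapmD !mapmZ -sg -th scalerDr !scalerA rmorphM [phi t * _]mulrC.
- move=> h g [s [i [s0 Ii sg]]]; have [t [P [t0 tP]]] := clear_denominators h.
  exists (t * s), (P * i); split; first by rewrite rmorphM mulf_neq0.
    exact: idealMl.
  by rewrite rmorphM mapmM -sg -tP -scalerAl -scalerAr scalerA.
Qed.

Lemma sat_eventually (E : set {mpoly k[n.+1]}) : homog_ideal E ->
  exists t1, forall u f, (t1 <= u)%N -> f \is u.-homog -> sat E f -> E f.
Proof.
move=> hE; have idE := hE.1; have idS := sat_ideal hE.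
have [s sE] := noetherian_mpoly idS.
have Ss i : (i < size s)%N -> sat E s`_i.
  by move=> ls; rewrite sE; apply: sub_ideal_gen; apply: mem_nth.
have /choice[N NP] (i : 'I_(size s)) : exists N, forall m : 'X_{1..n.+1}, (N <= mdeg m)%N ->
    E ('X_[m] * s`_i).
  have [N h] := Ss i (ltn_ord i); exists N; exact: (sat_ge hE h).
pose M := (\max_i N i)%N; pose D := (\max_(i < size s) msize s`_i)%N.
(* The components of the generators have degree below [D], so in degree at least [M + D] their
   cofactors have degree at least [M], which carries them into [E]. *)
exists (M + D)%N => u f ltu hf; rewrite {1}sE => /ideal_gen_seqP[c fE].
rewrite -(pihomog_dE hf) fE pihomog_sum; apply: ideal_sum => // i _.
rewrite {1}[s`_i](@pihomog_partitionE _ _ mdeg _ s`_i (leqnn _)) mulr_sumr pihomog_sum.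
apply: ideal_sum => // e _.
have eD : (e < D)%N by apply: leq_trans (ltn_ord e) (leq_bigmax i).
have eu : (e <= u)%N by rewrite (leq_trans (ltnW eD)) // (leq_trans _ ltu) // leq_addl.
rewrite mulrC -{1}(subnKC eu) (pihomog_mull _ _ (pihomogP _ _ _)) mulrC.
apply: (sat_mul_homog (N := M) idE) (pihomogP _ _ _) _; last first.
  by move: eD ltu; lia.
move=> m Mm; rewrite -(pihomog_mull _ _ (dhomog_mpolyX k m)); apply: hE.2.
by apply: NP; apply: leq_trans Mm; apply: (leq_bigmax i).
Qed.

Section Spread.
Variables (r m : nat) (d : 'I_r -> nat) (Y : 'I_r -> {mpoly A[n.+1]})
  (mu : 'I_m -> 'X_{1..n.+1}) (t1 : nat).
Hypotheses (hY : forall i, Y i \is (d i).-homog)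
  (gen : forall f, exists c,
     sat (ext_ideal phi I) (f - comb (fun i => map_mpoly phi (Y i)) mu c))
  (sat_t1 : forall u f, (t1 <= u)%N -> f \is u.-homog ->
     sat (ext_ideal phi I) f -> ext_ideal phi I f).

Let hy i : map_mpoly phi (Y i) \is (d i).-homog.
Proof. exact: map_mpoly_homog. Qed.

(** A relation over [k] lifts only up to a form [q] whose coefficients lie in the kernel of [phi];
    keeping [q] homogeneous of the same degree lets all these errors enter one square matrix. *)
Let lift_monomial u (a : 'X_{1..n.+1}) : (t1 <= u)%N -> mdeg a = u ->
  exists s q C, [/\ phi s != 0, q \is u.-homog, map_mpoly phi q = 0, comb_homog mu d u C
    & I (s *: 'X_[a] - q - comb Y mu C)].
Proof.
move=> t1u au; have ha : ('X_[a] : {mpoly k[n.+1]}) \is u.-homog by rewrite -au dhomog_mpolyX.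
have hA : ('X_[a] : {mpoly A[n.+1]}) \is u.-homog by rewrite -au dhomog_mpolyX.
have [c Jc] := gen 'X_[a]; pose c' := comb_proj mu d u c.
have Ec : ext_ideal phi I ('X_[a] - comb (fun i => map_mpoly phi (Y i)) mu c').
  have e : 'X_[a] - comb (fun i => map_mpoly phi (Y i)) mu c' =
      pihomog mdeg u ('X_[a] - comb (fun i => map_mpoly phi (Y i)) mu c).
    by rewrite linearB /= (pihomog_comb mu hy) pihomog_dE.
  apply: (sat_t1 t1u); rewrite e; first exact: pihomogP.
  exact: (sat_homog (ext_ideal_homog hI phi)).2.
have [s [C0 [s0 sC]]] := clear_denominators_fin c'.
pose C := comb_proj mu d u C0.
have CE l : map_mpoly phi (C l) = phi s *: c' l.
  apply/mpolyP => b; rewrite mcoeff_map mcoeff_comb_proj.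
  have := sC l => /mpolyP/(_ b); rewrite mcoeff_map => e.
  case: ifP => h; first by rewrite -e.
  by rewrite rmorph0 mcoeffZ mcoeff_comb_proj h mulr0.
have hC : comb_homog mu d u C by apply: comb_proj_homog.
pose w := s *: 'X_[a] - comb Y mu C.
have hw : w \is u.-homog by apply: rpredB; [apply: rpredZ | exact: (comb_homogP hY hC)].
have wE : map_mpoly phi w = phi s *: ('X_[a] - comb (fun i => map_mpoly phi (Y i)) mu c').
  rewrite mapmB mapmZ mapmX map_comb scalerBr -combZ; congr (_ - _).
  by apply: eq_comb => l; rewrite CE.
have [|s2 [i [s20 Ii e]]] := ext_ideal_lift (g := map_mpoly phi w).
  by rewrite wE -mul_mpolyC; apply: (idealMl (ext_ideal_ideal _ _)).
exists (s2 * s), (s2 *: w - pihomog mdeg u i), (fun l => s2 *: C l); split.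
- by rewrite rmorphM mulf_neq0.
- by rewrite rpredB ?rpredZ // pihomogP.
- rewrite mapmB mapmZ e -pihomog_map -e linearZ /= pihomog_dE ?subrr //.
  exact: map_mpoly_homog.
- by move=> l b; rewrite mcoeffZ => h; apply: hC; apply: contraNneq h => ->; rewrite mulr0.
- rewrite combZ.
  have -> : (s2 * s) *: 'X_[a] - (s2 *: w - pihomog mdeg u i) - s2 *: comb Y mu C =
      pihomog mdeg u i.
    rewrite /w scalerBr scalerA; move: (_ *: 'X_[a]) (s2 *: comb _ _ _) (pihomog _ _ _).
    by move=> p q v; ring.
  exact: hI.2.
Qed.

Lemma spread_degree u : (t1 <= u)%N -> exists f, phi f != 0 /\
  forall g, g \is u.-homog -> exists C, comb_homog mu d u C /\ I (f *: g - comb Y mu C).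
Proof.
move=> t1u; have idI := hI.1.
have [N [X [Xu Xsum]]] := homog_monomials A n.+1 u.
have /choice[x xP] a : exists x : A * {mpoly A[n.+1]} * ('I_m -> {mpoly A[r]}),
    [/\ phi x.1.1 != 0, x.1.2 \is u.-homog, map_mpoly phi x.1.2 = 0,
        comb_homog mu d u x.2 & I (x.1.1 *: 'X_[X a] - x.1.2 - comb Y mu x.2)].
  by have [s [q [C ?]]] := lift_monomial t1u (Xu a); exists (s, q, C).
(* The matrix of the relations is diagonal and invertible over k, so Nakayama's
   lemma holds after inverting its determinant. *)
pose M : 'M[A]_N := \matrix_(a, b) ((x a).1.1 *+ (a == b) - (x a).1.2@_(X b)).
have hM a : I (\sum_b M a b *: 'X_[X b] - comb Y mu (x a).2).
  have [_ hq _ _] := xP a; congr (I (_ - _)).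
  under eq_bigr do rewrite mxE scalerBl; rewrite sumrB -Xsum //; congr (_ - _).
  rewrite (bigD1 a) //= eqxx big1 ?addr0 // => b /negbTE ba.
  by rewrite eq_sym ba scale0r.
exists (\det M); split.
  have -> : phi (\det M) = \det (diag_mx (\row_a phi (x a).1.1)).
    rewrite -det_map_mx; congr (\det _); apply/matrixP => a b; rewrite !mxE rmorphB rmorphMn.
    have [_ _ /mpolyP/(_ (X b)) + _ _] := xP a; rewrite mcoeff_map mcoeff0 => ->.
    by rewrite subr0.
  by rewrite det_diag; apply/prodf_neq0 => a _; rewrite mxE; case: (xP a).
have hX b : I (\det M *: 'X_[X b] - comb Y mu (fun l => \sum_a (\adj M) b a *: (x a).2 l)).
  have -> : \det M *: 'X_[X b] - comb Y mu (fun l => \sum_a (\adj M) b a *: (x a).2 l) =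
      \sum_a (\adj M) b a *: (\sum_c M a c *: 'X_[X c] - comb Y mu (x a).2).
    under [RHS]eq_bigr do rewrite scalerBr; rewrite sumrB; congr (_ - _).
      under eq_bigr do rewrite scaler_sumr; rewrite exchange_big /=.
      have /matrixP adjM := mul_adj_mx M.
      under eq_bigr => c _.
        under eq_bigr do rewrite scalerA; rewrite -scaler_suml.
        have := adjM b c; rewrite !mxE => ->; over.
      rewrite (bigD1 b) //= eqxx big1 ?addr0 // => c /negbTE cb.
      by rewrite eq_sym cb scale0r.
    by rewrite comb_sum; apply: eq_bigr => a _; rewrite combZ.
  by apply: ideal_sum => // a _; rewrite -mul_mpolyC; apply: idealMl.
move=> g hg.
exists (fun l => \sum_b g@_(X b) *: (\sum_a (\adj M) b a *: (x a).2 l)); split.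
  apply: comb_homog_sum => b; apply: comb_homog_sum => a; by case: (xP a).
rewrite {1}(Xsum g hg) comb_sum scaler_sumr -sumrB; apply: ideal_sum => // b _.
by rewrite combZ scalerA mulrC -scalerA -scalerBr -mul_mpolyC; apply: idealMl.
Qed.

Lemma spread_degrees (us : seq nat) : {in us, forall u, (t1 <= u)%N} ->
  exists f, phi f != 0 /\ {in us, forall u g, g \is u.-homog ->
    exists C, comb_homog mu d u C /\ I (f *: g - comb Y mu C)}.
Proof.
have idI := hI.1.
elim: us => [|u us IHus] hus; first by exists 1; rewrite rmorph1 oner_eq0.
have [f [f0 hf]] := spread_degree (hus u (mem_head _ _)).
have [|f' [f'0 hf']] := IHus; first by move=> v vus; apply: hus; rewrite inE vus orbT.
exists (f * f'); split; first by rewrite rmorphM mulf_neq0.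
have scal a b v g C : comb_homog mu d v C -> I (b *: g - comb Y mu C) ->
    exists C, comb_homog mu d v C /\ I ((a * b) *: g - comb Y mu C).
  move=> hC IC; exists (fun l => a *: C l); split.
    move=> l e; rewrite mcoeffZ => h; apply: (hC l); apply: contraNneq h => ->.
    by rewrite mulr0.
  by rewrite combZ -scalerA -scalerBr -mul_mpolyC; apply: idealMl.
move=> v; rewrite inE => /orP[/eqP->|vus] g hg.
  by have [C [hC IC]] := hf g hg; rewrite mulrC; apply: (scal _ _ _ _ C).
by have [C [hC IC]] := hf' v vus g hg; apply: (scal _ _ _ _ C).
Qed.
End Spread.
End Fibre.

(** * Combinations in each degree *)

Section Degreewise.
Variables (k : fieldType) (n r m : nat).
Variables (y : 'I_r -> {mpoly k[n.+1]}) (mu : 'I_m -> 'X_{1..n.+1}) (d : 'I_r -> nat).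
Variable E : set {mpoly k[n.+1]}.
Hypotheses (hE : homog_ideal E) (d0 : forall i, (0 < d i)%N)
  (hy : forall i, y i \is (d i).-homog).

Let idE : is_ideal E. Proof. by case: hE. Qed.

Definition gen_in_degree (F : set {mpoly k[n.+1]}) u : Prop :=
  forall g, g \is u.-homog -> exists c, comb_homog mu d u c /\ F (g - comb y mu c).

Definition ind_in_degree (F : set {mpoly k[n.+1]}) u : Prop :=
  forall c : 'I_m -> {mpoly k[r]}, comb_homog mu d u c -> F (comb y mu c) ->
  forall l, c l = 0.

Lemma comb_homogZ u a (c : 'I_m -> {mpoly k[r]}) :
  comb_homog mu d u c -> comb_homog mu d u (fun l => a *: c l).
Proof. by move=> hc l b; rewrite mcoeffZ mulf_eq0 negb_or => /andP[_ /hc]. Qed.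

Lemma comb_homog_mulX u b (c : 'I_m -> {mpoly k[r]}) : comb_homog mu d u c ->
  comb_homog mu d (wdeg d b + u)%N (fun l => 'X_[b] * c l).
Proof.
move=> hc l a; rewrite mcoeff_mulX; case: ifP => [ba|]; last by rewrite eqxx.
by move/hc => <-; rewrite -{1}(submK ba) wdegD addnA [(wdeg d b + _)%N]addnC.
Qed.

(** In degree u beyond the window, write a monomial as a variable times one of degree u - 1, and
    expand the latter. As u - 1 exceeds the degrees of the basis monomials, every term contains some
    y_j; removing it leaves degree u - d_j, still at least t1, where induction applies. *)
Lemma gen_in_degree_window t1 dl : (forall l, (mdeg (mu l) < t1)%N) ->
  (forall i, (d i <= dl)%N) ->
  (forall u, (t1 <= u <= t1 + dl)%N -> gen_in_degree E u) ->
  forall u, (t1 <= u)%N -> gen_in_degree E u.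
Proof.
move=> mut ddl win u; elim/ltn_ind: u => u IHu t1u.
case: (leqP u (t1 + dl)) => [ut|ut]; first by apply: win; rewrite t1u.
pose G v g := exists c, comb_homog mu d v c /\ E (g - comb y mu c).
have GZ v a g : G v g -> G v (a *: g).
  move=> [c [hc Ec]]; exists (fun l => a *: c l); split; first exact: comb_homogZ.
  by rewrite combZ -scalerBr -mul_mpolyC; apply: idealMl.
have G_sum v N (F : 'I_N -> {mpoly k[n.+1]}) : (forall i, G v (F i)) -> G v (\sum_i F i).
  move=> /choice[c hc]; exists (fun l => \sum_i 1 *: c i l); split.
    by apply: comb_homog_sum => i; case: (hc i).
  rewrite comb_sum -sumrB; apply: (ideal_sum idE) => i _; rewrite combZ scale1r.
  by case: (hc i).
have G_sumL v (T : eqType) (s : seq T) (F : T -> {mpoly k[n.+1]}) :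
    {in s, forall i, G v (F i)} -> G v (\sum_(i <- s) F i).
  move=> GF; rewrite big_tnth; apply: G_sum => i; apply: GF; exact: mem_tnth.
have G_congr v g g' : E (g - g') -> G v g' -> G v g.
  move=> Eg [c [hc Ec]]; exists c; split=> //; exact: (ideal_sub_trans idE Eg Ec).
suff GX (a : 'X_{1..n.+1}) : mdeg a = u -> G u 'X_[a].
  move=> g hg; have [N [X [Xu gE]]] := homog_monomials k n.+1 u.
  by rewrite (gE g hg); apply: G_sum => i; apply: GZ; apply: GX.
move=> au; have u0 : (0 < mdeg a)%N by rewrite au; apply: leq_ltn_trans ut.
have [a1 [a2 [a11 aE]]] := mnm_split u0.
have a2u : mdeg a2 = u.-1 by move: au; rewrite aE mdegD a11; lia.
have hX2 : ('X_[a2] : {mpoly k[n.+1]}) \is u.-1.-homog by rewrite -a2u; apply: dhomog_mpolyX.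
have ltu : (u.-1 < u)%N by move: ut; lia.
have tu : (t1 <= u.-1)%N by move: ut; lia.
have [c [hc Ec]] := IHu _ ltu tu _ hX2.
apply: (G_congr _ _ ('X_[a1] * comb y mu c)).
  by rewrite aE mpolyXD -mulrBr; apply: idealMl.
rewrite mulr_sumr; apply: G_sum => l; rewrite [c l]mpolyE subst_sum mulr_suml mulr_sumr.
apply: G_sumL => b; rewrite mcoeff_msupp => /hc hb.
rewrite substZ -scalerAl -scalerAr; apply: GZ.
have [j bj] : exists j, b j != 0%N.
  apply: contrapT => nb; have b0 : b = 0%MM.
    by apply/mnmP => j; rewrite mnm0E; apply/eqP/negP => /negP h; apply: nb; exists j.
  by move: hb (mut l); rewrite b0 wdeg0; lia.
have b1 : (U_(j) <= b)%MM by rewrite lep1mP.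
have hb' : (d j + (wdeg d (b - U_(j)) + mdeg (mu l)) = u.-1)%N.
  by rewrite -hb -{2}(submK b1) wdegD wdeg1; lia.
have hg : 'X_[a1] * (subst y 'X_[b - U_(j)] * 'X_[mu l]) \is (u - d j).-homog.
  have -> : (u - d j = 1 + (wdeg d (b - U_(j)) + mdeg (mu l)))%N by move: hb' ltu; lia.
  apply: dhomogM; first by rewrite -a11; apply: dhomog_mpolyX.
  by apply: dhomogM; [exact: substXm_homog | exact: dhomog_mpolyX].
have ltju : (u - d j < u)%N by move: (d0 j) ltu; lia.
have tju : (t1 <= u - d j)%N by move: (ddl j) ut; lia.
have [c' [hc' Ec']] := IHu _ ltju tju _ hg.
exists (fun l => 'X_[U_(j)] * c' l); split.
  have -> : u = (wdeg d U_(j) + (u - d j))%N by rewrite wdeg1; move: (ddl j); lia.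
  exact: comb_homog_mulX.
rewrite combM -{1}(submK b1) mpolyXD substM [subst y 'X_[_ - _] * _]mulrC.
by rewrite -!mulrA [_ * (subst y _ * _)]mulrCA -mulrBr; apply: idealMl.
Qed.

(** Indices of the products y^a X_[mu l] of degree [u]; the bound on [a] loses nothing because the
    y_i have positive degrees. *)
Definition comb_index u : {set 'I_m * 'X_{1..r < u.+1}} :=
  [set x : 'I_m * 'X_{1..r < u.+1} | (wdeg d (val x.2) + mdeg (mu x.1))%N == u]%SET.

Let N u := #|comb_index u|.
Let li u (i : 'I_(N u)) : 'I_m := (enum_val i).1.
Let ai u (i : 'I_(N u)) : 'X_{1..r} := val (enum_val i).2.

Let aiP u (i : 'I_(N u)) : (wdeg d (ai i) + mdeg (mu (li i)))%N = u.
Proof. by have := enum_valP i; rewrite inE => /eqP. Qed.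

Let comb_indexK u l a : (wdeg d a + mdeg (mu l))%N = u ->
  exists i : 'I_(N u), li i = l /\ ai i = a.
Proof.
move=> e; have au : (mdeg a < u.+1)%N by move: (wdeg_ge a d0); lia.
have xB : (l, BMultinom au) \in comb_index u by rewrite inE /= e.
by exists (enum_rank_in xB (l, BMultinom au)); rewrite /li /ai enum_rankK_in.
Qed.

Let li_ai_inj u (i j : 'I_(N u)) : li i = li j -> ai i = ai j -> i = j.
Proof.
rewrite /li /ai => e1 /val_inj e2; apply: enum_val_inj.
by rewrite [enum_val i]surjective_pairing e1 e2 -surjective_pairing.
Qed.

Let cf u (x : 'I_(N u) -> k) l : {mpoly k[r]} :=
  \sum_(i | li i == l) x i *: 'X_[ai i].

Let cf_coeff u (x : 'I_(N u) -> k) (i : 'I_(N u)) : (cf x (li i))@_(ai i) = x i.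
Proof.
rewrite (raddf_sum (mcoeff (ai i))) (bigD1 i) //= mcoeffZ mcoeffX eqxx mulr1.
rewrite big1 ?addr0 // => j /andP[/eqP lij jE]; rewrite mcoeffZ mcoeffX.
case: eqP => [aij|]; last by rewrite mulr0.
by rewrite (li_ai_inj lij aij) eqxx in jE.
Qed.

Let cf_homog u (x : 'I_(N u) -> k) : comb_homog mu d u (cf x).
Proof.
move=> l a; rewrite (raddf_sum (mcoeff a)) /= => h.
have [[i /andP[/eqP <- /eqP <-]]|ni] := pselect (exists i : 'I_(N u), (li i == l) && (ai i == a)).
  exact: aiP.
move/eqP: h; case; rewrite big1 // => i il.
rewrite mcoeffZ mcoeffX; case: eqP => [e|]; last by rewrite mulr0.
by case: ni; exists i; rewrite il e eqxx.
Qed.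

Let vec u (i : 'I_(N u)) := subst y 'X_[ai i] * 'X_[mu (li i)].

Let comb_cf u (x : 'I_(N u) -> k) : comb y mu (cf x) = \sum_i x i *: vec i.
Proof.
rewrite (partition_big (@li u) xpredT) //=; apply: eq_bigr => l _.
rewrite subst_sum mulr_suml; apply: eq_bigr => i /eqP <-.
by rewrite substZ -scalerAl.
Qed.

Let cf_of u (c : 'I_m -> {mpoly k[r]}) : comb_homog mu d u c ->
  c =1 cf (fun i : 'I_(N u) => (c (li i))@_(ai i)).
Proof.
move=> hc l; apply/mpolyP => a.
have [e|ne] := eqVneq (wdeg d a + mdeg (mu l))%N u.
  by have [i [<- <-]] := comb_indexK e; rewrite cf_coeff.
have z (c' : 'I_m -> {mpoly k[r]}) : comb_homog mu d u c' -> (c' l)@_a = 0.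
  by move=> hc'; apply: contra_neq_eq ne; apply: hc'.
by rewrite !z //; apply: cf_homog.
Qed.

(** The rows of M are the coordinates of the products y^a X_[mu l] in a basis of the degree [u]
    part. Generation says that M has full column rank, so independence becomes a comparison of two
    numbers. *)
Lemma hilbert_fun_matrix u q : hilbert_fun_is E u q -> gen_in_degree E u ->
  exists M : 'M[k]_(N u, q), row_full M /\ (ind_in_degree E u <-> row_free M).
Proof.
move=> [b [hb bU]] gen.
have b_ind (x : 'I_q -> k) : E (\sum_j x j *: b j) -> forall j, x j = 0.
  move=> Ex; have [|c [_ cU]] := bU 0; first exact: dhomog0.
  have e1 : c = fun=> 0.
    by apply: cU; rewrite big1 ?subr0 => [|j _]; [apply: ideal0 | rewrite scale0r].
  have e2 : c = x by apply: cU; rewrite sub0r; apply: idealN.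
  by move=> j; rewrite -e2 e1.
have hvec (i : 'I_(N u)) : vec i \is u.-homog.
  have := dhomogM (substXm_homog hy (ai i)) (dhomog_mpolyX k (mu (li i))).
  by rewrite aiP.
have /choice[M0 hM0] (i : 'I_(N u)) : exists x : 'I_q -> k, E (vec i - \sum_j x j *: b j).
  by have [x [Ex _]] := bU _ (hvec i); exists x.
pose M : 'M[k]_(N u, q) := \matrix_(i, j) M0 i j.
have combM (x : 'rV[k]_(N u)) :
    E (\sum_i x 0 i *: vec i - \sum_j (x *m M) 0 j *: b j).
  have -> : \sum_j (x *m M) 0 j *: b j = \sum_i x 0 i *: \sum_j M0 i j *: b j.
    under [RHS]eq_bigr do rewrite scaler_sumr; rewrite exchange_big; apply: eq_bigr => j _ /=.
    by rewrite mxE scaler_suml; apply: eq_bigr => i _; rewrite mxE scalerA.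
  rewrite -sumrB; apply: (ideal_sum idE) => i _.
  by rewrite -scalerBr -mul_mpolyC; apply: idealMl.
exists M; split.
  have /choice[x hx] (j : 'I_q) : exists x : 'I_(N u) -> k, E (b j - \sum_i x i *: vec i).
    have [c [hc Ec]] := gen _ (hb j); exists (fun i => (c (li i))@_(ai i)).
    by rewrite -comb_cf -(eq_comb _ _ (cf_of hc)).
  pose L : 'M[k]_(q, N u) := \matrix_(j, i) x j i.
  apply/row_fullP; exists L; apply/matrixP => j j'.
  have h : E (b j - \sum_j' (row j L *m M) 0 j' *: b j').
    apply: (ideal_sub_trans idE (hx j)).
    by have := combM (row j L); under eq_bigr do rewrite !mxE.
  have {}h : E (\sum_j' ((j == j')%:R - (row j L *m M) 0 j') *: b j').
    under eq_bigr do rewrite scalerBl; rewrite sumrB.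
    rewrite (bigD1 j) //= eqxx scale1r [X in _ + X - _]big1 ?addr0 // => i /negbTE ij.
    by rewrite eq_sym ij scale0r.
  have /eqP := b_ind _ h j'; rewrite subr_eq0 -row_mul mxE => /eqP <-.
  by rewrite mxE.
split=> [ind|free c hc Ec].
  rewrite -kermx_eq0; apply/rowV0P => x /sub_kermxP xM.
  have := combM x; rewrite xM [X in _ - X]big1 ?subr0 => [|j _]; last by rewrite mxE scale0r.
  rewrite -comb_cf => Ex; have z := ind _ (@cf_homog u (x 0)) Ex.
  by apply/rowP => i; rewrite mxE -(cf_coeff (x 0) i) z mcoeff0.
pose x : 'rV[k]_(N u) := \row_i (c (li i))@_(ai i).
have cE := cf_of hc.
have xM0 : x *m M = 0.
  apply/rowP => j; rewrite [RHS]mxE; apply: (b_ind (fun j => (x *m M) 0 j)) => {j}.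
  apply/(ideal_congr idE (ideal_subC idE (combM x))); rewrite -comb_cf.
  by rewrite -(eq_comb _ _ (c := c)) // => l; rewrite cE; apply: eq_bigr => i _; rewrite mxE.
have x0 : x = 0 by apply: (row_free_inj free); rewrite xM0 mul0mx.
move=> l; rewrite cE; apply: big1 => i _.
by have /rowP/(_ i) := x0; rewrite !mxE => ->; rewrite scale0r.
Qed.

Lemma hilbert_fun_card u q : hilbert_fun_is E u q -> gen_in_degree E u ->
  ind_in_degree E u -> #|comb_index u| = q.
Proof.
move=> hq gen ind; have [M [full [/(_ ind) free _]]] := hilbert_fun_matrix hq gen.
by rewrite -[RHS](eqP full) (eqP free).
Qed.

Lemma card_ind_in_degree u : hilbert_fun_is E u #|comb_index u| ->
  gen_in_degree E u -> ind_in_degree E u.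
Proof.
move=> hq gen; have [M [full ind]] := hilbert_fun_matrix hq gen.
by apply/ind; rewrite row_free_unit -row_full_unit.
Qed.

End Degreewise.

Lemma subst_XUn (A : comNzRingType) n r (y : 'I_r -> {mpoly A[n]}) o a :
  subst y 'X_[U_(o) *+ a] = y o ^+ a.
Proof.
rewrite -mpolyXn; elim: a => [|a IHa]; first by rewrite !expr0 -mpolyC1 substC.
by rewrite !exprS substM substX IHa.
Qed.

(** * From high degrees to the saturation *)

Section SatBasis.
Variables (k : fieldType) (n r m : nat).
Variables (y : 'I_r -> {mpoly k[n.+1]}) (mu : 'I_m -> 'X_{1..n.+1}) (d : 'I_r -> nat).
Variable E : set {mpoly k[n.+1]}.
Hypotheses (hE : homog_ideal E) (d0 : forall i, (0 < d i)%N)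
  (hy : forall i, y i \is (d i).-homog).
Variables (t1 t2 : nat).
Hypotheses (gen : forall u, (t1 <= u)%N -> gen_in_degree y mu d E u)
  (ind : forall u, (t2 <= u)%N -> ind_in_degree y mu d E u).

Let idE : is_ideal E. Proof. by case: hE. Qed.
Let idS : is_ideal (sat E). Proof. exact: sat_ideal. Qed.

Lemma mulX_inj (B : comNzRingType) q b (p : {mpoly B[q]}) : 'X_[b] * p = 0 -> p = 0.
Proof.
move=> /mpolyP z; apply/mpolyP => a; have := z (b + a)%MM.
by rewrite mcoeff_mulX lem_addr addmC addmK !mcoeff0.
Qed.

Let comb_mulX o a c : comb y mu (fun l => 'X_[U_(o) *+ a] * c l) = y o ^+ a * comb y mu c.
Proof. by rewrite combM subst_XUn. Qed.

Let hya o a : y o ^+ a \is (d o * a).-homog.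
Proof. exact: dhomogMn. Qed.

(** A high power of y_o carries an element of the saturation into [E] and into a degree where
    independence is known, and multiplication of the coefficients by a power of X_o is injective. *)
Lemma sat_ind (o : 'I_r) c : sat E (comb y mu c) -> forall l, c l = 0.
Proof.
suff H e c' : comb_homog mu d e c' -> sat E (comb y mu c') -> forall l, c' l = 0.
  move=> Sc l; apply/mpolyP => a; rewrite mcoeff0.
  have h : comb_proj mu d (wdeg d a + mdeg (mu l))%N c l = 0.
    apply: (H (wdeg d a + mdeg (mu l))%N); first exact: comb_proj_homog.
    by rewrite -(pihomog_comb mu hy); apply: (sat_homog hE).2.
  by have /mpolyP/(_ a) := h; rewrite mcoeff_comb_proj eqxx mcoeff0.
move=> hc [N0 EN]; pose N := (N0 + t2)%N => l.
apply: (@mulX_inj _ _ (U_(o) *+ N)); move: l.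
apply: (ind (u := (wdeg d (U_(o) *+ N) + e)%N)).
- by rewrite wdegMn wdeg1 /N; move: (d0 o); nia.
- exact: comb_homog_mulX.
rewrite comb_mulX; apply: (sat_mul_homog (N := N0) idE _ (hya o N)).
  exact: (sat_ge hE EN).
by rewrite /N; move: (d0 o); nia.
Qed.

(** After multiplication by monomials of degree [t1] the element is a combination modulo [E], and
    X_o^a cancels from its coefficients. *)
Let sat_nzd (o : 'I_r) a e g : g \is e.-homog -> sat E (y o ^+ a * g) -> sat E g.
Proof.
move=> hg Sg; exists t1 => x xt1.
have [||c [hc Ec]] := gen (u := (mdeg x + e)%N) _ (g := 'X_[x] * g).
- by rewrite xt1 leq_addr.
- by apply: dhomogM => //; apply: dhomog_mpolyX.
apply/(ideal_congr idE Ec).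
have c0 : forall l, 'X_[U_(o) *+ a] * c l = 0.
  apply: (sat_ind o); rewrite comb_mulX.
  have h : sat E (y o ^+ a * ('X_[x] * g)) by rewrite mulrCA; apply: (idealMl idS).
  have h2 : sat E (y o ^+ a * ('X_[x] * g) - y o ^+ a * comb y mu c).
    by rewrite -mulrBr; apply: (idealMl idS); apply: (sub_sat hE).
  exact: (ideal_congr idS h2).1.
rewrite (eq_comb _ _ (c' := fun=> 0)) ?comb0 => [|l]; first exact: (ideal0 idE).
exact: mulX_inj (c0 l).
Qed.

(* If y_o^a f = comb c1 and y_o'^a f = comb c2 then X_o'^a c1 = X_o^a c2, so c1 is
   divisible by X_o^a; this brings generation down from the high degrees. *)
Lemma sat_gen (o o' : 'I_r) e : o != o' -> gen_in_degree y mu d (sat E) e.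
Proof.
(* Since the d_i are positive, the exponent [t1] brings y_o^a f and y_o'^a f into the degrees
   covered by [gen]. *)
move=> oo f hf; pose a := t1.
have big (o1 : 'I_r) : exists c, comb_homog mu d (d o1 * a + e) c /\
    sat E (y o1 ^+ a * f - comb y mu c).
  have [|c [hc Ec]] := gen (u := (d o1 * a + e)%N) _ (dhomogM (hya o1 a) hf).
    by move: (d0 o1); rewrite /a; nia.
  by exists c; split=> //; apply: (sub_sat hE).
have [c1 [hc1 S1]] := big o; have [c2 [hc2 S2]] := big o'.
have e12 l : 'X_[U_(o') *+ a] * c1 l = 'X_[U_(o) *+ a] * c2 l.
  apply/eqP; rewrite -subr_eq0; apply/eqP; move: l.
  apply: (sat_ind o); rewrite combB !comb_mulX.
  have h1 : sat E (y o' ^+ a * (y o ^+ a * f - comb y mu c1)) by apply: (idealMl idS).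
  have h2 : sat E (y o ^+ a * (y o' ^+ a * f - comb y mu c2)) by apply: (idealMl idS).
  have := idealB idS h2 h1; congr (sat E _); ring.
have /choice[c3 hc3] l := mpoly_shift (U_(o) *+ a)%MM (c1 l).
have c1E l : c1 l = 'X_[U_(o) *+ a] * c3 l.
  apply/mpolyP => b; rewrite mcoeff_mulX; case: ifP => [ab|/negP ab].
    by rewrite hc3 submK.
  (* Multiplying by a power of X_o' does not change the exponent of X_o, so a term of [c1] is
     divisible by X_o^a as soon as its multiple is. *)
  apply/eqP/negP => /negP cb; case: ab.
  have /mpolyP/(_ (U_(o') *+ a + b)%MM) := e12 l.
  rewrite !mcoeff_mulX lem_addr addmC addmK; case: ifP => [|_ z]; last by rewrite z eqxx in cb.
  move=> /mnm_lepP/(_ o) h _; apply/mnm_lepP => j; move: h.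
  rewrite mnmDE !mulmnE !mnm1E eqxx eq_sym (negbTE oo) mul0n addn0.
  by case: eqP => [<-|_] //; rewrite mul0n.
have hc3' : comb_homog mu d e c3.
  move=> l b; rewrite hc3 => /hc1; rewrite wdegD wdegMn wdeg1; lia.
exists c3; split; first exact: hc3'.
apply: (@sat_nzd o a e).
  by apply: rpredB; [exact: hf | exact: (comb_homogP hy hc3')].
have e1 : y o ^+ a * comb y mu c3 = comb y mu c1.
  by rewrite -comb_mulX; apply: eq_comb => l; rewrite c1E.
by rewrite mulrBr e1; exact: S1.
Qed.

End SatBasis.

(** The product of the polynomials p - j for j up to N has infinitely many roots, so one factor is
    zero and [p] is constant. *)
Lemma poly_finite_values (p : {poly rat}) t0 N :
  (forall u, (t0 <= u)%N -> exists2 j, (j <= N)%N & p.[u%:R] = j%:R) ->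
  (size p <= 1)%N.
Proof.
move=> hp; pose q := \prod_(j < N.+1) (p - (j%:R)%:P).
suff /eqP : q = 0.
  by case/prodf_eq0 => j _; rewrite subr_eq0 => /eqP ->; apply: size_polyC_leq1.
apply: contrapT => /eqP q0.
pose rs : seq rat := [seq (t0 + i)%:R | i <- iota 0 (size q)].
suff : (size q < size q)%N by rewrite ltnn.
have := max_poly_roots (rs := rs) q0; rewrite size_map size_iota; apply.
  apply/allP => _ /mapP[i _ ->]; have [|j jN pj] := hp (t0 + i)%N; first exact: leq_addr.
  rewrite /root horner_prod (bigD1 (Ordinal (jN : (j < N.+1)%N))) //=.
  by rewrite !hornerE pj subrr mul0r.
rewrite map_inj_uniq ?iota_uniq // => i j /eqP; rewrite Num.Theory.eqr_nat eqn_add2l.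
by move/eqP.
Qed.

(** With at most one variable, the exponent is determined by [l] and the degree. *)
Lemma comb_index_le n r m (mu : 'I_m -> 'X_{1..n.+1}) (d : 'I_r -> nat) u :
  (forall i, (0 < d i)%N) -> (r <= 1)%N -> (#|comb_index mu d u| <= m)%N.
Proof.
move=> d0 r1; rewrite -[X in (_ <= X)%N]card_ord -(card_in_imset (f := fst)).
  exact: max_card.
move=> [l a] [l' a']; rewrite !inE /= => /eqP h /eqP h' ll'; rewrite ll' in h *.
congr (_, _); apply/val_inj/mnmP => i.
have wE (b : 'X_{1..r}) : wdeg d b = (b i * d i)%N.
  rewrite /wdeg (bigD1 i) //= big1 ?addn0 // => j /eqP; case.
  by apply: val_inj => /=; move: (ltn_ord i) (ltn_ord j); lia.
have e : (val a i * d i = val a' i * d i)%N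
  by rewrite -!wE; apply: (@addIn (mdeg (mu l'))); rewrite h h'.
by apply/eqP; rewrite -(eqn_pmul2r (d0 i)) e.
Qed.

(** * Determinants of weighted homogeneous matrices *)

Section WeightedDet.
Variables (k : fieldType) (r m : nat) (d : 'I_r -> nat).
Hypothesis d0 : forall i, (0 < d i)%N.

Let W (z : int) (p : {mpoly k[r]}) := forall a, p@_a != 0 -> (wdeg d a)%:Z = z.

Let WM z1 z2 p1 p2 : W z1 p1 -> W z2 p2 -> W (z1 + z2) (p1 * p2).
Proof.
move=> h1 h2 a; rewrite -mcoeff_msupp => /msuppM_le /allpairsP[[a1 a2] /= [m1 m2 ->]].
rewrite !mcoeff_msupp in m1 m2.
by rewrite wdegD PoszD (h1 _ m1) (h2 _ m2).
Qed.

(** All terms of the Leibniz expansion have the same weight z, which is 0 because the constant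
    coefficient is nonzero; positive weights leave only the constant monomial. The weight is an
    integer since s_i + s_j - t may be negative at a zero entry. *)
Lemma weighted_det_const (T : 'M[{mpoly k[r]}]_m) (s : 'I_m -> nat) t :
  (forall i j a, (T i j)@_a != 0 -> (wdeg d a + t = s i + s j)%N) ->
  \det (\matrix_(i, j) (T i j)@_0%MM) != 0 ->
  exists dinv, \det T * dinv = 1.
Proof.
move=> hT det0; pose z : int := \sum_i ((s i)%:Z *+ 2 - t%:Z).
have Wdet : W z (\det T).
  suff Wterm (g : {perm 'I_m}) : W z (\prod_i T i (g i)).
    move=> a; rewrite (raddf_sum (mcoeff a)) /= => h.
    have [[g hg]|ng] := pselect (exists g : {perm 'I_m}, (\prod_i T i (g i))@_a != 0).
      exact: Wterm hg.
    case/eqP: h; apply: big1 => g _.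
    have [e|e] := eqVneq (\prod_i T i (g i))@_a 0; last by case: ng; exists g.
    by case: (odd_perm g); rewrite ?expr1 ?expr0 ?mulN1r ?mul1r ?mcoeffN e ?oppr0.
  have -> : z = \sum_i ((s i)%:Z + (s (g i))%:Z - t%:Z).
    have e : \sum_i (s (g i))%:Z = \sum_i (s i)%:Z.
      by rewrite [RHS](reindex_inj (@perm_inj _ g)).
    by rewrite /z !sumrB [in RHS]big_split /= e -big_split.
  apply: (big_ind2 W) => [a|*|i _ a].
  - by rewrite mcoeff1; have [->|_] := eqVneq a 0%MM; rewrite ?wdeg0 ?eqxx.
  - exact: WM.
  - by move/hT => e; lia.
pose c := \det (\matrix_(i, j) (T i j)@_0%MM).
have one : (1 : {mpoly k[r]})@_0%MM = 1 by rewrite mcoeff1 eqxx.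
have [f fE] := @rmorphism_of_fun _ _ (fun p : {mpoly k[r]} => p@_0%MM)
  (fun p q => mcoeffD _ p q) (@mcoeff0M r k) one.
have det_coeff0 : (\det T)@_0%MM = c.
  rewrite -fE -det_map_mx; congr (\det _); apply/matrixP => i j; rewrite !mxE.
  exact: fE.
have z0 : z = 0 by rewrite -(Wdet 0%MM) ?wdeg0 // det_coeff0.
have -> : \det T = c%:MP.
  apply/mpolyP => a; rewrite mcoeffC; have [->|a0] := eqVneq a 0%MM; last rewrite mulr0.
    by rewrite mulr1 det_coeff0.
  apply/eqP; apply: contraNT a0 => /Wdet; rewrite z0 => e.
  by rewrite -mdeg_eq0; move: (wdeg_ge a d0); lia.
by exists c^-1%:MP; rewrite -mpolyCM divff.
Qed.
End WeightedDet.

Section SatGorenstein.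
Variables (k : fieldType) (n r m : nat).
Variables (y : 'I_r -> {mpoly k[n.+1]}) (mu : 'I_m -> 'X_{1..n.+1}) (d : 'I_r -> nat).
Variables (E : set {mpoly k[n.+1]}) (l0 : 'I_m).
Hypotheses (hE : homog_ideal E) (d0 : forall i, (0 < d i)%N)
  (gen : forall e, gen_in_degree y mu d (sat E) e)
  (ind : forall c, sat E (comb y mu c) -> forall l, c l = 0)
  (pairing : forall c,
    (forall i j, sat E ('X_[mu i] * 'X_[mu j] - comb y mu (c i j))) ->
    \det (\matrix_(i, j) (c i j l0)@_0%MM) != 0).

Lemma free_basis_arith_gorenstein : arith_gorenstein E.
Proof.
have idS := sat_ideal hE.
have S1 : ~ sat E 1.
  move=> S1; have [] := elimN eqP (oner_neq0 {mpoly k[r]}).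
  have := ind (c := fun l => if l == l0 then 1 else 0) _ l0; rewrite eqxx; apply.
  by rewrite comb_delta -[_ * _]mulr1; apply: (idealMl idS).
have [Q [pi quot]] := exists_quotient idS S1; exists Q, pi; split=> //.
case: (quot) => surj ker.
have [sg sgE] : exists sg : {rmorphism {mpoly k[r]} -> Q}, forall q, sg q = pi (subst y q).
  apply: rmorphism_of_fun => [p q|p q|]; rewrite ?substD ?substM ?rmorphD ?rmorphM //.
  by rewrite -mpolyC1 substC rmorph1.
have piC c : pi (comb y mu c) = \sum_l sg (c l) * pi 'X_[mu l].
  by rewrite rmorph_sum; apply: eq_bigr => l _; rewrite rmorphM sgE.
(* The expansions are chosen homogeneous of the degree of the product, as the weight argument for
   the determinant requires. *)
have /choice[c hc] (x : 'I_m * 'I_m) : exists c,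
    comb_homog mu d (mdeg (mu x.1) + mdeg (mu x.2)) c /\
    sat E ('X_[mu x.1] * 'X_[mu x.2] - comb y mu c).
  by apply: gen; apply: dhomogM; apply: dhomog_mpolyX.
have [||dinv dinvE] := @weighted_det_const k r m d d0
    (\matrix_(i, j) c (i, j) l0) (mdeg \o mu) (mdeg (mu l0)).
- by move=> i j a; rewrite mxE => h; case: (hc (i, j)) => /(_ _ _ h).
- have := pairing (c := fun i j => c (i, j)) (fun i j => (hc (i, j)).2).
  by congr (\det _ != 0); apply/matrixP => i j; rewrite !mxE.
apply: (frobenius_gorenstein (sg := sg) (e := fun l => pi 'X_[mu l]) (l0 := l0)
  (c := fun i j => c (i, j)) (dinv := dinv)) => //.
- exact: (noetherian_quotient (@noetherian_mpoly k n.+1) surj).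
- move=> a; have [f <-] := surj a.
  have /choice[c' hc'] e := gen (pihomogP mdeg e f).
  exists (fun l => \sum_(e < msize f) c' e l); rewrite -piC.
  apply/eqP; rewrite -subr_eq0 -rmorphB; apply/eqP/ker.
  rewrite {1}[f](@pihomog_partitionE _ _ mdeg _ f (leqnn _)) comb_sum -sumrB.
  by apply: (ideal_sum idS) => e _; case: (hc' e).
- by move=> c'; rewrite -piC => /ker; apply: ind.
- move=> i j; rewrite -piC -rmorphM; apply/eqP; rewrite -subr_eq0 -rmorphB; apply/eqP/ker.
  by case: (hc (i, j)).
Qed.
End SatGorenstein.

(** * Specialization of relations to a fibre *)

Section Specialize.
Variables (n : nat) (A : comNzRingType) (I : set {mpoly A[n.+1]}).
Hypothesis hI : homog_ideal I.
Variables (r m : nat) (d : 'I_r -> nat) (Y : 'I_r -> {mpoly A[n.+1]})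
  (mu : 'I_m -> 'X_{1..n.+1}).
Variables (k : fieldType) (psi : {rmorphism A -> k}).
Let y i := map_mpoly psi (Y i).
Let E := ext_ideal psi I.

Let idE : is_ideal E. Proof. exact: ext_ideal_ideal. Qed.
Let hE : homog_ideal E. Proof. exact: ext_ideal_homog. Qed.

Lemma spread_specialize u f : psi f != 0 ->
  (forall g, g \is u.-homog -> exists C, comb_homog mu d u C /\ I (f *: g - comb Y mu C)) ->
  gen_in_degree y mu d E u.
Proof.
move=> f0 spr g hg; have [N [X [Xu gE]]] := homog_monomials k n.+1 u.
have /choice[C hC] (i : 'I_N) : exists C, comb_homog mu d u C /\ I (f *: 'X_[X i] - comb Y mu C).
  by apply: spr; rewrite -(Xu i); apply: dhomog_mpolyX.
exists (fun l => \sum_i (g@_(X i) / psi f) *: map_mpoly psi (C i l)); split.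
  apply: comb_homog_sum => i l a; rewrite mcoeff_map => h; case: (hC i) => hCi _.
  by apply: hCi; apply: contraNneq h => ->; rewrite rmorph0.
rewrite comb_sum {1}(gE g hg) -sumrB; apply: (ideal_sum idE) => i _.
have [_ hCi] := hC i; have h := @map_ext_ideal n A I k psi _ hCi.
rewrite combZ -map_comb; set w := map_mpoly psi (comb _ _ _).
have -> : g@_(X i) *: 'X_[X i] - (g@_(X i) / psi f) *: w =
    (g@_(X i) / psi f) *: map_mpoly psi (f *: 'X_[X i] - comb Y mu (C i)).
  by rewrite mapmB mapmZ mapmX scalerBr scalerA divfK.
by rewrite -mul_mpolyC; apply: (idealMl idE).
Qed.

(** Over [A] only the multiples of the products by Y_o^a have been expanded. By uniqueness of
    coordinates in the fibre, C specializes to f X_o^a c, so its coefficient at X_o^a is [psi f]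
    times the constant term of c. *)
Lemma pairing_specialize o a f (l0 : 'I_m) (C : 'I_m -> 'I_m -> 'I_m -> {mpoly A[r]})
    (c : 'I_m -> 'I_m -> 'I_m -> {mpoly k[r]}) :
  (forall c, sat E (comb y mu c) -> forall l, c l = 0) ->
  (forall i j, I (f *: (Y o ^+ a * ('X_[mu i] * 'X_[mu j])) - comb Y mu (C i j))) ->
  (forall i j, sat E ('X_[mu i] * 'X_[mu j] - comb y mu (c i j))) ->
  psi (\det (\matrix_(i, j) (C i j l0)@_(U_(o) *+ a)%MM)) =
  psi f ^+ m * \det (\matrix_(i, j) (c i j l0)@_0%MM).
Proof.
move=> ind hC hc; have idS := sat_ideal hE.
rewrite -detZ -det_map_mx; congr (\det _); apply/matrixP => i j; rewrite !mxE.
have e l : map_mpoly psi (C i j l) - psi f *: ('X_[U_(o) *+ a] * c i j l) = 0.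
  move: l; apply: ind; rewrite combB combZ combM subst_XUn -map_comb.
  have h1 := sub_sat hE (@map_ext_ideal n A I k psi _ (hC i j)).
  rewrite mapmB mapmZ !mapmM mapmXn !mapmX in h1.
  have h2 : sat E ((psi f *: y o ^+ a) * ('X_[mu i] * 'X_[mu j] - comb y mu (c i j))).
    exact: (idealMl idS).
  have := idealB idS h2 h1; congr (sat E _).
  rewrite mulrBr -!scalerAl scalerAr.
  move: (_ *: _) (map_mpoly _ _) (_ *: _).
  by move=> u v w; ring.
have /mpolyP/(_ (U_(o) *+ a)%MM) := e l0.
rewrite mcoeffB mcoeff_map mcoeffZ mcoeff_mulX lepm_refl.
have -> (a0 : 'X_{1..r}) : (a0 - a0)%MM = 0%MM :> 'X_{1..r} by apply/mnmP => s; rewrite mnmBE subnn mnm0E.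
rewrite mcoeff0.
by move/eqP; rewrite subr_eq0 => /eqP.
Qed.
End Specialize.

(** * Spreading the Gorenstein property from a point *)

Theorem arith_gorenstein_spread (n : nat) (A : comNzRingType) (I : set {mpoly A[n.+1]})
    (k : fieldType) (phi : {rmorphism A -> k}) (p : {poly rat}) :
  homog_ideal I -> (forall c : k, exists a s, phi s != 0 /\ phi s * c = phi a) ->
  (1 < size p)%N -> has_hilbert_poly (ext_ideal phi I) p ->
  arith_gorenstein (ext_ideal phi I) ->
  exists f, phi f != 0 /\ forall (k' : fieldType) (psi : {rmorphism A -> k'}),
    psi f != 0 -> has_hilbert_poly (ext_ideal psi I) p ->
    arith_gorenstein (ext_ideal psi I).
Proof.
move=> hI frac p1 [t0 hilb] [Q [pi [quot gor]]].
pose E := ext_ideal phi I; have hE : homog_ideal E by apply: ext_ideal_homog.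
(* The regular sequence is to consist of forms that lift to [A]; clearing denominators makes every
   form liftable up to a nonzero scalar. *)
pose adm e y := exists2 Y : {mpoly A[n.+1]}, Y \is e.-homog & map_mpoly phi Y = y.
have [||r [m [d [y [mu [l0 [hy gen ind det]]]]]]] :=
  gorenstein_free_basis (adm := adm) _ _ (sat_homog hE) quot gor.
- by move=> e y [Y hY <-]; apply: map_mpoly_homog.
- move=> e y hy; have [s [P [s0 sP]]] := clear_denominators frac y.
  exists (phi s); split=> //; exists (pihomog mdeg e P); first exact: pihomogP.
  by rewrite -pihomog_map -sP linearZ /= pihomog_dE.
have d0 i : (0 < d i)%N by case: (hy i).
have /choice[Y hY] i : exists Y : {mpoly A[n.+1]}, Y \is (d i).-homog /\ map_mpoly phi Y = y i.
  by case: (hy i) => _ [Y ? ?]; exists Y.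
have Yh i : Y i \is (d i).-homog by case: (hY i).
have yE : y = fun i => map_mpoly phi (Y i) by apply/funext => i; case: (hY i).
have map_hom (B : comNzRingType) (g : {rmorphism A -> B}) i : map_mpoly g (Y i) \is (d i).-homog.
  exact: map_mpoly_homog.
rewrite {}yE in hy gen ind det.
have [ts sat_ts] := sat_eventually hE.
have gen_u u : (ts <= u)%N -> gen_in_degree (fun i => map_mpoly phi (Y i)) mu d E u.
  move=> tu g hg; have [c Sc] := gen g; exists (comb_proj mu d u c).
  split; first exact: comb_proj_homog.
  have e : g - comb (fun i => map_mpoly phi (Y i)) mu (comb_proj mu d u c) =
      pihomog mdeg u (g - comb (fun i => map_mpoly phi (Y i)) mu c).
    by rewrite linearB /= (pihomog_comb mu (map_hom _ phi)) pihomog_dE.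
  apply: (sat_ts u _ tu); rewrite e; first exact: pihomogP.
  exact: (sat_homog hE).2.
have card_u u : (maxn ts t0 <= u)%N -> p.[u%:R] = #|comb_index mu d u|%:R.
  rewrite geq_max => /andP[tu t0u]; have [q [hq ->]] := hilb u t0u.
  rewrite (hilbert_fun_card hE d0 (map_hom _ phi) hq (gen_u u tu)) // => c _ Ec.
  by apply: ind; apply: (sub_sat hE).
(* With at most one y_i, each degree contains at most [m] products y^a X_[mu l], so [p] would take
   finitely many values at large integers. *)
have r1 : (1 < r)%N.
  rewrite ltnNge; apply: contraL p1 => r1; rewrite -leqNgt.
  apply: (poly_finite_values (t0 := maxn ts t0) (N := m)) => u tu.
  by exists #|comb_index mu d u|; [exact: comb_index_le | exact: card_u].
pose o : 'I_r := Ordinal (ltnW r1); pose o' : 'I_r := Ordinal r1.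
(* [t1] exceeds every degree of a basis monomial, as the window argument requires, and is at least
   [ts], beyond which the fibre agrees with its saturation; [dl] bounds all d_i and is the length of
   the window. *)
pose t1 := ((\sum_l mdeg (mu l)).+1 + ts)%N; pose dl := (\sum_i d i)%N.
have tst1 : (ts <= t1)%N by rewrite leq_addl.
have mut l : (mdeg (mu l) < t1)%N by rewrite /t1 (bigD1 l) //=; lia.
have ddl i : (d i <= dl)%N by rewrite /dl (bigD1 i) //= leq_addr.
(* Degree of Y_o^t1 times a product of two basis monomials; these degrees are added to the window so
   that a single [f] serves both generation and the pairing. *)
pose v (x : 'I_m * 'I_m) := (d o * t1 + (mdeg (mu x.1) + mdeg (mu x.2)))%N.
pose us := iota t1 dl.+1 ++ [seq v x | x <- enum [set: 'I_m * 'I_m]%SET].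
have us_ts : {in us, forall u, (ts <= u)%N}.
  move=> u; rewrite mem_cat => /orP[|/mapP[x _ ->]].
    by rewrite mem_iota => /andP[+ _]; apply: leq_trans.
  by apply: (leq_trans tst1); rewrite /v; move: (d0 o); nia.
have [f [f0 hf]] := spread_degrees hI frac Yh gen sat_ts us_ts.
have /choice[C hC] (x : 'I_m * 'I_m) : exists C,
    I (f *: (Y o ^+ t1 * ('X_[mu x.1] * 'X_[mu x.2])) - comb Y mu C).
  have vus : v x \in us by rewrite mem_cat map_f ?orbT // mem_enum finset.in_setT.
  have [|C [_ IC]] := hf _ vus (Y o ^+ t1 * ('X_[mu x.1] * 'X_[mu x.2])); last by exists C.
  apply: dhomogM; first exact: dhomogMn.
  by apply: dhomogM; apply: dhomog_mpolyX.
pose tau := \det (\matrix_(i, j) (C (i, j) l0)@_(U_(o) *+ t1)%MM).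
exists (f * tau); split.
  have /choice[c hc] (x : 'I_m * 'I_m) := gen ('X_[mu x.1] * 'X_[mu x.2]).
  rewrite rmorphM mulf_neq0 //.
  rewrite (pairing_specialize hI l0 (c := fun i j => c (i, j)) ind (fun i j => hC (i, j))
    (fun i j => hc (i, j))).
  by rewrite mulf_neq0 ?expf_neq0 //; exact: (det (fun i j => c (i, j)) (fun i j => hc (i, j))).
move=> k' psi; rewrite rmorphM mulf_eq0 negb_or => /andP[psif psit] [t0' hilb'].
have hE' := ext_ideal_homog hI psi.
have gen' u : (t1 <= u)%N -> gen_in_degree (fun i => map_mpoly psi (Y i)) mu d (ext_ideal psi I) u.
  apply: (gen_in_degree_window hE' d0 (map_hom _ psi) mut ddl) => w tw.
  have wus : w \in us by rewrite mem_cat mem_iota addnS ltnS tw.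
  exact: (spread_specialize psif (hf w wus)).
have ind' u : (maxn t1 (maxn t0 t0') <= u)%N ->
    ind_in_degree (fun i => map_mpoly psi (Y i)) mu d (ext_ideal psi I) u.
  rewrite !geq_max => /and3P[tu t0u t0u'].
  apply: (card_ind_in_degree hE' d0 (map_hom _ psi)) (gen' _ tu).
  have [q [hq e]] := hilb' u t0u'; suff -> : #|comb_index mu d u| = q by [].
  by apply/eqP; rewrite -(Num.Theory.eqr_nat rat) -e card_u // geq_max (leq_trans tst1 tu).
have ind_all := sat_ind hE' d0 (map_hom _ psi) ind' o.
apply: (free_basis_arith_gorenstein (l0 := l0) hE' d0 _ ind_all).
  move=> e; apply: (sat_gen hE' d0 (map_hom _ psi) gen' ind' (o := o) (o' := o')).
  by [].
move=> c hc.
have := pairing_specialize hI l0 ind_all (fun i j => hC (i, j)) hc.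
by move=> e; move: psit; rewrite [psi tau]e mulf_eq0 negb_or => /andP[].
Qed.

(** * Residue fields *)

Lemma exists_residue_field_of_prime (A : comNzRingType) (P : set A) : prime_ideal P ->
  exists (k : fieldType) (rho : {rmorphism A -> k}), (forall a, rho a = 0 <-> P a) /\
    forall c, exists a s, rho s != 0 /\ rho s * c = rho a.
Proof.
move=> primeP; case: (primeP) => idP P1 PM.
have [B [pi [surj ker]]] := exists_quotient idP P1.
have prime0 : prime_ideal [set b : B | b = 0].
  split.
  - split=> [//|a b /= -> ->|a b /= ->]; by rewrite ?addr0 ?mulr0.
  - by rewrite /= => /eqP; rewrite oner_eq0.
  - move=> a b /=; have [a' <-] := surj a; have [b' <-] := surj b.
    by rewrite -rmorphM => /ker/PM[]/ker ->; [left|right].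
have [L [phi [inv frac ker0]]] := exists_localization prime0.
have phi0 b : phi b = 0 -> b = 0.
  case/ker0 => s [s0 sb0]; case: prime0 => _ _ h.
  by case: (h s b sb0).
have Linv (l : L) : l != 0 -> exists l', l * l' = 1.
  move=> l0; have [a [s [s0 sl]]] := frac l.
  have [u su] := inv s s0.
  have a0 : ~ a = 0.
    move=> a0; case/eqP: l0; move: sl; rewrite a0 rmorph0 => sl.
    by rewrite -[l]mul1r -su mulrAC sl mul0r.
  have [v av] := inv a a0; exists (phi s * v).
  by rewrite mulrA [l * _]mulrC sl.
have [k [f [g [fK gK]]]] := comring_field Linv.
exists k, (f \o phi \o pi : {rmorphism A -> k}); split=> [a /=|c].
  split=> [e|/ker ->]; last by rewrite !rmorph0.
  by apply/ker/phi0/(can_inj fK); rewrite e rmorph0.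
have [b [t [t0 tc]]] := frac (g c); have [a ab] := surj b; have [s st] := surj t.
exists a, s => /=; rewrite st ab -tc rmorphM gK; split=> //.
by apply/eqP => e; apply: t0; apply/phi0/(can_inj fK); rewrite e rmorph0.
Qed.

Section Points.
Variables (K : fieldType) (X : ringed_space K).
Implicit Types (U V W : nopen X) (x y : X).

Let nopen_refl U : U `<=` U. Proof. by []. Qed.

Lemma nopenI x V W : pts V x -> pts W x ->
  exists O : nopen X, [/\ pts O x, O `<=` V & O `<=` W].
Proof.
move=> Vx Wx; have ne : (pts V `&` pts W) !=set0 by exists x.
exists (Nopen (openI (nopen_open V) (nopen_open W)) ne).
by split=> // z [].
Qed.

Lemma germ_unit_res x U V (h : V `<=` U) (s : sec U) : pts V x ->
  germ_unit x (res X h s) <-> germ_unit x s.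
Proof.
move=> Vx; split=> [[W [hW [Wx [t st]]]]|[W [hW [Wx [t st]]]]].
  have hWU : W `<=` U by apply: subset_trans hW h.
  by exists W, hWU; split=> //; exists t; rewrite -(res_comp h hW).
have [O [Ox OV OW]] := nopenI Vx Wx; exists O, OV; split=> //.
have OU : O `<=` U by apply: subset_trans OV h.
exists (res X OW t); rewrite (res_comp h OV OU) -(res_comp hW OW OU).
by rewrite -rmorphM st rmorph1.
Qed.

Lemma germ_unitM x U (s t : sec U) :
  germ_unit x (s * t) <-> germ_unit x s /\ germ_unit x t.
Proof.
split=> [[W [hW [Wx [u stu]]]]|[[V [hV [Vx [u su]]]] [W [hW [Wx [v tv]]]]]].
  by split; exists W, hW; split=> //; [exists (res X hW t * u)|exists (res X hW s * u)];
    rewrite -stu rmorphM; ring.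
have [O [Ox OV OW]] := nopenI Vx Wx.
have OU : O `<=` U by apply: subset_trans OV hV.
exists O, OU; split=> //; exists (res X OV u * res X OW v).
have h1 : res X OU s * res X OV u = 1.
  by rewrite -(res_comp hV OV OU) -rmorphM su rmorph1.
have h2 : res X OU t * res X OW v = 1.
  by rewrite -(res_comp hW OW OU) -rmorphM tv rmorph1.
by rewrite rmorphM mulrACA h1 h2 mulr1.
Qed.

Lemma germ_unit1 x U : pts U x -> germ_unit x (1 : sec U).
Proof. by move=> Ux; exists U, (@nopen_refl U); split=> //; exists 1; rewrite rmorph1 mulr1. Qed.

Lemma germ_unit_res_eq0 x U V (h : V `<=` U) (s : sec U) : pts V x ->
  res X h s = 0 -> ~ germ_unit x s.
Proof.
move=> Vx s0 /(germ_unit_res h _ Vx)[W [hW [Wx [t]]]].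
by rewrite s0 rmorph0 mul0r => /esym/eqP; rewrite oner_eq0.
Qed.

Lemma point_ideal_prime U x : locally_ringed X -> pts U x -> prime_ideal (@point_ideal K X U x).
Proof.
move=> locX Ux; split.
- split; first exact: (germ_unit_res_eq0 (h := @nopen_refl U) Ux (rmorph0 _)).
    by move=> s t us ut /(locX _ _ _ _ Ux)[].
  by move=> s t ut /germ_unitM[].
- by apply; exact: germ_unit1.
- by move=> s t; rewrite /point_ideal /= germ_unitM => /not_andP.
Qed.

Lemma open_basic_open U (f : sec U) : open (basic_open f).
Proof.
rewrite openE => x [Ux [V [hV [Vx ut]]]].
apply: (@filterS _ _ _ V); last by apply: open_nbhs_nbhs; split; [exact: nopen_open|].
by move=> z Vz; split; [exact: (hV z Vz) | exists V, hV].
Qed.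

(** On a basic open of [U] contained in [V] the section is a fraction whose denominator is a power
    of the function defining that open. *)
Lemma affine_fraction U V x (s : sec V) : affine U -> pts U x -> pts V x ->
  exists (W : nopen X) (hV : W `<=` V) (hU : W `<=` U) (a b : sec U),
    [/\ pts W x, germ_unit x b & res X hU b * res X hV s = res X hU a].
Proof.
move=> [_ basis fracU] Ux Vx; have [O [Ox OU OV]] := nopenI Ux Vx.
have [g [gx gO]] := basis O x OU Ox.
have ne : basic_open g !=set0 by exists x.
pose W := Nopen (open_basic_open g) ne.
have WU : W `<=` U by apply: subset_trans OU.
have WV : W `<=` V by apply: subset_trans OV.
have [_ /(_ (res X WV s))[e [a ga]]] := fracU g W WU erefl.
exists W, WV, WU, a, (g ^+ e); split=> //; last by rewrite rmorphXn.
elim: e {ga} => [|e IHe]; first by rewrite expr0; exact: germ_unit1.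
by rewrite exprS; apply/germ_unitM; split=> //; case: gx.
Qed.

Lemma residue_field_frac x (k : fieldType) (r : residue_field x k) U (Ux : pts U x) :
  affine U -> forall c : k, exists a s, ev r Ux s != 0 /\ ev r Ux s * c = ev r Ux a.
Proof.
move=> affU c; have [V [Vx [s <-]]] := ev_surj r c.
have [W [hV [hU [a [b [Wx ub e]]]]]] := affine_fraction s affU Ux Vx.
exists a, b; split; first by apply/eqP => /ev_eq0.
by rewrite -(ev_res r Ux Wx hU b) -(ev_res r Vx Wx hV s) -rmorphM e ev_res.
Qed.

Section ResidueField.
Variables (U : nopen X) (y : X) (k : fieldType) (rho : {rmorphism sec U -> k}).
Hypotheses (affU : affine U) (Uy : pts U y)
  (ker : forall a, rho a = 0 <-> ~ germ_unit y a)
  (frac : forall c, exists a s, rho s != 0 /\ rho s * c = rho a).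

Let rho_neq0 a : rho a != 0 <-> germ_unit y a.
Proof.
split=> [/eqP r0|ua]; last by apply/eqP => /ker.
by apply: contrapT => /ker.
Qed.

(** The graph of evaluation at [y], through a local expression of [s] as a fraction a/b over [U];
    [value_uniq] shows independence of that expression. *)
Let value V (s : sec V) (c : k) := exists (W : nopen X) (hV : W `<=` V) (hU : W `<=` U) a b,
  [/\ pts W y, rho b != 0, res X hU b * res X hV s = res X hU a & rho b * c = rho a].

Let value_ex V (s : sec V) : pts V y -> exists c, value s c.
Proof.
move=> Vy; have [W [hV [hU [a [b [Wy ub e]]]]]] := affine_fraction s affU Uy Vy.
exists (rho a / rho b), W, hV, hU, a, b; split=> //; first exact/rho_neq0.
by rewrite mulrC divfK //; apply/rho_neq0.
Qed.

Let value2 V (s t : sec V) c e : value s c -> value t e ->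
  exists (W : nopen X) (hV : W `<=` V) (hU : W `<=` U) a b a' b',
  [/\ pts W y,
      [/\ rho b != 0, res X hU b * res X hV s = res X hU a & rho b * c = rho a]
    & [/\ rho b' != 0, res X hU b' * res X hV t = res X hU a' & rho b' * e = rho a']].
Proof.
move=> [W [hV [hU [a [b [Wy b0 es ec]]]]]] [W' [hV' [hU' [a' [b' [Wy' b0' es' ec']]]]]].
have [O [Oy OW OW']] := nopenI Wy Wy'.
have OV : O `<=` V := subset_trans OW hV.
have OU : O `<=` U := subset_trans OW hU.
exists O, OV, OU, a, b, a', b'; split=> //; split=> //.
  rewrite -(res_comp hU OW OU b) -(res_comp hV OW OV s) -rmorphM es.
  exact: res_comp.
rewrite -(res_comp hU' OW' OU b') -(res_comp hV' OW' OV t) -rmorphM es'.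
exact: res_comp.
Qed.

Let value_uniq V (s : sec V) c e : value s c -> value s e -> c = e.
Proof.
move=> sc se; have [W [hV [hU [a [b [a' [b' [Wy [b0 es ec] [b0' es' ec']]]]]]]]] := value2 sc se.
have z : rho (b' * a - b * a') = 0.
  apply/ker; apply: (germ_unit_res_eq0 (h := hU) Wy).
  by rewrite rmorphB !rmorphM /= -es -es'; ring.
apply: (mulfI b0); apply: (mulfI b0'); apply/eqP; rewrite -subr_eq0 ec mulrCA ec'.
by rewrite -!rmorphM -rmorphB z.
Qed.

Let value1 V : pts V y -> value (1 : sec V) 1.
Proof.
move=> Vy; have [O [Oy OU OV]] := nopenI Uy Vy.
by exists O, OV, OU, 1, 1; rewrite !rmorph1 oner_eq0 !mulr1.
Qed.

Let valueD V (s t : sec V) c e : value s c -> value t e -> value (s + t) (c + e).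
Proof.
move=> sc te; have [W [hV [hU [a [b [a' [b' [Wy [b0 es ec] [b0' es' ec']]]]]]]]] := value2 sc te.
exists W, hV, hU, (a * b' + a' * b), (b * b'); split=> //.
- by rewrite rmorphM mulf_neq0.
- by rewrite !rmorphD !rmorphM /= -es -es'; ring.
- by rewrite !rmorphD !rmorphM -ec -ec'; ring.
Qed.

Let valueM V (s t : sec V) c e : value s c -> value t e -> value (s * t) (c * e).
Proof.
move=> sc te; have [W [hV [hU [a [b [a' [b' [Wy [b0 es ec] [b0' es' ec']]]]]]]]] := value2 sc te.
exists W, hV, hU, (a * a'), (b * b'); split=> //.
- by rewrite rmorphM mulf_neq0.
- by rewrite !rmorphM /= -es -es'; ring.
- by rewrite !rmorphM -ec -ec'; ring.
Qed.

Let value_rmorphism V : pts V y -> exists f : {rmorphism sec V -> k}, forall s, value s (f s).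
Proof.
move=> Vy; have /choice[f hf] (s : sec V) := value_ex s Vy.
have [| | |g gE] := @rmorphism_of_fun (sec V) k f.
- by move=> s t; apply: (value_uniq (hf _)); apply: valueD.
- by move=> s t; apply: (value_uniq (hf _)); apply: valueM.
- by apply: (value_uniq (hf _)); apply: value1.
by exists g => s; rewrite gE.
Qed.

(** Membership in the locus asks for a residue field at the point, so one has to be produced at
    every point near the given one. *)
Lemma exists_residue_field : inhabited (residue_field y k).
Proof.
pose evf V (Vy : pts V y) := projT1 (cid (value_rmorphism Vy)).
have evfP V (Vy : pts V y) s : value s (evf V Vy s) := projT2 (cid (value_rmorphism Vy)) s.
apply: inhabits; apply: (@ResidueField K X y k evf).
- move=> V V' Vy Vy' h s; apply: value_uniq (evfP V Vy s).
  have [W [hV [hU [a [b [Wy b0 es ec]]]]]] := evfP V' Vy' (res X h s).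
  have WV : W `<=` V := subset_trans hV h.
  by exists W, WV, hU, a, b; split=> //; rewrite -(res_comp h hV WV).
- move=> c; have [a [s [s0 sc]]] := frac c.
  have [V [hV [Vy [t st]]]] := (rho_neq0 s).1 s0.
  exists V, Vy, (res X hV a * t); apply: value_uniq (evfP _ _ _) _.
  exists V, (@nopen_refl V), hV, a, s; split=> //.
  by rewrite res_id mulrCA st mulr1.
- move=> V Vy s; have [W [hV [hU [a [b [Wy b0 es ec]]]]]] := evfP V Vy s.
  have ub := (rho_neq0 b).1 b0.
  have -> : evf V Vy s = 0 <-> rho a = 0.
    rewrite -ec; split=> [->|/eqP]; first by rewrite mulr0.
    by rewrite mulf_eq0 (negbTE b0) => /eqP.
  rewrite ker -(germ_unit_res hU a Wy) -(germ_unit_res hV s Wy) -es germ_unitM.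
  have h := (germ_unit_res hU b Wy).2 ub.
  by split=> [n u|n [_ u]]; apply: n.
Qed.
End ResidueField.
End Points.

(** * Openness on the Hilbert scheme *)

Theorem corollary5p5 (K : fieldType) (n : nat) (p : {poly rat})
  (hp : is_hilbert_polynomial K n p) (hnc : (1 < size p)%N)
  (H : ringed_space K) (Z : closed_subscheme n H)
  (hH : is_hilbert_scheme p Z) :
  open (arith_gorenstein_locus Z).
Proof.
case: hH => [[locH _] flatZ _].
rewrite openE => x [kappa [r [U [Ux [affU gorx]]]]].
have [_ hilb] := flatZ U affU.
have [f [f0 hf]] := arith_gorenstein_spread (ideal_at_homog Z affU)
  (residue_field_frac r Ux affU) hnc (hilb x kappa r Ux) gorx.
have fx : basic_open f x by split=> //; apply: contrapT => /(ev_eq0 r Ux)/eqP; apply/negP.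
apply: (@filterS _ _ _ (basic_open f)); last first.
  by apply: open_nbhs_nbhs; split; [exact: open_basic_open|].
move=> y [Uy fy].
(* The fraction field of O(U) modulo the prime at which [y] lies serves as residue field at [y]. *)
have [k [rho [ker frac]]] := exists_residue_field_of_prime (point_ideal_prime locH Uy).
have [r'] := exists_residue_field affU Uy ker frac.
exists k, r', U, Uy; split=> //.
apply: hf; last exact: hilb.
by apply/eqP => /(ev_eq0 r' Uy).
Qed.
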